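(* Let $G_0(x,y,\lambda)$ and $G(x,y,\lambda)$ be the Green functions of $\mathbb L_0-\lambda$ and $\mathbb L-\lambda$ respectively, where $\mathbb L$ is generated by the differential expression $\ell$ and the (Birkhoff regular) boundary conditions (BC), and $\mathbb L_0$ is generated by $(-i)^nD^n$ and the same boundary conditions (BC), as described in the context. Let $\{\lambda_N^0\}_{N\ge1}$ be the eigenvalues of $\mathbb L_0$. Then for every sequence $R=R_l\to\infty$ separated from $|\lambda^0_N|^{1/n}$ the integral $$\int\limits_{|\lambda|=R^{n}} |(G_0-G)(x,y,\lambda)|\,|d\lambda|$$ tends to zero (as $l\to\infty$) uniformly in $x,y\in[a,b]$.
   Context: Let $[a,b]$ be a finite segment ($a<b$), $n\ge 2$ an integer, $D=d/dx$, and $$\ell=(-i)^nD^n+\sum_{k=0}^{n-2}p_k(x)D^k,$$ where $p_k\in L^1([a,b])$ are (possibly non-real) summable functions. Let $P_j,Q_j$, $j\in\{0,\dots,n-1\}$, be polynomials (with complex coefficients) of degree at most $n-1$; they define $n$ (linearly independent) boundary conditions $$\text{(BC)}\qquad P_j(D)y(a)+Q_j(D)y(b)=0,\quad j\in\{0,\dots,n-1\}.$$ Let $d_j$ be the maximum of the degrees of $P_j$ and $Q_j$, and let $a_j$, $b_j$ be the coefficients of the $d_j$-th power in $P_j$, $Q_j$ respectively. The system (BC) is assumed to be normalized, i.e. $\sum_j d_j$ is minimal among all systems of boundary conditions obtained from (BC) by invertible linear transformations, and Birkhoff regular. With $\rho=e^{2\pi i/n}$, $\nu_1=[\frac{n+1}{2}]$,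 $\nu_2=[\frac n2]$, Birkhoff regularity of normalized conditions means that for $\kappa=1,2$ the $n\times n$ matrix whose $(j,k)$ entry ($j,k\in\{1,\dots,n\}$) is $\rho^{(k-1)d_{j-1}}a_{j-1}$ for $k\le\nu_\kappa$ and $\rho^{(k-1)d_{j-1}}b_{j-1}$ for $k>\nu_\kappa$ is non-degenerate. $\mathbb L$ is the operator in $L^2([a,b])$ generated by $\ell$ and (BC) in the standard way: it acts as $y\mapsto \ell y$ on functions $y$ with $y,\dots,y^{(n-1)}$ absolutely continuous, $\ell y\in L^2$, satisfying (BC). It is not assumed to be self-adjoint. $\mathbb L_0$ is the operator generated by $(-i)^nD^n$ and the same conditions (BC). Both have purely discrete spectrum; eigenvalues are enumerated in ascending order of absolute value according to multiplicity. The Green function of $\mathbb L-\lambda$ is the integral kernel of the resolvent: $((\mathbb L-\lambda)^{-1}f)(x)=\int_a^bG(x,y,\lambda)f(y)\,dy$; similarly for $\mathbb L_0-\lambda$ and $G_0$. A sequence $R_l>0$ is separated from $|\lambda_N^0|^{1/n}$ if $\inf_{l,N}\big|R_l-|\lambda_N^0|^{1/n}\big|>0$. *)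

(* Defs.v *)
From HB Require Import structures.
From mathcomp Require Import all_boot all_order all_algebra.
From mathcomp Require Import complex.
From mathcomp Require Import all_classical all_reals all_analysis.

Set Implicit Arguments.
Unset Strict Implicit.
Unset Printing Implicit Defensive.

Import Order.TTheory GRing.Theory Num.Theory.
Import numFieldNormedType.Exports.

Local Open Scope classical_set_scope.
Local Open Scope ring_scope.

(* [cmod z] is the modulus of [z] as a real number; the library norm [`|z|]
   takes its values in [R[i]]. *)
Notation cmod := ComplexField.Normc.normc.

Definition expi (R : realType) (t : R) : R[i] := Complex (cos t) (sin t).

(* Functions are total on [R]; only their values on [a, b] matter, and equality
   is always required on [a, b] only. Limits, measurability and integrals are
   taken componentwise, on real and imaginary parts. *)

Definition eq_seg (R : realType) (a b : R) (f g : R -> R[i]) : Prop :=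
  forall x, a <= x <= b -> f x = g x.

Definition L1_seg (R : realType) (a b : R) (f : R -> R[i]) : Prop :=
  (@lebesgue_measure R).-integrable `[a, b] (EFin \o (fun x => complex.Re (f x)))
  /\ (@lebesgue_measure R).-integrable `[a, b]
       (EFin \o (fun x => complex.Im (f x))).

Definition sqnorm2_seg (R : realType) (a b : R) (f : R -> R[i]) : \bar R :=
  (\int[@lebesgue_measure R]_(x in `[a, b]) (cmod (f x) ^+ 2)%:E)%E.

Definition L2_seg (R : realType) (a b : R) (f : R -> R[i]) : Prop :=
  [/\ measurable_fun `[a, b] (fun x => complex.Re (f x)),
      measurable_fun `[a, b] (fun x => complex.Im (f x)) &
      (sqnorm2_seg a b f < +oo)%E].

Definition cintegral_seg (R : realType) (a b : R) (f : R -> R[i]) : R[i] :=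
  Complex (\int[@lebesgue_measure R]_(x in `[a, b]) complex.Re (f x))
          (\int[@lebesgue_measure R]_(x in `[a, b]) complex.Im (f x)).

Definition AC_seg (R : realType) (a b : R) (f : R -> R[i]) : Prop :=
  forall eps : R, 0 < eps -> exists2 delta : R, 0 < delta &
    forall (m : nat) (s t : 'I_m -> R),
      (forall i, [/\ a <= s i, s i <= t i & t i <= b]) ->
      trivIset setT (fun i => `]s i, t i[%classic) ->
      \sum_(i < m) (t i - s i) < delta ->
      \sum_(i < m) cmod (f (t i) - f (s i)) < eps.

(* The derivative at [x] of the restriction of [f] to [a, b] is [d]; it is
   one-sided at the end-points. *)
Definition is_derive_seg (R : realType) (a b : R) (f : R -> R[i]) (x : R)
    (d : R[i]) : Prop :=
  (fun t => (complex.Re (f t) - complex.Re (f x)) / (t - x))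
    @ within `[a, b]%classic x^' --> complex.Re d /\
  (fun t => (complex.Im (f t) - complex.Im (f x)) / (t - x))
    @ within `[a, b]%classic x^' --> complex.Im d.

(* The boundary conditions are P_j(D) y (a) + Q_j(D) y (b) = 0, j < n. *)

Definition lin_indep_bc (R : realType) (n : nat) (P Q : 'I_n -> {poly R[i]}) :
    Prop :=
  forall c : 'I_n -> R[i],
    \sum_(j < n) c j *: P j = 0 -> \sum_(j < n) c j *: Q j = 0 ->
    forall j, c j = 0.

Definition bc_order (R : realType) (n : nat) (P Q : 'I_n -> {poly R[i]})
    (j : 'I_n) : nat :=
  (maxn (size (P j)) (size (Q j))).-1.

Definition transform_bc (R : realType) (n : nat) (A : 'M[R[i]]_n)
    (P : 'I_n -> {poly R[i]}) : 'I_n -> {poly R[i]} :=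
  fun j => \sum_(i < n) A j i *: P i.

Definition normalized_bc (R : realType) (n : nat) (P Q : 'I_n -> {poly R[i]}) :
    Prop :=
  forall A : 'M[R[i]]_n, A \in unitmx ->
    (\sum_(j < n) bc_order P Q j <=
     \sum_(j < n) bc_order (transform_bc A P) (transform_bc A Q) j)%N.

(* Rows and columns are numbered from 0. *)
Definition birkhoff_mx (R : realType) (n : nat) (P Q : 'I_n -> {poly R[i]})
    (nu : nat) : 'M[R[i]]_n :=
  \matrix_(j < n, k < n)
    (expi (2%:R * pi / n%:R) ^+ (k * bc_order P Q j) *
     (if (k < nu)%N then (P j)`_(bc_order P Q j)
      else (Q j)`_(bc_order P Q j))).

Definition birkhoff_regular (R : realType) (n : nat)
    (P Q : 'I_n -> {poly R[i]}) : Prop :=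
  birkhoff_mx P Q (n.+1)./2 \in unitmx /\ birkhoff_mx P Q n./2 \in unitmx.

(* [diff_oper a b p P Q y f] says that [y] is in the domain of the operator in
   L^2([a, b]) generated by (-i)^n D^n + sum_(k <= n-2) p_k D^k and the boundary
   conditions, and that the operator maps [y] to [f]. The function [Y k] is the
   k-th derivative of [y]; for k = n it is only an a.e. derivative. *)
Definition diff_oper (R : realType) (a b : R) (n : nat)
    (p : 'I_n.-1 -> R -> R[i]) (P Q : 'I_n -> {poly R[i]})
    (y f : R -> R[i]) : Prop :=
  L2_seg a b f /\
  exists Y : nat -> R -> R[i],
    [/\ eq_seg a b (Y 0%N) y,
        forall k, (k < n)%N -> AC_seg a b (Y k),
        forall k, (k.+1 < n)%N -> forall x, a <= x <= b ->
          is_derive_seg a b (Y k) x (Y k.+1 x),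
        forall j, \sum_(k < n) (P j)`_k * Y k a +
                  \sum_(k < n) (Q j)`_k * Y k b = 0 &
        {ae @lebesgue_measure R, forall x, a <= x <= b ->
          is_derive_seg a b (Y n.-1) x (Y n x) /\
          f x = (- Complex 0 1) ^+ n * Y n x +
                \sum_(k < n.-1) p k x * Y k x}].

(* An operator in L^2([a, b]) is given by its graph: [T y f] means T y = f. *)

Definition oper (R : realType) := (R -> R[i]) -> (R -> R[i]) -> Prop.

(* (T - lam) y = f *)
Definition shift_oper (R : realType) (T : oper R) (lam : R[i]) : oper R :=
  fun y f => T y (fun x => f x + lam * y x).

Definition resolvent_set (R : realType) (a b : R) (T : oper R) (lam : R[i]) :
    Prop :=
  (forall f, L2_seg a b f -> exists2 y, shift_oper T lam y f &
     forall z, shift_oper T lam z f -> eq_seg a b z y) /\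
  (exists M : R, forall y f, L2_seg a b f -> shift_oper T lam y f ->
     (sqnorm2_seg a b y <= M%:E * sqnorm2_seg a b f)%E).

(* (T - lam)^m y = 0 *)
Fixpoint ker_pow (R : realType) (a b : R) (T : oper R) (lam : R[i]) (m : nat)
    (y : R -> R[i]) : Prop :=
  if m is m'.+1 then
    exists2 z, shift_oper T lam y z & ker_pow a b T lam m' z
  else eq_seg a b y (fun=> 0).

(* The root subspace (union of the kernels of the powers of T - lam) has
   dimension [m]; [m = 0] when [lam] is not an eigenvalue. *)
Definition alg_multiplicity (R : realType) (a b : R) (T : oper R) (lam : R[i])
    (m : nat) : Prop :=
  exists e : 'I_m -> R -> R[i],
    (forall i, exists k, ker_pow a b T lam k (e i)) /\
    (forall y, (exists k, ker_pow a b T lam k y) ->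
       exists! c : 'rV[R[i]]_m,
         eq_seg a b y (fun x => \sum_(i < m) c 0 i * e i x)).

(* The enumeration starts at index 0. *)
Definition eigenvalue_enum (R : realType) (a b : R) (T : oper R)
    (lam : nat -> R[i]) : Prop :=
  (forall N M : nat, (N <= M)%N -> cmod (lam N) <= cmod (lam M)) /\
  (forall mu : R[i], exists2 m : nat, alg_multiplicity a b T mu m &
     ([set N | lam N = mu] #= `I_m)%card).

(* A kernel of the resolvent is determined up to a.e. equality only. For an
   operator of order n >= 2 there is a unique kernel continuous on the closed
   square, and the Green function is that one. The values of [G] for [lam]
   outside the resolvent set are unconstrained. *)
Definition green_function (R : realType) (a b : R) (T : oper R)
    (G : R -> R -> R[i] -> R[i]) : Prop :=
  forall lam, resolvent_set a b T lam ->
    [/\ {within `[a, b] `*` `[a, b], continuous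
           (fun xy : R * R => complex.Re (G xy.1 xy.2 lam))},
        {within `[a, b] `*` `[a, b], continuous
           (fun xy : R * R => complex.Im (G xy.1 xy.2 lam))} &
        forall f y, L2_seg a b f -> shift_oper T lam y f ->
          forall x, a <= x <= b ->
            y x = cintegral_seg a b (fun t => G x t lam * f t)].

(* The integral of [h lam] against |d lam| over the circle |lam| = r. *)
Definition circle_integral (R : realType) (r : R) (h : R[i] -> R) : \bar R :=
  (\int[@lebesgue_measure R]_(t in `[0%R, (2%:R * pi)%R])
     (h (Complex r 0 * expi t) * r)%:E)%E.

Definition separated_from (R : realType) (n : nat) (Rad : nat -> R)
    (lam : nat -> R[i]) : Prop :=
  0 < inf [set `|Rad u.1 - powR (cmod (lam u.2)) (n%:R^-1)| | u in
             [set: nat * nat]].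

(* Main.v *)
(* Put lam = rho^n, r = i rho and eps = e^(2 pi i / n). The equation
   (L0 - lam) y = f becomes y^(n) = r^n y + i^n f, whose solutions combine the
   exponentials e^(r eps^k x) with a convolution of f; anchoring every exponential
   at the end-point where it has modulus 1 turns the boundary conditions into a
   linear system. Its determinant, with row j divided by r^(d_j), stays away from 0
   on |lam| = R_l^n. If no r eps^k is nearly imaginary, the matrix is close to a
   Birkhoff matrix up to a permutation of columns and invertible scalings.
   Otherwise the determinant is close to a quadratic polynomial in one exponential,
   and by the minimum modulus principle a small value forces a zero nearby, i.e.
   an eigenvalue of L0 in the gap provided by the separation of R_l.

   With s = R |sin arg lam| / n this gives |y^(j)(x)| <= C R^(j+1-n) int K_s |f|
   where K_s(x, t) = e^(-s|x-t|) + e^(-s|a-t|) + e^(-s|b-t|). Since l has no term of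
   order n - 1, the lower order terms are a perturbation of relative size C/R, so
   lam is in the resolvent set of L, and R^n |G0 - G|(x, y, lam) is at most
   C sum_k int K_s(x, t) |p_k(t)| dt. This is bounded, and tends to 0 uniformly in
   x as s tends to infinity, i.e. outside small arcs around the real lam. *)
Require Import Defs.
From HB Require Import structures.
From mathcomp Require Import all_boot all_order all_algebra.
From mathcomp Require Import fingroup perm complex.
From mathcomp Require Import all_classical all_reals all_analysis.
From mathcomp Require Import measurable_realfun.
From mathcomp Require Import ring lra zify.

Set Implicit Arguments.
Unset Strict Implicit.
Unset Printing Implicit Defensive.

Import Order.TTheory GRing.Theory Num.Theory.
Import numFieldNormedType.Exports.

Local Open Scope classical_set_scope.
Local Open Scope ring_scope.
Local Notation Re := complex.Re.
Local Notation Im := complex.Im.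
Local Notation "x %:C" := (real_complex _ x) : ring_scope.

(** * Complex exponential *)

(** Regularity is a condition on two initial segments of columns only, whereas the exponents r
    eps^k, as r rotates, produce every half-plane pattern of columns; a cyclic shift of the root
    index brings each of them back to one of the two. When a pair of opposite exponents crosses the
    imaginary axis, two patterns compete: the determinant is close to c0 + c1 z + c2 z^2, where c0
    and c2 are the nonzero determinants of the patterns on the two sides (c1 replaces c2 if no
    opposite exponent exists). Such a polynomial does vanish for some z, so the distance to the
    spectrum has to enter, and it enters through a whole disc of values of r. The minimum modulus
    principle on this disc is derived from the case of polynomials, with locally uniform limits of
    polynomials in the role of entire functions. All estimates have an L^1 norm of f on the right.
    This suits summable coefficients p_k, makes the lower order terms a contraction of L^1, and is
    exactly the form from which a pointwise bound of a continuous kernel can be read off. *)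

Lemma max0_lip (R : realType) (x y : R) : `|Num.max 0 x - Num.max 0 y| <= `|x - y|.
Proof.
rewrite ler_norml; case: (ltrP 0 x) => x0; case: (ltrP 0 y) => y0;
  have := ler_norm (x - y); have := ler_norm (- (x - y)); rewrite normrN => *;
  apply/andP; split; lra.
Qed.

(** * Modulus of complex numbers *)

Section Modulus.
Variable R : realType.
Implicit Types (x y z w : R[i]).

Lemma cmodE z : cmod z = Num.sqrt (Re z ^+ 2 + Im z ^+ 2).
Proof. by case: z. Qed.

Lemma cmod_ge0 z : 0 <= cmod z.
Proof. by rewrite cmodE sqrtr_ge0. Qed.

Lemma cmod_sqr z : cmod z ^+ 2 = Re z ^+ 2 + Im z ^+ 2.
Proof. by rewrite cmodE sqr_sqrtr ?addr_ge0 ?sqr_ge0. Qed.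

Lemma cmod0 : cmod (0 : R[i]) = 0.
Proof. exact: ComplexField.Normc.normc0. Qed.

Lemma cmod1 : cmod (1 : R[i]) = 1.
Proof. exact: ComplexField.Normc.normc1. Qed.

Lemma cmodM z w : cmod (z * w) = cmod z * cmod w.
Proof. exact: ComplexField.Normc.normcM. Qed.

Lemma cmodV z : cmod z^-1 = (cmod z)^-1.
Proof. exact: ComplexField.Normc.normcV. Qed.

Lemma cmodD z w : cmod (z + w) <= cmod z + cmod w.
Proof. exact: (@le_normcD R z w). Qed.

Lemma cmodN z : cmod (- z) = cmod z.
Proof. exact: (@normcN R z). Qed.

Lemma cmodB z w : cmod (z - w) <= cmod z + cmod w.
Proof. by rewrite (le_trans (cmodD _ _))// cmodN. Qed.

Lemma cmodBC z w : cmod (z - w) = cmod (w - z).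
Proof. by rewrite -cmodN opprB. Qed.

Lemma cmodX z n : cmod (z ^+ n) = cmod z ^+ n.
Proof.
by elim: n => [|n IH]; rewrite ?expr0 ?cmod1// !exprS cmodM IH.
Qed.

Lemma cmod_eq0 z : (cmod z == 0) = (z == 0).
Proof.
apply/eqP/eqP => [/(@ComplexField.Normc.eq0_normc R)//|->].
exact: cmod0.
Qed.

Lemma cmod_gt0 z : (0 < cmod z) = (z != 0).
Proof. by rewrite lt_def cmod_ge0 andbT cmod_eq0. Qed.

Lemma cmod_le0 z : cmod z <= 0 -> z = 0.
Proof. by move=> h; apply/eqP; rewrite -cmod_eq0 eq_le h cmod_ge0. Qed.

Lemma cmod_distB z w : cmod z - cmod w <= cmod (z - w).
Proof. by rewrite lerBlDr (le_trans _ (cmodD _ _))// subrK. Qed.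

Lemma cmodR (t : R) : cmod (t%:C : R[i]) = `|t|.
Proof. by rewrite cmodE /= expr0n addr0 sqrtr_sqr. Qed.

Lemma Re_le_cmod z : `|Re z| <= cmod z.
Proof.
by rewrite cmodE -sqrtr_sqr ler_sqrt ?addr_ge0 ?sqr_ge0// lerDl sqr_ge0.
Qed.

Lemma Im_le_cmod z : `|Im z| <= cmod z.
Proof.
by rewrite cmodE -sqrtr_sqr ler_sqrt ?addr_ge0 ?sqr_ge0// lerDr sqr_ge0.
Qed.

Lemma cmod_ReIm z : cmod z <= `|Re z| + `|Im z|.
Proof.
rewrite -(@ler_pXn2r _ 2) ?nnegrE ?cmod_ge0 ?addr_ge0//.
rewrite cmod_sqr sqrrD -!normrX !(ger0_norm (sqr_ge0 _)) lerD2r lerDl.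
by rewrite mulrn_wge0// mulr_ge0.
Qed.

Lemma cmod_sum (I : Type) (r : seq I) (P : pred I) (F : I -> R[i]) :
  cmod (\sum_(i <- r | P i) F i) <= \sum_(i <- r | P i) cmod (F i).
Proof.
elim/big_ind2 : _ => [|x u y v hx hy|//]; first by rewrite cmod0.
exact: le_trans (cmodD _ _) (lerD hx hy).
Qed.

Lemma cmod_prod (I : Type) (r : seq I) (P : pred I) (F : I -> R[i]) :
  cmod (\prod_(i <- r | P i) F i) = \prod_(i <- r | P i) cmod (F i).
Proof. by elim/big_ind2 : _ => [|x u y v <- <-|//]; [exact: cmod1|exact: cmodM]. Qed.

Lemma ReM z w : Re (z * w) = Re z * Re w - Im z * Im w.
Proof. by case: z; case: w. Qed.

Lemma ImM z w : Im (z * w) = Re z * Im w + Im z * Re w.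
Proof. by case: z => a b; case: w => c d. Qed.

Lemma ReD z w : Re (z + w) = Re z + Re w.
Proof. by case: z; case: w. Qed.

Lemma ImD z w : Im (z + w) = Im z + Im w.
Proof. by case: z; case: w. Qed.

Lemma ReN z : Re (- z) = - Re z. Proof. by case: z. Qed.

Lemma ImN z : Im (- z) = - Im z. Proof. by case: z. Qed.

Lemma ReB z w : Re (z - w) = Re z - Re w.
Proof. by rewrite ReD ReN. Qed.

Lemma ImB z w : Im (z - w) = Im z - Im w.
Proof. by rewrite ImD ImN. Qed.

Lemma complex_eqP z w : Re z = Re w -> Im z = Im w -> z = w.
Proof. by case: z => a b; case: w => c d /= -> ->. Qed.

(** Factor out x - y: the cofactor has [n.+1] terms of modulus at most m^n. *)
Lemma cmod_subX x y (m : R) n : cmod x <= m -> cmod y <= m ->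
  cmod (x ^+ n.+1 - y ^+ n.+1) <= n.+1%:R * m ^+ n * cmod (x - y).
Proof.
move=> xm ym; have m0 : 0 <= m := le_trans (cmod_ge0 _) xm.
rewrite subrXX cmodM mulrC ler_wpM2r ?cmod_ge0//.
apply: le_trans (cmod_sum _ _ _) _.
apply: le_trans (_ : \sum_(i < n.+1) m ^+ n <= _); last first.
  by rewrite sumr_const card_ord mulr_natl.
apply: ler_sum => i _; rewrite cmodM !cmodX.
have ilt : (i <= n)%N by rewrite -ltnS.
have -> : m ^+ n = m ^+ (n - i) * m ^+ i by rewrite -exprD subnK.
rewrite /=.
by apply: ler_pM; rewrite ?exprn_ge0 ?cmod_ge0// lerXn2r ?nnegrE ?cmod_ge0.
Qed.

End Modulus.

Section ComplexExponential.
Variable R : realType.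
Implicit Types (w z : R[i]) (t : R).

Definition cexp w : R[i] := (expR (Re w))%:C * expi (Im w).

Lemma Re_cexp w : Re (cexp w) = expR (Re w) * cos (Im w).
Proof. by rewrite /cexp ReM /= mul0r subr0. Qed.

Lemma Im_cexp w : Im (cexp w) = expR (Re w) * sin (Im w).
Proof. by rewrite /cexp ImM /= mul0r addr0. Qed.

Lemma expiD (s t : R) : expi (s + t) = expi s * expi t.
Proof.
by apply: complex_eqP; rewrite ?ReM ?ImM /= ?cosD ?sinD// addrC.
Qed.

Lemma expi0 : expi (0 : R) = 1.
Proof. by apply: complex_eqP; rewrite /= ?cos0 ?sin0. Qed.

Lemma cexpD z w : cexp (z + w) = cexp z * cexp w.
Proof.
rewrite /cexp ReD ImD expRD expiD.
have -> : (expR (Re z) * expR (Re w))%:C = (expR (Re z))%:C * (expR (Re w))%:C.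
  by rewrite rmorphM.
ring.
Qed.

Lemma cexp0 : cexp 0 = 1.
Proof. by rewrite /cexp /= expR0 expi0 mulr1. Qed.

Lemma cmod_expi t : cmod (expi t) = 1.
Proof. by rewrite /= cos2Dsin2 sqrtr1. Qed.

Lemma cmod_cexp w : cmod (cexp w) = expR (Re w).
Proof. by rewrite cmodM cmod_expi mulr1 cmodR ger0_norm ?expR_ge0. Qed.

Lemma cexp_neq0 w : cexp w != 0.
Proof. by rewrite -cmod_gt0 cmod_cexp expR_gt0. Qed.

Lemma cexpMn w n : cexp (w *+ n) = cexp w ^+ n.
Proof.
by elim: n => [|n IH]; rewrite ?mulr0n ?cexp0 ?expr0// mulrS cexpD IH exprS.
Qed.

Lemma expiMn t n : expi (t *+ n) = expi t ^+ n.
Proof.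
by elim: n => [|n IH]; rewrite ?mulr0n ?expi0 ?expr0// mulrS expiD IH exprS.
Qed.

Lemma sin_le_norm t : `|sin t| <= `|t|.
Proof.
wlog t0 : t / 0 <= t => [H|].
  case: (lerP 0 t) => [/H//|/ltW t0].
  by rewrite -normrN -sinN -(normrN t) H ?oppr_ge0.
have [<-|tn0] := eqVneq 0 t; first by rewrite sin0.
have t0' : 0 < t by rewrite lt_def eq_sym tn0.
have [c _ ] := @MVT_segment R (@sin R) (@cos R) 0 t t0
  (fun x _ => is_derive_sin x)
  (@continuous_subspaceT _ _ _ _ (@continuous_sin R)).
rewrite sin0 !subr0 => ->; rewrite normrM ler_piMl// cos_max//.
Qed.

(** Mean value theorem with the derivative controlled by [sin_le_norm]; the next lemma iterates the
    argument. The constants are not sharp. *)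
Lemma cos_sub1_bound t : `|cos t - 1| <= t ^+ 2.
Proof.
have [c c0t ] : exists2 c, c \in `[0, `|t|] & cos `|t| - cos 0 = - sin c * (`|t| - 0).
  apply: (@MVT_segment R (@cos R) (fun x => - sin x) 0 `|t| (normr_ge0 _)
    (fun x _ => is_derive_cos x)
    (@continuous_subspaceT _ _ _ _ (@continuous_cos R))).
rewrite cos_norm cos0 subr0 => ->; rewrite normrM normrN normr_id -real_normK ?num_real//.
rewrite expr2 ler_wpM2r// (le_trans (sin_le_norm c))//.
by move: c0t; rewrite in_itv/= => /andP[c0 ct]; rewrite ger0_norm.
Qed.

Lemma sin_sub_bound t : `|t| <= 1 -> `|sin t - t| <= t ^+ 2.
Proof.
move=> t1.
have D x : is_derive x (1:R) (fun x : R => sin x - x) (cos x - 1).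
  by apply: is_deriveB.
have C : continuous (fun x : R => sin x - x).
  move=> x; apply: cvgB; [exact: continuous_sin|exact: cvg_id].
wlog t0 : t t1 / 0 <= t => [H|].
  case: (lerP 0 t) => [/H->//|/ltW t0].
  have := H (- t); rewrite normrN t1 oppr_ge0 t0 sinN sqrrN => /(_ isT isT).
  by rewrite -opprD normrN.
have [c c0t] := @MVT_segment R (fun x => sin x - x) (fun x => cos x - 1) 0 t t0
    (fun x _ => D x) (@continuous_subspaceT _ _ _ _ C).
rewrite sin0 !subr0 => ->; rewrite normrM (ger0_norm t0) expr2 ler_wpM2r//.
apply: le_trans (cos_sub1_bound c) _.
move: c0t; rewrite in_itv/= => /andP[c0 ct].
rewrite (le_trans _ ct)// expr2 ler_piMl// (le_trans ct)//.
by rewrite (le_trans (ler_norm _)).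
Qed.

(** Only the tangent inequality is used: at [t] it gives the lower bound, at [- t] it gives e^t (1 -
    t) <= 1 and hence the upper one. *)
Lemma expR_sub1_bound t : `|t| <= 1 / 2 -> `|expR t - 1 - t| <= 2 * t ^+ 2.
Proof.
rewrite ler_norml => /andP[tl tu].
have h := expR_ge1Dx t; rewrite ger0_norm; last by lra.
have h2 := expR_ge1Dx (- t).
have e0 := expR_gt0 t.
have : expR t * (1 - t) <= 1.
  by rewrite (le_trans (ler_wpM2l (ltW e0) h2))// expRxMexpNx_1.
nra.
Qed.

Lemma cexp_sub1_bound w : cmod w <= 1 / 2 ->
  cmod (cexp w - 1 - w) <= 6 * cmod w ^+ 2.
Proof.
move=> w2; set x := Re w; set y := Im w.
have xw : `|x| <= cmod w := Re_le_cmod w.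
have yw : `|y| <= cmod w := Im_le_cmod w.
have m0 := cmod_ge0 w.
have Ex : `|expR x - 1 - x| <= 2 * x ^+ 2.
  by apply: expR_sub1_bound; apply: le_trans w2.
have Cy := cos_sub1_bound y.
have Sy : `|sin y - y| <= y ^+ 2 by apply: sin_sub_bound; lra.
(* The constant 6 is 2 + 3 + 1, one summand for each of the three pieces below. *)
have E : cexp w - 1 - w = (expR x - 1 - x)%:C * expi y
   + (1 + x)%:C * (Complex (cos y - 1) (sin y - y)) + Complex 0 (x * y).
  apply: complex_eqP; rewrite !(ReD,ImD,ReM,ImM,ReN,ImN,Re_cexp,Im_cexp) /= -/x -/y; ring.
rewrite E; apply: le_trans (cmodD _ _) _.
have h3 : cmod (Complex 0 (x * y)) <= cmod w ^+ 2.
  apply: le_trans (cmod_ReIm _) _; rewrite /= normr0 add0r normrM expr2.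
  by apply: ler_pM.
have h1 : cmod ((expR x - 1 - x)%:C * expi y) <= 2 * cmod w ^+ 2.
  rewrite cmodM cmod_expi mulr1 cmodR; apply: le_trans Ex _.
  by rewrite ler_wpM2l// -(real_normK (num_real x)) ler_pXn2r ?nnegrE.
have h2 : cmod ((1 + x)%:C * Complex (cos y - 1) (sin y - y)) <= 3 / 2 * (2 * cmod w ^+ 2).
  rewrite cmodM cmodR; apply: ler_pM => //; first exact: cmod_ge0.
    by apply: le_trans (ler_normD _ _) _; rewrite normr1; lra.
  apply: le_trans (cmod_ReIm _) _; rewrite /=.
  have : y ^+ 2 <= cmod w ^+ 2.
    by rewrite -(real_normK (num_real y)) ler_pXn2r ?nnegrE.
  lra.
have := cmodD ((expR x - 1 - x)%:C * expi y) ((1 + x)%:C * Complex (cos y - 1) (sin y - y)).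
by lra.
Qed.

(** For |w| <= 1/12 the quadratic error 6 |w|^2 is at most |w| / 2. The bound later keeps the values
    of an exponential at separated points apart. *)
Lemma cexp_sub1_lower w : cmod w <= 1 / 12 -> cmod w / 2 <= cmod (cexp w - 1).
Proof.
move=> w2; have h : cmod (cexp w - 1 - w) <= 6 * cmod w ^+ 2.
  by apply: cexp_sub1_bound; lra.
have := cmod_distB w (w - (cexp w - 1)).
have -> : w - (w - (cexp w - 1)) = cexp w - 1 by ring.
rewrite cmodBC.
have := cmod_ge0 w; nra.
Qed.

Lemma cexp_sub1_upper w : cmod w <= 1 / 2 -> cmod (cexp w - 1) <= 4 * cmod w.
Proof.
move=> w2; have h := cexp_sub1_bound w2.
have := cmodD (cexp w - 1 - w) w; rewrite subrK.
have := cmod_ge0 w; nra.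
Qed.

(** Both terms are powers of order N = [n.+1], of e^v and of 1 + v with v = w / N. The bases differ
    by O(1 / N^2) and have modulus at most e^(B / N), so [cmod_subX] loses only one factor N. *)
Lemma cexp_compound_bound (B : R) w n : cmod w <= B -> 2 * B <= n.+1%:R ->
  cmod (cexp w - (1 + w / n.+1%:R) ^+ n.+1) <= 6 * B ^+ 2 * expR B / n.+1%:R.
Proof.
move=> wB Bn; set N : R := n.+1%:R.
have N0 : 0 < N by rewrite ltr0n.
have B0 : 0 <= B := le_trans (cmod_ge0 _) wB.
set v := w / n.+1%:R.
have cN : cmod (n.+1%:R : R[i]) = N.
  have -> : (n.+1%:R : R[i]) = (N%:C) by rewrite /N rmorph_nat.
  by rewrite cmodR ger0_norm// ltW.
have vE : cmod v = cmod w / N by rewrite cmodM cmodV cN.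
have vB : cmod v <= B / N by rewrite vE ler_pM2r ?invr_gt0.
have BN2 : B / N <= 1 / 2 by rewrite ler_pdivrMr//; lra.
have -> : w = v *+ n.+1 by rewrite /v -mulr_natr divfK// pnatr_eq0.
rewrite cexpMn.
have m1 : cmod (cexp v) <= expR (B / N).
  rewrite cmod_cexp ler_expR; apply: le_trans vB.
  exact: le_trans (ler_norm _) (Re_le_cmod _).
have m2 : cmod (1 + v) <= expR (B / N).
  apply: le_trans (expR_ge1Dx _); apply: le_trans (cmodD _ _) _.
  by rewrite cmod1 lerD2l.
apply: le_trans (cmod_subX n m1 m2) _.
rewrite opprD addrA.
have h := cexp_sub1_bound (le_trans vB BN2).
apply: le_trans (_ : N * expR B * (6 * (B / N) ^+ 2) <= _).
  apply: ler_pM; rewrite ?mulr_ge0 ?exprn_ge0 ?expR_ge0 ?cmod_ge0 ?ler0n//.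
    apply: ler_wpM2l; first exact: ltW.
    rewrite -expRM_natl ler_expR mulrCA ler_piMr//.
    by rewrite ler_pdivrMr// mul1r ler_nat.
  apply: le_trans h _; rewrite ler_wpM2l// ler_pXn2r ?nnegrE ?cmod_ge0//.
  by rewrite divr_ge0// ltW.
have -> // : N * expR B * (6 * (B / N) ^+ 2) = 6 * B ^+ 2 * expR B / N.
by field; rewrite lt0r_neq0.
Qed.

End ComplexExponential.

(** * Calculus on a segment *)

Section SegmentCalculus.
Variable R : realType.
Implicit Types (a b s t x y : R) (f g : R -> R[i]).

(** Tolerances are divided by [K + 1] instead of [K], so that [K = 0] needs no case of its own. *)
Lemma ratio_mul_le (K c : R) : 0 <= K -> 0 <= c -> K / (K + 1) * c <= c.
Proof.
move=> K0 c0; rewrite ler_piMl// ler_pdivrMr ?ltr_wpDl// mul1r lerDl//.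
Qed.

(** The derivative in remainder form: there is no quotient, the point t = x is harmless, and real
    and imaginary parts stay together. [is_derive_segP] is the link with [is_derive_seg]. *)
Definition dseg a b f x (d : R[i]) : Prop :=
  forall eps : R, 0 < eps -> exists2 r : R, 0 < r & forall t, a <= t <= b ->
    `|t - x| < r -> cmod (f t - f x - d * (t - x)%:C) <= eps * `|t - x|.

Lemma real_slopeP a b (u : R -> R) x (l : R) :
  ((fun t => (u t - u x) / (t - x)) @ within `[a, b]%classic x^' --> l) <->
  (forall eps : R, 0 < eps -> exists2 r : R, 0 < r & forall t, a <= t <= b ->
    `|t - x| < r -> `|u t - u x - l * (t - x)| <= eps * `|t - x|).
Proof.
split=> [/cvgrPdist_le H eps e0|H].
  have := H eps e0.
  rewrite /within /= /dnbhs /within /= => /nbhs_ballP[r /= r0 Hr].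
  exists r => // t tab txr.
  have [->|tx] := eqVneq t x; first by rewrite !subrr mulr0 subrr normr0 mulr0.
  have := Hr t; rewrite /ball /= distrC => /(_ txr tx).
  rewrite in_itv /= => /(_ tab).
  have tx0 : t - x != 0 by rewrite subr_eq0.
  have -> : u t - u x - l * (t - x) = - (l - (u t - u x) / (t - x)) * (t - x).
    by field.
  by rewrite normrM normrN => /ler_wpM2r; apply.
apply/cvgrPdist_le => eps e0; have [r r0 Hr] := H eps e0.
rewrite /within /= /dnbhs /within /=; apply/nbhs_ballP; exists r => //= t.
rewrite /ball /= distrC => txr tx; rewrite in_itv /= => tab.
have tx0 : t - x != 0 by rewrite subr_eq0.
have -> : l - (u t - u x) / (t - x) = - (u t - u x - l * (t - x)) / (t - x).
  by field.
by rewrite normrM normrN normfV ler_pdivrMr ?normr_gt0// Hr.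
Qed.

Lemma is_derive_segP a b f x d : is_derive_seg a b f x d <-> dseg a b f x d.
Proof.
rewrite /is_derive_seg !real_slopeP; split=> [[HR HI] eps e0|H].
  have e20 : 0 < eps / 2 by rewrite divr_gt0.
  have [r r0 Hr] := HR _ e20; have [q q0 Hq] := HI _ e20.
  exists (Num.min r q); first by rewrite lt_min r0.
  move=> t tab; rewrite lt_min => /andP[tr tq].
  apply: le_trans (cmod_ReIm _) _.
  rewrite !(ReB, ImB, ReM, ImM) /= !mulr0 subr0 add0r.
  by have := Hr _ tab tr; have := Hq _ tab tq; lra.
split=> eps e0; have [r r0 Hr] := H _ e0; exists r => // t tab tr.
  have := Hr _ tab tr; apply: le_trans.
  by apply: le_trans (Re_le_cmod _); rewrite !(ReB, ReM) /= mulr0 subr0.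
have := Hr _ tab tr; apply: le_trans.
by apply: le_trans (Im_le_cmod _); rewrite !(ImB, ImM) /= mulr0 add0r.
Qed.

Lemma dseg_ext a b f g x d : a <= x <= b -> eq_seg a b f g ->
  dseg a b f x d -> dseg a b g x d.
Proof.
move=> xab fg H eps e0; have [r r0 Hr] := H _ e0; exists r => // t tab tr.
by rewrite -!fg// Hr.
Qed.

Lemma dseg_cst a b (c : R[i]) x : dseg a b (fun=> c) x 0.
Proof.
move=> eps e0; exists 1 => // t _ _.
by rewrite subrr mul0r subrr cmod0 mulr_ge0// ltW.
Qed.

Lemma dseg_lip a b f x d : dseg a b f x d ->
  exists2 r, 0 < r & forall t, a <= t <= b -> `|t - x| < r ->
    cmod (f t - f x) <= (cmod d + 1) * `|t - x|.
Proof.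
move=> /(_ 1 ltr01)[r r0 Hr]; exists r => // t tab tr.
have := Hr t tab tr; have := cmodD (f t - f x - d * (t - x)%:C) (d * (t - x)%:C).
rewrite subrK cmodM cmodR; lra.
Qed.

Lemma dsegD a b f g x d e : dseg a b f x d -> dseg a b g x e ->
  dseg a b (fun t => f t + g t) x (d + e).
Proof.
move=> hf hg eps e0; have e20 : 0 < eps / 2 by rewrite divr_gt0.
have [r r0 Hr] := hf _ e20; have [q q0 Hq] := hg _ e20.
exists (Num.min r q); first by rewrite lt_min r0.
move=> t tab; rewrite lt_min => /andP[tr tq].
have -> : f t + g t - (f x + g x) - (d + e) * (t - x)%:C =
  (f t - f x - d * (t - x)%:C) + (g t - g x - e * (t - x)%:C) by ring.
apply: le_trans (cmodD _ _) _.
by have := Hr _ tab tr; have := Hq _ tab tq; lra.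
Qed.

Lemma dsegM a b f g x d e : dseg a b f x d -> dseg a b g x e ->
  dseg a b (fun t => f t * g t) x (d * g x + f x * e).
Proof.
move=> hf hg eps e0.
set A := cmod (g x) + (cmod e + 1); set B := cmod (f x); set D := cmod d.
have A0 : 0 <= A by rewrite addr_ge0 ?cmod_ge0// addr_ge0 ?cmod_ge0.
have B0 : 0 <= B := cmod_ge0 _.
have D0 : 0 <= D * (cmod e + 1) by rewrite mulr_ge0 ?addr_ge0 ?cmod_ge0.
have h1 : 0 < eps / (3 * (A + 1)) by rewrite divr_gt0// mulr_gt0// ltr_wpDl.
have h2 : 0 < eps / (3 * (B + 1)) by rewrite divr_gt0// mulr_gt0// ltr_wpDl.
have h3 : 0 < eps / (3 * (D * (cmod e + 1) + 1)).
  by rewrite divr_gt0// mulr_gt0// ltr_wpDl.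
have [r r0 Hr] := hf _ h1; have [q q0 Hq] := hg _ h2; have [p p0 Hp] := dseg_lip hg.
exists (Num.min (Num.min r q) (Num.min p (Num.min 1 (eps / (3 * (D * (cmod e + 1) + 1)))))).
  by rewrite !lt_min r0 q0 p0 ltr01 h3.
move=> t tab; rewrite !lt_min => /andP[/andP[tr tq] /andP[tp /andP[t1 te]]].
have -> : f t * g t - f x * g x - (d * g x + f x * e) * (t - x)%:C =
  (f t - f x - d * (t - x)%:C) * g t + d * (t - x)%:C * (g t - g x)
  + f x * (g t - g x - e * (t - x)%:C) by ring.
apply: le_trans (cmodD _ _) _; apply: le_trans (lerD (cmodD _ _) (lexx _)) _.
rewrite !cmodM cmodR -/B -/D.
have gt : cmod (g t) <= A + 1.
  have := cmodD (g t - g x) (g x); rewrite subrK.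
  have := Hp _ tab tp; have : (cmod e + 1) * `|t - x| <= cmod e + 1.
    by rewrite ler_piMr ?addr_ge0 ?cmod_ge0// ltW.
  rewrite /A; lra.
have n0 : 0 <= `|t - x| by [].
have b1 : cmod (f t - f x - d * (t - x)%:C) * cmod (g t) <= eps / 3 * `|t - x|.
  apply: le_trans (ler_pM (cmod_ge0 _) (cmod_ge0 _) (Hr _ tab tr) gt) _.
  have -> // : eps / (3 * (A + 1)) * `|t - x| * (A + 1) = eps / 3 * `|t - x|.
  by field; rewrite gt_eqF// ltr_wpDl.
have b2 : D * `|t - x| * cmod (g t - g x) <= eps / 3 * `|t - x|.
  have := Hp _ tab tp => h.
  apply: le_trans (ler_wpM2l _ h) _; first by rewrite mulr_ge0 ?cmod_ge0.
  rewrite [leLHS](_ : _ = D * (cmod e + 1) * `|t - x| * `|t - x|); last by ring.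
  rewrite ler_wpM2r//; apply: le_trans (ler_wpM2l D0 (ltW te)) _.
  set K := D * _ in D0 *.
  rewrite [leLHS](_ : _ = K / (K + 1) * (eps / 3)); last by field; rewrite gt_eqF// ltr_wpDl.
  by rewrite ratio_mul_le// ?divr_ge0// ?ltW.
have b3 : B * cmod (g t - g x - e * (t - x)%:C) <= eps / 3 * `|t - x|.
  apply: le_trans (ler_wpM2l B0 (Hq _ tab tq)) _; rewrite mulrA ler_wpM2r//.
  rewrite [leLHS](_ : _ = B / (B + 1) * (eps / 3)); last by field; rewrite gt_eqF// ltr_wpDl.
  by rewrite ratio_mul_le// ?divr_ge0// ?ltW.
lra.
Qed.

Lemma dsegZ a b f x d (c : R[i]) : dseg a b f x d ->
  dseg a b (fun t => c * f t) x (c * d).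
Proof.
by move=> h; have := dsegM (@dseg_cst a b c x) h; rewrite mul0r add0r.
Qed.

Lemma dseg_sum a b (I : Type) (l : seq I) (P : pred I) (F : I -> R -> R[i])
    (D : I -> R[i]) x : (forall i, P i -> dseg a b (F i) x (D i)) ->
  dseg a b (fun t => \sum_(i <- l | P i) F i t) x (\sum_(i <- l | P i) D i).
Proof.
move=> h; elim: l => [|i l IH].
  under eq_fun do rewrite big_nil; rewrite big_nil; exact: dseg_cst.
under eq_fun do rewrite big_cons; rewrite big_cons.
by case: ifP => // Pi; apply: dsegD => //; exact: h.
Qed.

Lemma dseg_id a b x : dseg a b (fun t => t%:C) x 1.
Proof.
move=> eps e0; exists 1 => // t _ _.
rewrite mul1r -rmorphB subrr cmod0 mulr_ge0// ltW//.
Qed.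

Lemma cexp_line_sub (k : R[i]) s t :
  cexp (k * t%:C) = cexp (k * s%:C) * cexp (k * (t - s)%:C).
Proof. by rewrite -cexpD -mulrDr -rmorphD addrC subrK. Qed.

Lemma dseg_cexp a b (k : R[i]) x :
  dseg a b (fun t => cexp (k * t%:C)) x (k * cexp (k * x%:C)).
Proof.
move=> eps e0; set E := cmod (cexp (k * x%:C)); set K := cmod k.
have E0 : 0 <= E := cmod_ge0 _; have K0 : 0 <= K := cmod_ge0 _.
have h1 : 0 < 1 / (2 * (K + 1)) by rewrite divr_gt0// mulr_gt0// ltr_wpDl.
have M0 : 0 <= E * (6 * K ^+ 2) by rewrite mulr_ge0// mulr_ge0// exprn_ge0.
have h2 : 0 < eps / (E * (6 * K ^+ 2) + 1) by rewrite divr_gt0// ltr_wpDl.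
exists (Num.min (1 / (2 * (K + 1))) (eps / (E * (6 * K ^+ 2) + 1))).
  by rewrite lt_min h1.
move=> t _; rewrite lt_min => /andP[t1 t2].
rewrite (cexp_line_sub k x t).
set h := (t - x)%:C.
have -> : cexp (k * x%:C) * cexp (k * h) - cexp (k * x%:C)
  - k * cexp (k * x%:C) * h = cexp (k * x%:C) * (cexp (k * h) - 1 - k * h).
  by ring.
rewrite cmodM -/E.
have kh : cmod (k * h) = K * `|t - x| by rewrite cmodM cmodR.
have kh2 : cmod (k * h) <= 1 / 2.
  rewrite kh; apply: le_trans (ler_wpM2l K0 (ltW t1)) _.
  rewrite [leLHS](_ : _ = K / (K + 1) * (1 / 2)); last by field; rewrite gt_eqF// ltr_wpDl.
  by rewrite ratio_mul_le// ?divr_ge0// ?ltW.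
apply: le_trans (ler_wpM2l E0 (cexp_sub1_bound kh2)) _; rewrite kh.
rewrite [leLHS](_ : _ = E * (6 * K ^+ 2) * `|t - x| * `|t - x|); last by ring.
rewrite ler_wpM2r//; apply: le_trans (ler_wpM2l M0 (ltW t2)) _.
set M := E * _ in M0 *.
rewrite [leLHS](_ : _ = M / (M + 1) * eps); last by field; rewrite gt_eqF// ltr_wpDl.
by rewrite ratio_mul_le// ?ltW.
Qed.

Lemma dseg_unique a b f x d e : a < b -> a <= x <= b ->
  dseg a b f x d -> dseg a b f x e -> d = e.
Proof.
move=> ab xab hd he; apply/eqP; rewrite -subr_eq0 -cmod_eq0; apply/negP => /negP n0.
have c0 : 0 < cmod (d - e) by rewrite lt_def n0 cmod_ge0.
have c40 : 0 < cmod (d - e) / 4 by rewrite divr_gt0.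
have [r r0 Hr] := hd _ c40; have [q q0 Hq] := he _ c40.
have [t [tab tx tr tq]] : exists t, [/\ a <= t <= b, t != x, `|t - x| < r & `|t - x| < q].
  (* A step small for both radii and for the segment, so that [x + m] or [x - m] is an admissible
     test point. *)
  pose m := Num.min (Num.min r q) (b - a) / 4.
  have m0 : 0 < m by rewrite divr_gt0// !lt_min r0 q0 subr_gt0.
  have m4 : m * 4 = Num.min (Num.min r q) (b - a) by rewrite /m divfK.
  have mr : m * 4 <= r by rewrite m4 !ge_min lexx.
  have mq : m * 4 <= q by rewrite m4 !ge_min lexx orbT.
  have mb : m * 4 <= b - a by rewrite m4 !ge_min lexx !orbT.
  case/andP : xab => ax xb.
  have [h|h] := lerP (x + m) b.
    exists (x + m); have -> : x + m - x = m by ring.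
    rewrite gtr0_norm//; split; [lra| |lra|lra].
    by rewrite -subr_eq0 addrAC subrr add0r gt_eqF.
  exists (x - m); have -> : x - m - x = - m by ring.
  rewrite normrN gtr0_norm//; split; [lra| |lra|lra].
  by rewrite -subr_eq0 addrAC subrr add0r oppr_eq0 gt_eqF.
have h1 := Hr _ tab tr; have h2 := Hq _ tab tq.
have := cmodB (f t - f x - e * (t - x)%:C) (f t - f x - d * (t - x)%:C).
have -> : f t - f x - e * (t - x)%:C - (f t - f x - d * (t - x)%:C) =
  (d - e) * (t - x)%:C by ring.
rewrite cmodM cmodR => h3.
have tx0 : 0 < `|t - x| by rewrite normr_gt0 subr_eq0.
nra.
Qed.

End SegmentCalculus.


(** * Absolutely continuous functions *)

Section AbsolutelyContinuous.
Variable R : realType.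
Implicit Types (a b s t x y : R) (f g : R -> R[i]).

Lemma ae_imply (A B : R -> Prop) : (forall x, A x -> B x) ->
  {ae @lebesgue_measure R, forall x, A x} -> {ae @lebesgue_measure R, forall x, B x}.
Proof. by move=> AB; apply: (@filterS _ _ (ae_filter_ringOfSetsType _)). Qed.

Lemma ae_and (A B : R -> Prop) : {ae @lebesgue_measure R, forall x, A x} ->
  {ae @lebesgue_measure R, forall x, B x} ->
  {ae @lebesgue_measure R, forall x, A x /\ B x}.
Proof.
by move=> hA hB; apply: (@filterI _ _ (ae_filter_ringOfSetsType _)).
Qed.

Lemma AC_ext a b f g : eq_seg a b f g -> AC_seg a b f -> AC_seg a b g.
Proof.
move=> fg H eps e0; have [d d0 Hd] := H _ e0; exists d => // m s t st tri ltd.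
have := Hd m s t st tri ltd; under eq_bigr => i _.
  have [h1 h2 h3] := st i.
  rewrite !fg ?h1 ?h3 ?(le_trans h2 h3) ?(le_trans h1 h2)//.
  over.
by [].
Qed.

Lemma AC_locally_lipschitz a b f (K r : R) : 0 < r ->
  (forall s t, a <= s -> s <= t -> t <= b -> t - s < r ->
     cmod (f t - f s) <= K * (t - s)) -> AC_seg a b f.
Proof.
move=> r0 H eps e0.
have K1 : 0 < `|K| + 1 by rewrite ltr_wpDl.
exists (Num.min r (eps / (`|K| + 1))); first by rewrite lt_min r0 divr_gt0.
move=> m s t st _; rewrite lt_min => /andP[lr le].
have pos i : 0 <= t i - s i by rewrite subr_ge0; have [] := st i.
have small i : t i - s i < r.
  apply: le_lt_trans lr; rewrite (bigD1 i)//= lerDl sumr_ge0// => j _.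
apply: le_lt_trans (_ : \sum_(i < m) (`|K| + 1) * (t i - s i) < eps).
  apply: ler_sum => i _; have [h1 h2 h3] := st i.
  apply: le_trans (H _ _ h1 h2 h3 (small i)) _; rewrite ler_wpM2r//.
  by rewrite (le_trans (ler_norm _))// lerDl.
by rewrite -mulr_sumr mulrC -ltr_pdivlMr.
Qed.

Lemma AC_uniform a b f (eps : R) : AC_seg a b f -> 0 < eps ->
  exists2 d, 0 < d & forall s t, a <= s <= b -> a <= t <= b -> `|t - s| < d ->
    cmod (f t - f s) < eps.
Proof.
move=> H e0; have [d d0 Hd] := H _ e0; exists d => // s t.
wlog st : s t / s <= t => [W|] sab tab ltd.
  have [st|/ltW st] := lerP s t; first exact: W.
  by rewrite cmodBC; apply: W => //; rewrite distrC.
have := Hd 1%N (fun=> s) (fun=> t).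
rewrite !big_ord_recl !big_ord0 !addr0; apply.
- by case/andP : sab => ->; case/andP : tab => _ ->.
- by move=> i j _ _ _; rewrite !ord1.
- by apply: le_lt_trans ltd; rewrite ler_norm.
Qed.

(** Real induction: the supremum c of the points satisfying P is approached from the left by such
    points, and the hypothesis at c carries P across c, so c can only be t. *)
Lemma segment_induction (P : R -> Prop) s t : s <= t -> P s ->
  (forall c, s <= c <= t -> exists2 r, 0 < r &
     forall u v, s <= u <= c -> c <= v <= t -> c - r < u -> v < c + r ->
     P u -> P v) ->
  P t.
Proof.
move=> st Ps H.
pose E := [set v | s <= v <= t /\ P v].
have hE : has_sup E.
  split; first by exists s; split; rewrite ?lexx.
  by exists t => v [/andP[]].
have Es : E s by split; rewrite ?lexx.
have cs : s <= sup E by apply: ub_le_sup => //; case: hE.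
have ct : sup E <= t by apply: ge_sup => [|v [/andP[]]]//; case: hE.
have [|r r0 Hr] := H (sup E); first by rewrite cs.
have [u [/andP[su ut] Pu] cu] := sup_adherent r0 hE.
have uc : u <= sup E by apply: ub_le_sup; [case: hE|split; rewrite ?su].
have step v : sup E <= v <= t -> v < sup E + r -> P v.
  by move=> h1 h2; apply: (Hr u v) => //; rewrite su.
have [tr|tr] := ltP t (sup E + r); first by apply: step; rewrite ?ct ?lexx.
have h : sup E <= sup E + r / 2 <= t.
  by apply/andP; split; lra.
have : E (sup E + r / 2).
  split; last by apply: step => //; lra.
  by case/andP : h => h1 ->; rewrite (le_trans cs h1).
move=> /(ub_le_sup (proj2 hE)); rewrite gerDl => h3.
by move: h3; lra.
Qed.

Lemma AC_bounded a b f : AC_seg a b f ->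
  exists2 M, 0 <= M & forall x, a <= x <= b -> cmod (f x) <= M.
Proof.
move=> H; have [ab|ba] := leP a b; last first.
  exists 0 => // x /andP[ax xb].
  by have := lt_le_trans ba (le_trans ax xb); rewrite ltxx.
have [d d0 Hd] := AC_uniform H ltr01.
have [M hM] : exists M, forall x, a <= x <= b -> cmod (f x) <= M.
  apply: (@segment_induction (fun v => exists M, forall x, a <= x <= v -> cmod (f x) <= M) a b ab).
    exists (cmod (f a)) => x; rewrite -eq_le => /eqP <- //.
  move=> c cab; exists (d / 2); first by rewrite divr_gt0.
  move=> u v /andP[au uc] /andP[cv vb] cu vc [M HM].
  exists (M + 1) => x /andP[ax xv].
  have h1 := HM u; rewrite au lexx in h1; have {}h1 := h1 isT.
  have [xu|ux] := leP x u; first by rewrite (le_trans (HM _ _))// ?ax// lerDl.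
  have := cmodD (f x - f u) (f u); rewrite subrK => h2.
  have : cmod (f x - f u) < 1.
    apply: Hd; [| |rewrite gtr0_norm ?subr_gt0//]; lra.
  lra.
by exists `|M| => // x /hM/le_trans; apply; rewrite ler_norm.
Qed.

Lemma AC_M a b f g : AC_seg a b f -> AC_seg a b g ->
  AC_seg a b (fun t => f t * g t).
Proof.
move=> hf hg eps e0.
have [F F0 HF] := AC_bounded hf; have [G G0 HG] := AC_bounded hg.
have ef : 0 < eps / (2 * (G + 1)) by rewrite divr_gt0// mulr_gt0// ltr_wpDl.
have eg : 0 < eps / (2 * (F + 1)) by rewrite divr_gt0// mulr_gt0// ltr_wpDl.
have [d d0 Hd] := hf _ ef; have [p p0 Hp] := hg _ eg.
exists (Num.min d p); first by rewrite lt_min d0.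
move=> m s t st tri; rewrite lt_min => /andP[ld lp].
have h1 := Hd m s t st tri ld; have h2 := Hp m s t st tri lp.
apply: le_lt_trans (_ : (G + 1) * (\sum_(i < m) cmod (f (t i) - f (s i)))
   + (F + 1) * (\sum_(i < m) cmod (g (t i) - g (s i))) < eps).
  rewrite !mulr_sumr -big_split/=; apply: ler_sum => i _; have [q1 q2 q3] := st i.
  have -> : f (t i) * g (t i) - f (s i) * g (s i) =
    g (t i) * (f (t i) - f (s i)) + f (s i) * (g (t i) - g (s i)) by ring.
  apply: le_trans (cmodD _ _) _; rewrite !cmodM lerD// ler_wpM2r ?cmod_ge0//.
    by rewrite (le_trans (HG _ _))// ?lerDl// q3 (le_trans q1 q2).
  by rewrite (le_trans (HF _ _))// ?lerDl// q1 (le_trans q2 q3).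
have G1 : 0 < G + 1 by rewrite ltr_wpDl.
have F1 : 0 < F + 1 by rewrite ltr_wpDl.
have k1 : (G + 1) * (\sum_(i < m) cmod (f (t i) - f (s i))) < eps / 2.
  by rewrite mulrC -ltr_pdivlMr// (lt_le_trans h1)// invfM mulrA.
have k2 : (F + 1) * (\sum_(i < m) cmod (g (t i) - g (s i))) < eps / 2.
  by rewrite mulrC -ltr_pdivlMr// (lt_le_trans h2)// invfM mulrA.
lra.
Qed.

Lemma AC_D a b f g : AC_seg a b f -> AC_seg a b g ->
  AC_seg a b (fun t => f t + g t).
Proof.
move=> hf hg eps e0; have e20 : 0 < eps / 2 by rewrite divr_gt0.
have [d d0 Hd] := hf _ e20; have [p p0 Hp] := hg _ e20.
exists (Num.min d p); first by rewrite lt_min d0.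
move=> m s t st tri; rewrite lt_min => /andP[ld lp].
have h1 := Hd m s t st tri ld; have h2 := Hp m s t st tri lp.
apply: le_lt_trans (_ : (\sum_(i < m) cmod (f (t i) - f (s i)))
   + (\sum_(i < m) cmod (g (t i) - g (s i))) < eps); last by lra.
rewrite -big_split/=; apply: ler_sum => i _; rewrite opprD addrACA.
exact: cmodD.
Qed.

Lemma AC_cst a b (c : R[i]) : AC_seg a b (fun=> c).
Proof.
apply: (@AC_locally_lipschitz _ _ _ 0 1) => // s t _ _ _ _.
by rewrite subrr cmod0 mul0r.
Qed.

Lemma AC_Z a b f (c : R[i]) : AC_seg a b f -> AC_seg a b (fun t => c * f t).
Proof. exact/AC_M/AC_cst. Qed.

Lemma AC_sum a b (I : Type) (l : seq I) (P : pred I) (F : I -> R -> R[i]) :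
  (forall i, P i -> AC_seg a b (F i)) ->
  AC_seg a b (fun t => \sum_(i <- l | P i) F i t).
Proof.
move=> h; elim: l => [|i l IH].
  by apply: AC_ext (AC_cst a b 0) => t _; rewrite big_nil.
apply: (@AC_ext a b (fun t => if P i then F i t + \sum_(j <- l | P j) F j t
    else \sum_(j <- l | P j) F j t)) => [t _|]; first by rewrite big_cons.
by case Pi : (P i) => //; apply: AC_D => //; exact: h.
Qed.

Lemma AC_id a b : AC_seg a b (fun t => t%:C).
Proof.
apply: (@AC_locally_lipschitz _ _ _ 1 1) => // s t _ st _ _.
by rewrite -rmorphB cmodR mul1r ger0_norm ?subr_ge0.
Qed.

Lemma AC_cexp a b (k : R[i]) : AC_seg a b (fun t => cexp (k * t%:C)).
Proof.
have K0 : 0 <= cmod k := cmod_ge0 _.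
pose M := expR (cmod k * (`|a| + `|b|)).
apply: (@AC_locally_lipschitz _ _ _ (M * (4 * cmod k)) (1 / (2 * (cmod k + 1)))).
  by rewrite divr_gt0// mulr_gt0// ltr_wpDl.
move=> s t as_ st tb h.
rewrite (cexp_line_sub k s t) -{2}[cexp (k * s%:C)]mulr1 -mulrBr cmodM -mulrA.
have ts : cmod ((t - s)%:C : R[i]) = t - s by rewrite cmodR ger0_norm ?subr_ge0.
apply: ler_pM; rewrite ?cmod_ge0//.
  rewrite cmod_cexp ler_expR; apply: le_trans (ler_norm _) _.
  apply: le_trans (Re_le_cmod _) _; rewrite cmodM cmodR ler_wpM2l//.
  rewrite ler_norml; apply/andP; split.
    have := ler_norm (- a); rewrite normrN; have : 0 <= `|b| by []; lra.
  have := ler_norm b; have : 0 <= `|a| by []; lra.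
apply: le_trans (cexp_sub1_upper _) _; rewrite cmodM ts; last by rewrite mulrA.
apply: le_trans (ler_wpM2l K0 (ltW h)) _.
rewrite [leLHS](_ : _ = cmod k / (cmod k + 1) * (1 / 2)); last by field; rewrite gt_eqF// ltr_wpDl.
by rewrite ratio_mul_le// ?divr_ge0// ?ltW.
Qed.

(* Cover the exceptional null set by an open set U of small measure; walking
   along [s, t], a step tagged at a point of U costs an increment that absolute
   continuity controls, any other step costs at most (M + eps) times its length. *)
Lemma AC_mean_value a b f s t (M : R) : 0 <= M ->
  AC_seg a b f -> a <= s -> s <= t -> t <= b ->
  {ae @lebesgue_measure R, forall x, s <= x <= t ->
     exists2 d, dseg a b f x d & cmod d <= M} ->
  cmod (f t - f s) <= M * (t - s).
Proof.
move=> M0 hf as_ st tb [A [mA mA0 HA]].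
have A0 : lebesgue_measure A = 0%E := mA0.
apply/ler_addgt0Pl => e e0.
(* Two errors occur, eps (t - s) along the walk and eps from absolute continuity; their sum is
   [e]. *)
pose eps := e / (t - s + 1).
have ts1 : 0 < t - s + 1 by rewrite ltr_wpDl ?subr_ge0.
have eps0 : 0 < eps by rewrite divr_gt0.
have [dl dl0 Hdl] := hf _ eps0.
have Alt : (lebesgue_measure A < +oo)%E by rewrite A0.
have [U [oU AU mU]] := lebesgue_regularity_outer mA Alt dl0.
have mUd : (lebesgue_measure U < dl%:E)%E.
  have mU' : measurable U by exact: open_measurable.
  have -> : U = A `|` (U `\` A) by rewrite setDUK.
  have := measureU2 (@lebesgue_measure R) mA (measurableD mU' mA).
  by move=> /le_lt_trans; apply; rewrite [X in (X + _)%E]A0 add0e.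
(* Invariant of the walk: the increments not controlled by a derivative are carried by ordered
   intervals inside [U], whose total length is therefore below the threshold of absolute
   continuity. *)
pose good v := exists (m : nat) (p q : nat -> R),
  [/\ forall i, (i < m)%N -> [/\ s <= p i, p i <= q i, q i <= v &
         `]p i, q i[%classic `<=` U],
      forall i j, (i < j < m)%N -> q i <= p j &
      cmod (f v - f s) <= (M + eps) * (v - s) + \sum_(i < m) cmod (f (q i) - f (p i))].
have : good t.
  apply: (segment_induction st).
    exists 0%N, (fun=> 0), (fun=> 0); split => //; last by rewrite big_ord0 !subrr cmod0 mulr0 addr0.

  move=> c /andP[sc ct].
  have [Uc|Uc] := pselect (U c).
    have [r /= r0 Hr] := (nbhs_ballP _ _).1 (open_nbhs_nbhs (conj oU Uc)).
    exists r => // u v /andP[su uc] /andP[cv vt] cu vc [m [p [q [h1 h2 h3]]]].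
    exists m.+1, (fun i => if (i == m)%N then u else p i),
      (fun i => if (i == m)%N then v else q i).
    have uv : u <= v := le_trans uc cv.
    split=> [i|i j|].
    - rewrite ltnS leq_eqVlt; case: eqP => [_ _|_ /= /h1[k1 k2 k3 k4]].
        split => // z /=; rewrite in_itv/= => /andP[uz zv]; apply: Hr.
        by rewrite /ball/= ltr_norml; apply/andP; split; lra.
      by split => //; exact: le_trans uv.
    - rewrite ltnS => /andP[ij]; rewrite leq_eqVlt; case: eqP => [jm _|jm /= jm'].
        rewrite jm in ij.
        by rewrite ltn_eqF//=; have [_ _ + _] := h1 _ ij.
      by rewrite ltn_eqF ?(ltn_trans ij)//=; apply: h2; rewrite ij.
    - rewrite big_ord_recr/= eqxx addrA.
      under eq_bigr => i _ do rewrite ltn_eqF//.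
      have := cmodD (f v - f u) (f u - f s).
      rewrite addrA subrK => h4; apply: le_trans h4 _.
      have : (M + eps) * (u - s) <= (M + eps) * (v - s).
        by rewrite ler_wpM2l ?addr_ge0 ?(ltW eps0)// lerB.
      lra.
  have [d Hd dM] : exists2 d, dseg a b f c d & cmod d <= M.
    apply: contrapT => nP; apply: Uc; apply: AU; apply: HA => /= H.
    by apply: nP; apply: H; rewrite sc.
  have [r r0 Hr] := Hd _ eps0; exists r => // u v /andP[su uc] /andP[cv vt] cu vc.
  move=> [m [p [q [h1 h2 h3]]]]; exists m, p, q.
  have uv : u <= v := le_trans uc cv.
  split=> // [i /h1[k1 k2 k3 k4]|]; first by split => //; exact: le_trans uv.
  have est y : a <= y <= b -> `|y - c| < r -> cmod (f y - f c) <= (M + eps) * `|y - c|.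
    move=> yab yc; have := Hr _ yab yc.
    have := cmodD (f y - f c - d * (y - c)%:C) (d * (y - c)%:C).
    rewrite subrK cmodM cmodR.
    have := ler_wpM2r (normr_ge0 (y - c)) dM; lra.
  have e1 : cmod (f v - f c) <= (M + eps) * (v - c).
    have := est v; rewrite ger0_norm ?subr_ge0//; apply; lra.
  have e2 : cmod (f u - f c) <= (M + eps) * (c - u).
    have := est u; rewrite distrC ger0_norm ?subr_ge0//; apply; lra.
  have := cmodD (f v - f c) (f c - f u + (f u - f s)).
  have := cmodD (f c - f u) (f u - f s); rewrite (cmodBC (f c)).
  have -> : f v - f c + (f c - f u + (f u - f s)) = f v - f s by ring.
  lra.
move=> [m [p [q [h1 h2 h3]]]].
have tri : trivIset setT (fun i : 'I_m => `]p i, q i[%classic).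
  move=> i j _ _ [z /= []]; rewrite !in_itv/= => /andP[pz zq] /andP[pz' zq'].
  apply/val_inj => /=; case: (ltngtP i j) => // ij; exfalso.
    by have := h2 i j; rewrite ij ltn_ord => /(_ isT); lra.
  by have := h2 j i; rewrite ij ltn_ord => /(_ isT); lra.
have small : \sum_(i < m) (q i - p i) < dl.
  rewrite -lte_fin; apply: le_lt_trans mUd.
  apply: le_trans (_ : (lebesgue_measure (\big[setU/set0]_(i < m) `]p i, q i[%classic) <= _)%E).
    rewrite measure_bigsetU_ord// -sumEFin; apply: lee_sum => i _.
    have [_ pq _ _] := h1 i (ltn_ord i).
    have E := @lebesgue_measure_itv R `]p i, q i[.
    rewrite [leRHS]E /= lte_fin -EFinB.
    by case: ltgtP pq => //= -> _; rewrite subrr.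
  apply: le_measure; rewrite ?inE.
  - by apply: bigsetU_measurable => i _; exact: measurable_itv.
  - exact: open_measurable.
  - elim/big_ind : _ => [|X Y XU YU|i _]; [exact: sub0set|by rewrite subUset|].
    by have [] := h1 i (ltn_ord i).
have := Hdl m (p \o val) (q \o val) _ tri small.
have ok (i : 'I_m) : [/\ a <= p i, p i <= q i & q i <= b].
  by have [k1 k2 k3 _] := h1 i (ltn_ord i); split => //; lra.
move=> /(_ ok) /= lt_eps.
have : eps * (t - s + 1) = e by rewrite /eps divfK// gt_eqF.
lra.
Qed.

(** The case M = 0 of the mean value inequality. It yields uniqueness for the first order equations
    into which the problem is decoupled. *)
Lemma AC_derive0_const a b f : AC_seg a b f ->
  {ae @lebesgue_measure R, forall x, a <= x <= b -> dseg a b f x 0} ->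
  forall x, a <= x <= b -> f x = f a.
Proof.
move=> hf h x /andP[ax xb]; apply/eqP; rewrite -subr_eq0 -cmod_eq0 eq_le cmod_ge0 andbT.
have := @AC_mean_value a b f a x 0 (lexx _) hf (lexx _) ax xb.
rewrite mul0r; apply; apply: ae_imply h => y h /andP[ay yx].
by exists 0; [apply: h; rewrite ay (le_trans yx)|rewrite cmod0].
Qed.

(** After subtraction of the linear function of slope [h x], the a.e. derivative is smaller than eps
    near x, and the mean value inequality gives the remainder estimate at every point, exceptional
    ones included. *)
Lemma AC_derive_continuous a b f (h : R -> R[i]) : AC_seg a b f -> AC_seg a b h ->
  {ae @lebesgue_measure R, forall x, a <= x <= b -> dseg a b f x (h x)} ->
  forall x, a <= x <= b -> dseg a b f x (h x).
Proof.
move=> hf hh H x xab eps e0; have [r r0 Hr] := AC_uniform hh e0.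
exists r => // t tab tr.
pose F (y : R) : R[i] := f y + (- h x) * y%:C.
have AF : AC_seg a b F by apply: AC_D => //; apply/AC_Z/AC_id.
suff W : forall u v, a <= u <= b -> a <= v <= b -> u <= v -> `|u - x| < r -> `|v - x| < r ->
    cmod (F v - F u) <= eps * (v - u).
  have -> : f t - f x - h x * (t - x)%:C = F t - F x by rewrite /F rmorphB; ring.
  have xr : `|x - x| < r by rewrite subrr normr0.
  have [xt|/ltW tx] := leP x t; first by rewrite ger0_norm ?subr_ge0// W.
  by rewrite cmodBC distrC ger0_norm ?subr_ge0// W.
move=> u v /andP[au _] /andP[_ vb] uv ux vx.
apply: (AC_mean_value (ltW e0) AF) => //.
apply: ae_imply H => y H /andP[uy yv].
have yab : a <= y <= b by rewrite (le_trans au uy) (le_trans yv vb).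
exists (h y - h x).
  by rewrite -[- h x]mulr1; apply: dsegD; [exact: H|exact/dsegZ/dseg_id].
apply/ltW/Hr => //; move: ux vx; rewrite !ltr_norml; lra.
Qed.

End AbsolutelyContinuous.

(** * Integrals of real functions over a segment *)

Section RealIntegral.
Variable R : realType.
Implicit Types (a b c x y : R) (u v h : R -> R).
Local Notation mu := (@lebesgue_measure R).

Definition integr a b u := mu.-integrable `[a, b] (EFin \o u).

Lemma integr_meas a b u : integr a b u -> measurable_fun `[a, b] u.
Proof. by move=> /measurable_int/measurable_EFinP. Qed.

Lemma integr_sub a b c d u : a <= c -> d <= b -> integr a b u -> integr c d u.
Proof.
move=> ac db; apply: integrableS => // z /=; rewrite !in_itv /= => /andP[cz zd].
by rewrite (le_trans ac cz) (le_trans zd db).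
Qed.

Lemma integr_ext a b u v : (forall x, a <= x <= b -> u x = v x) ->
  integr a b u -> integr a b v.
Proof.
move=> uv; apply: eq_integrable => // x; rewrite inE /= in_itv /= => /uv.
by move=> ->.
Qed.

Lemma integr_dom a b u h : measurable_fun `[a, b] u -> integr a b h ->
  (forall x, a <= x <= b -> `|u x| <= h x) -> integr a b u.
Proof.
move=> mu_ hh uh; apply: le_integrable hh => //.
  exact/measurable_EFinP.
move=> x /=; rewrite in_itv/= => /uh uhx; rewrite lee_fin.
by rewrite (le_trans uhx)// ler_norm.
Qed.

Lemma integrD a b u v : integr a b u -> integr a b v ->
  integr a b (fun x => u x + v x).
Proof. by move=> hu hv; apply: (integrableD _ hu hv). Qed.

Lemma integrZ a b u k : integr a b u -> integr a b (fun x => k * u x).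
Proof. by move=> hu; apply: (integrableZl _ k hu). Qed.

Lemma integr_norm a b u : integr a b u -> integr a b (fun x => `|u x|).
Proof. exact: integrable_norm. Qed.

Lemma integr_cst a b (k : R) : integr a b (fun=> k).
Proof.
apply: measurable_bounded_integrable => //.
  rewrite [ltLHS](@lebesgue_measure_itv R `[a, b]) /=.
  by case: ifP => _; rewrite ?ltry.
by exists `|k|; split => // M kM x _ /=; exact: ltW.
Qed.

Lemma integr_sum a b (I : Type) (l : seq I) (P : pred I) (F : I -> R -> R) :
  (forall i, P i -> integr a b (F i)) ->
  integr a b (fun x => \sum_(i <- l | P i) F i x).
Proof.
move=> h; elim: l => [|i l IH].
  by apply: integr_ext (integr_cst a b 0) => x _; rewrite big_nil.
apply: (@integr_ext a b (fun t => if P i then F i t + \sum_(j <- l | P j) F j t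
    else \sum_(j <- l | P j) F j t)) => [t _|]; first by rewrite big_cons.
by case Pi : (P i) => //; apply: integrD => //; exact: h.
Qed.

Definition rint a b u : R := \int[mu]_(x in `[a, b]) u x.

Lemma rint_ext a b u v : (forall x, a <= x <= b -> u x = v x) ->
  rint a b u = rint a b v.
Proof. by move=> uv; apply: eq_Rintegral => x; rewrite inE/= in_itv/=; exact: uv. Qed.

Lemma rintD a b u v : integr a b u -> integr a b v ->
  rint a b (fun x => u x + v x) = rint a b u + rint a b v.
Proof. by move=> hu hv; apply: RintegralD. Qed.

Lemma rintZ a b u k : integr a b u ->
  rint a b (fun x => k * u x) = k * rint a b u.
Proof. by move=> hu; apply: RintegralZl. Qed.

Lemma rint_ge0 a b u : (forall x, a <= x <= b -> 0 <= u x) -> 0 <= rint a b u.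
Proof. by move=> h; apply: Rintegral_ge0 => x /=; rewrite in_itv/=; exact: h. Qed.

Lemma rint_le a b u v : integr a b u -> integr a b v ->
  (forall x, a <= x <= b -> u x <= v x) -> rint a b u <= rint a b v.
Proof.
by move=> hu hv h; apply: le_Rintegral => // x /=; rewrite in_itv/=; exact: h.
Qed.

Lemma rint_norm a b u : integr a b u -> `|rint a b u| <= rint a b (fun x => `|u x|).
Proof. by move=> hu; exact: le_normr_Rintegral. Qed.

Lemma rint_cst a b k : a <= b -> rint a b (fun=> k) = k * (b - a).
Proof.
move=> ab; rewrite /rint Rintegral_cst//.
congr (_ * _); have E := @lebesgue_measure_itv R `[a, b].
rewrite [X in fine X]E /= lte_fin -EFinB.
by case: ltgtP ab => //= ->; rewrite subrr.
Qed.

Lemma rint_split a c b u : a <= c -> c <= b -> integr a b u ->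
  rint a b u = rint a c u + rint c b u.
Proof.
move=> ac cb hu.
have h1 : integr c b u by apply: integr_sub hu.
have h2 : mu.-integrable `]c, b] (EFin \o u).
  apply: integrableS h1 => // z /=; rewrite !in_itv/= => /andP[/ltW-> ->]//.
have := @Rintegral_itvB R u (BLeft a) (BRight b) c hu.
rewrite !bnd_simp ac cb => /(_ isT isT).
rewrite -/(rint a b u) -/(rint a c u) Rintegral_itv_obnd_cbnd// -/(rint c b u) => <-.
by rewrite addrCA subrr addr0.
Qed.

Lemma rint_sub_le a b c d u : a <= c -> c <= d -> d <= b -> integr a b u ->
  (forall x, a <= x <= b -> 0 <= u x) -> rint c d u <= rint a b u.
Proof.
move=> ac cd db hu u0.
rewrite (@rint_split a c b)// ?(le_trans cd)//.
rewrite (@rint_split c d b)//; last exact: integr_sub hu.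
have : 0 <= rint a c u.
  by apply: rint_ge0 => x /andP[ax xc]; apply: u0; rewrite ax (le_trans xc)// (le_trans cd).
have : 0 <= rint d b u.
  by apply: rint_ge0 => x /andP[dx xb]; apply: u0; rewrite xb andbT (le_trans ac)// (le_trans cd).
lra.
Qed.

Lemma integr_patch a b u : integr a b u -> mu.-integrable setT (EFin \o (u \_ `[a, b])).
Proof.
move=> hu; rewrite -restrict_EFin.
by have [H _] := @integrable_mkcond _ _ _ mu `[a, b] (EFin \o u) (measurable_itv _); exact: H.
Qed.

(** Absolute continuity of the Lebesgue integral of |u|, extended by 0, applied to the union of the
    intervals, whose measure is the sum of the lengths. *)
Lemma rint_abs_continuous a b u (e : R) : integr a b u -> 0 < e ->
  exists2 d, 0 < d & forall (m : nat) (s t : 'I_m -> R),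
    (forall i, [/\ a <= s i, s i <= t i & t i <= b]) ->
    trivIset setT (fun i => `]s i, t i[%classic) ->
    \sum_(i < m) (t i - s i) < d -> \sum_(i < m) rint (s i) (t i) (fun x => `|u x|) < e.
Proof.
move=> hu e0; have hp := integr_patch hu.
have [d [d0 Hd]] := integral_normr_continuous hp e0.
exists d => // m s t st tri lt_d.
pose U := \big[setU/set0]_(i < m) `]s i, t i[%classic.
have mU : measurable U by apply: bigsetU_measurable => i _; exact: measurable_itv.
have E : (mu U = \sum_(i < m) (t i - s i)%:E)%E.
  rewrite /U measure_bigsetU_ord//; apply: eq_bigr => i _.
  have [_ sti _] := st i.
  rewrite [LHS](@lebesgue_measure_itv R `]s i, t i[) /= lte_fin -EFinB.
  by case: ltgtP sti => //= ->; rewrite subrr.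
have := Hd U mU; rewrite [X in (X < _)%E]E sumEFin lte_fin => /(_ lt_d).
apply: le_lt_trans; rewrite le_eqVlt; apply/orP; left; apply/eqP.
rewrite /Rintegral -[LHS]/(fine (\sum_(i < m) rint (s i) (t i) (fun x => `|u x|))%:E).
congr fine; rewrite /U.
pose f x := `|(u \_ `[a, b]) x|%:E.
have intf : mu.-integrable setT f.
  by have := integrable_norm hp; apply: eq_integrable.
have -> : (\int[mu]_(x in \big[setU/set0]_(i < m) `]s i, t i[%classic) f x =
   \sum_(i < m) \int[mu]_(x in `]s i, t i[%classic) f x)%E.
  rewrite -(@ge0_integral_bigsetU _ _ _ mu 'I_m (fun i => `]s i, t i[%classic) f (index_enum 'I_m))//.
  - exact: index_enum_uniq.
  - by apply: sub_trivIset tri.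
  - by apply: measurable_funS (measurable_int _ intf).
  - by move=> x _; rewrite /f lee_fin.
rewrite -sumEFin; apply: eq_bigr => i _; have [q1 q2 q3] := st i.
have hi : integr (s i) (t i) (fun x => `|u x|).
  by apply: integr_norm; apply: integr_sub hu.
rewrite /rint /Rintegral fineK; last exact: integrable_fin_num.
rewrite -integral_itv_obnd_cbnd; last first.
  by apply: (measurable_int mu); apply: integrableS hi => // z /=; rewrite !in_itv/= => /andP[/ltW-> ->].
rewrite -integral_itv_bndo_bndc; last first.
  apply: (measurable_int mu); apply: integrableS hi => // z /=; rewrite !in_itv/= => /andP[/ltW-> /ltW->]//.
apply: eq_integral => x; rewrite inE/= in_itv/= => /andP[sx xt].
by rewrite /f patchE mem_set//= in_itv/= (le_trans q1 (ltW sx)) (le_trans (ltW xt) q3).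
Qed.

(** The extension by 0 turns [u] into a function integrable on the whole line, where the Lebesgue
    differentiation theorem applies. *)
Lemma rint_derive_ae a b u : integr a b u ->
  {ae mu, forall x, a < x < b -> derivable (fun y => rint a y (u \_ `[a, b])) x 1 /\
     derive1 (fun y => rint a y (u \_ `[a, b])) x = u x}.
Proof.
move=> hu; have hp := integr_patch hu.
have loc : locally_integrable setT (u \_ `[a, b]).
  by apply: integrable_locally_restrict hu; exact: measurable_itv.
have := @FTC1 R (u \_ `[a, b]) (BLeft a).
move=> /(_ _ loc) H.
have hy y : mu.-integrable [set` Interval (BLeft a) (BRight y)] (EFin \o (u \_ `[a, b])).
  by apply: integrableS hp.
have {}H := H hy; apply: ae_imply H => x H /andP[ax xb].
have [|h1 h2] := H; first by rewrite /= lte_fin.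
split; first exact: h1.
rewrite -[RHS]/(u x) [LHS]h2.
by rewrite patchE mem_set//= in_itv/= !ltW.
Qed.

End RealIntegral.

(** * Integrals of complex functions; the spaces L^1 and L^2 *)

Section ComplexIntegral.
Variable R : realType.
Implicit Types (a b c x y : R) (u v h : R -> R) (f g : R -> R[i]).
Local Notation mu := (@lebesgue_measure R).
Local Notation cint := (@cintegral_seg R).

Definition meas_seg a b f := measurable_fun `[a, b] (fun x => Re (f x)) /\
  measurable_fun `[a, b] (fun x => Im (f x)).

Lemma meas_ext a b f g : eq_seg a b f g -> meas_seg a b f -> meas_seg a b g.
Proof.
move=> fg [h1 h2]; split.
  by apply: eq_measurable_fun h1 => x; rewrite inE/= in_itv/= => /fg ->.
by apply: eq_measurable_fun h2 => x; rewrite inE/= in_itv/= => /fg ->.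
Qed.

Lemma meas_D a b f g : meas_seg a b f -> meas_seg a b g ->
  meas_seg a b (fun x => f x + g x).
Proof.
move=> [f1 f2] [g1 g2]; split.
  rewrite (_ : (fun x => _) = (fun x => Re (f x) + Re (g x))).
    exact: measurable_funD.
  by apply/funext => x; rewrite ReD.
rewrite (_ : (fun x => _) = (fun x => Im (f x) + Im (g x))).
  exact: measurable_funD.
by apply/funext => x; rewrite ImD.
Qed.

Lemma meas_M a b f g : meas_seg a b f -> meas_seg a b g ->
  meas_seg a b (fun x => f x * g x).
Proof.
move=> [f1 f2] [g1 g2]; split.
  rewrite (_ : (fun x => _) = (fun x => Re (f x) * Re (g x) - Im (f x) * Im (g x))).
    by apply: measurable_funB; exact: measurable_funM.
  by apply/funext => x; rewrite ReM.
rewrite (_ : (fun x => _) = (fun x => Re (f x) * Im (g x) + Im (f x) * Re (g x))).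
  by apply: measurable_funD; exact: measurable_funM.
by apply/funext => x; rewrite ImM.
Qed.

Lemma within_meas a b u :
  (forall x, a <= x <= b -> forall eps : R, 0 < eps -> exists2 r : R, 0 < r &
     forall t, a <= t <= b -> `|t - x| < r -> `|u t - u x| <= eps) ->
  measurable_fun `[a, b] u.
Proof.
move=> H; apply: subspace_continuous_measurable_fun; first exact: measurable_itv.
apply/subspace_continuousP => x /=; rewrite in_itv/= => xab.
apply/cvgrPdist_le => e e0; have [r r0 Hr] := H x xab e e0.
rewrite /within /=; apply/nbhs_ballP; exists r => //= t.
by rewrite /ball /= distrC in_itv/= => tr tab; rewrite distrC Hr.
Qed.

Lemma meas_AC a b f : AC_seg a b f -> meas_seg a b f.
Proof.
move=> hf; split; apply: within_meas => x xab e e0;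
  have [r r0 Hr] := AC_uniform hf e0; exists r => // t tab tr; apply: ltW.
  by rewrite -ReB; apply: le_lt_trans (Re_le_cmod _) _; exact: Hr.
by rewrite -ImB; apply: le_lt_trans (Im_le_cmod _) _; exact: Hr.
Qed.

Lemma meas_cmod a b f : meas_seg a b f -> measurable_fun `[a, b] (fun x => cmod (f x)).
Proof.
move=> [h1 h2].
rewrite (_ : (fun x => _) = Num.sqrt \o (fun x => Re (f x) ^+ 2 + Im (f x) ^+ 2)); last first.
  by apply/funext => x; rewrite cmodE.
apply: measurableT_comp.
  by apply: continuous_measurable_fun; exact: sqrt_continuous.
by apply: measurable_funD; exact: measurable_funX.
Qed.

Lemma L1_meas a b f : L1_seg a b f -> meas_seg a b f.
Proof. by move=> [h1 h2]; split; exact: integr_meas. Qed.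

Lemma L1_dom a b f h : meas_seg a b f -> integr a b h ->
  (forall x, a <= x <= b -> cmod (f x) <= h x) -> L1_seg a b f.
Proof.
move=> [h1 h2] hh H; split; apply: integr_dom hh _ => // x /H hx.
  exact: le_trans (Re_le_cmod _) hx.
exact: le_trans (Im_le_cmod _) hx.
Qed.

Lemma L1_cmod a b f : L1_seg a b f -> integr a b (fun x => cmod (f x)).
Proof.
move=> hf; have [h1 h2] := hf.
apply: (integr_dom (meas_cmod (L1_meas hf)) (integrD (integr_norm h1) (integr_norm h2))).
by move=> x _; rewrite ger0_norm ?cmod_ge0//; exact: cmod_ReIm.
Qed.

Lemma L1_ext a b f g : eq_seg a b f g -> L1_seg a b f -> L1_seg a b g.
Proof.
move=> fg hf; apply: (L1_dom (meas_ext fg (L1_meas hf)) (L1_cmod hf)).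
by move=> x xab; rewrite fg.
Qed.

Lemma L1_D a b f g : L1_seg a b f -> L1_seg a b g ->
  L1_seg a b (fun x => f x + g x).
Proof.
move=> hf hg; apply: (L1_dom (meas_D (L1_meas hf) (L1_meas hg))
  (integrD (L1_cmod hf) (L1_cmod hg))) => x _; exact: cmodD.
Qed.

Lemma L1_M a b f g M : meas_seg a b g -> (forall x, a <= x <= b -> cmod (g x) <= M) ->
  L1_seg a b f -> L1_seg a b (fun x => g x * f x).
Proof.
move=> mg gM hf; apply: (L1_dom (meas_M mg (L1_meas hf)) (integrZ M (L1_cmod hf))).
by move=> x xab; rewrite cmodM ler_wpM2r ?cmod_ge0// gM.
Qed.

Lemma L1_ACM a b f g : AC_seg a b g -> L1_seg a b f ->
  L1_seg a b (fun x => g x * f x).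
Proof.
move=> hg hf; have [M _ HM] := AC_bounded hg.
exact: L1_M (meas_AC hg) HM hf.
Qed.

Lemma L1_Z a b f (z : R[i]) : L1_seg a b f -> L1_seg a b (fun x => z * f x).
Proof. exact/L1_ACM/AC_cst. Qed.

Lemma L1_cst a b (z : R[i]) : L1_seg a b (fun=> z).
Proof. by split; exact: integr_cst. Qed.

Lemma L1_AC a b f : AC_seg a b f -> L1_seg a b f.
Proof.
move=> hf; apply: (@L1_ext a b (fun x => f x * 1)) => [x _|]; first by rewrite mulr1.
exact: L1_ACM hf (L1_cst a b 1).
Qed.

Lemma L1_sum a b (I : Type) (l : seq I) (P : pred I) (F : I -> R -> R[i]) :
  (forall i, P i -> L1_seg a b (F i)) ->
  L1_seg a b (fun x => \sum_(i <- l | P i) F i x).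
Proof.
move=> h; elim: l => [|i l IH].
  by apply: L1_ext (L1_cst a b 0) => x _; rewrite big_nil.
apply: (@L1_ext a b (fun t => if P i then F i t + \sum_(j <- l | P j) F j t
    else \sum_(j <- l | P j) F j t)) => [t _|]; first by rewrite big_cons.
by case Pi : (P i) => //; apply: L1_D => //; exact: h.
Qed.

Lemma L1_sub a b c d f : a <= c -> d <= b -> L1_seg a b f -> L1_seg c d f.
Proof. by move=> ac db [h1 h2]; split; exact: integr_sub ac db _. Qed.

Lemma cint_ext a b f g : eq_seg a b f g -> cint a b f = cint a b g.
Proof.
by move=> fg; congr Complex; apply: rint_ext => x /fg ->.
Qed.

Lemma cintD a b f g : L1_seg a b f -> L1_seg a b g ->
  cint a b (fun x => f x + g x) = cint a b f + cint a b g.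
Proof.
move=> [f1 f2] [g1 g2]; apply: complex_eqP; rewrite ?ReD ?ImD /=.
  rewrite -[LHS]/(rint a b _) -rintD//; apply: rint_ext => x _; exact: ReD.
rewrite -[LHS]/(rint a b _) -rintD//; apply: rint_ext => x _; exact: ImD.
Qed.

Lemma cintZ a b f (z : R[i]) : L1_seg a b f ->
  cint a b (fun x => z * f x) = z * cint a b f.
Proof.
move=> [f1 f2]; apply: complex_eqP; rewrite ?ReM ?ImM.
  transitivity (rint a b (fun x => Re z * Re (f x) + (- Im z) * Im (f x))).
    by apply: rint_ext => x _; rewrite ReM mulNr.
  by rewrite rintD ?rintZ ?mulNr//; exact: integrZ.
transitivity (rint a b (fun x => Re z * Im (f x) + Im z * Re (f x))).
  by apply: rint_ext => x _; rewrite ImM.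
by rewrite rintD ?rintZ//; exact: integrZ.
Qed.

(** The factor 2 comes from treating real and imaginary parts separately; it is absorbed by later
    constants. *)
Lemma cint_bound a b f h : L1_seg a b f -> integr a b h ->
  (forall x, a <= x <= b -> cmod (f x) <= h x) -> cmod (cint a b f) <= 2 * rint a b h.
Proof.
move=> [f1 f2] hh H; apply: le_trans (cmod_ReIm _) _ => /=.
have h1 : `|rint a b (fun x => Re (f x))| <= rint a b h.
  apply: le_trans (rint_norm f1) _; apply: rint_le => //; first exact: integr_norm.
  by move=> x /H; exact: le_trans (Re_le_cmod _).
have h2 : `|rint a b (fun x => Im (f x))| <= rint a b h.
  apply: le_trans (rint_norm f2) _; apply: rint_le => //; first exact: integr_norm.
  by move=> x /H; exact: le_trans (Im_le_cmod _).
move: h1 h2; rewrite /rint; lra.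
Qed.

Lemma cint_split a c b f : a <= c -> c <= b -> L1_seg a b f ->
  cint a b f = cint a c f + cint c b f.
Proof.
move=> ac cb [f1 f2]; apply: complex_eqP; rewrite ?ReD ?ImD /=; exact: rint_split.
Qed.

Lemma cint_sub a x y b f : a <= x -> x <= y -> y <= b -> L1_seg a b f ->
  cint a y f - cint a x f = cint x y f.
Proof.
move=> ax xy yb hf; rewrite (@cint_split a x y)//; last exact: L1_sub hf.
by rewrite addrAC subrr add0r.
Qed.

Lemma cint_AC a b f : L1_seg a b f -> AC_seg a b (fun x => cint a x f).
Proof.
move=> hf e e0; have e20 : 0 < e / 2 by rewrite divr_gt0.
have [d d0 Hd] := rint_abs_continuous (L1_cmod hf) e20.
exists d => // m s t st tri lt_d; have := Hd m s t st tri lt_d => h.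
apply: le_lt_trans (_ : 2 * \sum_(i < m) rint (s i) (t i) (fun x => `|cmod (f x)|) < e);
  last by lra.
rewrite mulr_sumr; apply: ler_sum => i _; have [q1 q2 q3] := st i.
rewrite (cint_sub q1 q2 q3 hf); apply: cint_bound.
- exact: L1_sub hf.
- by apply/integr_norm/L1_cmod; exact: L1_sub hf.
- by move=> x _; rewrite ger0_norm ?cmod_ge0.
Qed.

Lemma derive1_slope u x l : derivable u x 1 -> derive1 u x = l ->
  forall eps : R, 0 < eps -> exists2 r : R, 0 < r & forall t,
    `|t - x| < r -> `|u t - u x - l * (t - x)| <= eps * `|t - x|.
Proof.
move=> du <- eps e0; rewrite derive1E.
have : h^-1 *: (u (h *: 1 + x) - u x) @[h --> 0^'] --> 'D_1 u x by exact: du.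
move=> /cvgrPdist_le /(_ _ e0); rewrite /= /dnbhs /within /= => /nbhs_ballP[r /= r0 Hr].
exists r => // t tr.
have [->|tx] := eqVneq t x; first by rewrite !subrr mulr0 subrr normr0 mulr0.
have tx0 : t - x != 0 by rewrite subr_eq0.
have := Hr (t - x); rewrite /ball /= sub0r normrN => /(_ tr tx0).
rewrite /GRing.scale /= mulr1 subrK => h.
rewrite [X in `|X|](_ : _ = - ('D_1 u x - (t - x)^-1 * (u t - u x)) * (t - x)); last by field.
by rewrite normrM normrN ler_wpM2r.
Qed.

Lemma cint_derive a b f : L1_seg a b f ->
  {ae mu, forall x, a < x < b -> dseg a b (fun y => cint a y f) x (f x)}.
Proof.
move=> [f1 f2]; have H := ae_and (rint_derive_ae f1) (rint_derive_ae f2).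
apply: ae_imply H => x [H1 H2] xab.
have [d1 e1] := H1 xab; have [d2 e2] := H2 xab.
have E u y : a <= y <= b -> rint a y (u \_ `[a, b]) = rint a y u.
  move=> /andP[ay yb]; apply: rint_ext => z /andP[az zy].
  by rewrite patchE mem_set//= in_itv/= az (le_trans zy yb).
have xab' : a <= x <= b by case/andP : xab => /ltW-> /ltW->.
apply/is_derive_segP; rewrite /is_derive_seg; split; apply/real_slopeP => eps e0.
  have [r r0 Hr] := derive1_slope d1 e1 e0; exists r => // t tab tr.
  by have := Hr t tr; rewrite !E.
have [r r0 Hr] := derive1_slope d2 e2 e0; exists r => // t tab tr.
by have := Hr t tr; rewrite !E.
Qed.

Lemma ae_neq (z : R) : {ae mu, forall x, x <> z}.
Proof.
exists [set z]; split; [exact: measurable_set1|exact: lebesgue_measure_set1|].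
by move=> x /= /contrapT.
Qed.

Lemma cint_derive_ae a b f : L1_seg a b f ->
  {ae mu, forall x, a <= x <= b -> dseg a b (fun y => cint a y f) x (f x)}.
Proof.
move=> hf; have := ae_and (cint_derive hf) (ae_and (ae_neq a) (ae_neq b)).
apply: ae_imply => x [H [xa xb]] /andP[ax bx]; apply: H; rewrite !lt_neqAle ax bx.
by apply/andP; split; apply/andP; split => //; apply/eqP => // e; apply: xa.
Qed.

Lemma L2_bounded a b f M : meas_seg a b f -> (forall x, a <= x <= b -> cmod (f x) <= M) ->
  L2_seg a b f /\ (sqnorm2_seg a b f <= (M ^+ 2 * `|b - a|)%:E)%E.
Proof.
move=> mf fM.
have B : (sqnorm2_seg a b f <= (M ^+ 2 * `|b - a|)%:E)%E.
  apply: (@le_trans _ _ (\int[mu]_(x in `[a, b]) (M ^+ 2)%:E)%E).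
    apply: ge0_le_integral => //=.
    - by move=> x _; rewrite lee_fin sqr_ge0.
    - by apply/measurable_EFinP; apply: measurable_funX; exact: meas_cmod.
    - move=> x; rewrite in_itv/= => xab; rewrite lee_fin lerXn2r ?nnegrE ?cmod_ge0//; last exact: fM.
      exact: le_trans (cmod_ge0 (f x)) (fM _ xab).
  rewrite integral_cst//; have E := @lebesgue_measure_itv R `[a, b].
  rewrite [X in (_ * X)%E]E /= lte_fin; case: ifP => h.
    by rewrite -EFinB -EFinM lee_fin ler_wpM2l ?sqr_ge0// ler_norm.
  by rewrite mule0 lee_fin mulr_ge0 ?sqr_ge0.
by case: mf => h1 h2; split=> //; split => //; exact: le_lt_trans B (ltry _).
Qed.

Lemma L2_integr a b f : L2_seg a b f ->
  integr a b (fun x => cmod (f x) ^+ 2) /\ (sqnorm2_seg a b f = (rint a b (fun x => cmod (f x) ^+ 2))%:E)%E.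
Proof.
move=> [h1 h2 h3].
have I : integr a b (fun x => cmod (f x) ^+ 2).
  apply/integrableP; split.
    by apply/measurable_EFinP; apply: measurable_funX; apply: meas_cmod.
  apply: le_lt_trans h3; rewrite le_eqVlt; apply/orP; left; apply/eqP.
  by apply: eq_integral => x _; rewrite /= ger0_norm ?sqr_ge0.
split => //; rewrite /rint /Rintegral fineK//.
exact: integrable_fin_num.
Qed.

Lemma L2_L1 a b f : L2_seg a b f -> L1_seg a b f.
Proof.
move=> hf; have [I _] := L2_integr hf; case: hf => h1 h2 _.
apply: (@L1_dom a b f (fun x => 1 + cmod (f x) ^+ 2)) => //.
  by apply: integrD => //; exact: integr_cst.
move=> x _; have := sqr_ge0 (cmod (f x) - 1); have := cmod_ge0 (f x); nra.
Qed.

Lemma L2_D a b f g : L2_seg a b f -> L2_seg a b g -> L2_seg a b (fun x => f x + g x).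
Proof.
move=> hf hg; have [I1 _] := L2_integr hf; have [I2 _] := L2_integr hg.
case: hf => f1 f2 _; case: hg => g1 g2 _.
have [m1 m2] : meas_seg a b (fun x => f x + g x) by exact: meas_D.
split => //.
have I := integrZ 2 (integrD I1 I2).
have : integr a b (fun x => cmod (f x + g x) ^+ 2).
  apply: integr_dom I _; first by apply: measurable_funX; exact: meas_cmod.
  move=> x _; rewrite ger0_norm ?sqr_ge0//.
  have h := cmodD (f x) (g x); have h0 := cmod_ge0 (f x + g x).
  have := sqr_ge0 (cmod (f x) - cmod (g x)).
  have : cmod (f x + g x) ^+ 2 <= (cmod (f x) + cmod (g x)) ^+ 2.
    by rewrite lerXn2r ?nnegrE// (le_trans h0 h).
  rewrite !expr2; lra.
move=> /integrableP[_]; apply: le_lt_trans; rewrite le_eqVlt; apply/orP; left; apply/eqP.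
by apply: eq_integral => x _; rewrite /= ger0_norm ?sqr_ge0.
Qed.

Lemma L2_ext a b f g : eq_seg a b f g -> L2_seg a b f -> L2_seg a b g.
Proof.
move=> fg [h1 h2 h3]; have [m1 m2] := meas_ext fg (conj h1 h2); split => //.
apply: le_lt_trans h3; rewrite le_eqVlt; apply/orP; left; apply/eqP.
by apply: eq_integral => x; rewrite inE/= in_itv/= => /fg ->.
Qed.

(* Cauchy-Schwarz, by expanding the square of s |f| - N. *)
Lemma L2_norm1 a b f : a < b -> L2_seg a b f ->
  rint a b (fun x => cmod (f x)) ^+ 2 <= (b - a) * rint a b (fun x => cmod (f x) ^+ 2).
Proof.
move=> ab hf; have [I _] := L2_integr hf; have I1 := L1_cmod (L2_L1 hf).
set N := rint a b _; set Q := rint a b _.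
have s0 : 0 < b - a by rewrite subr_gt0.
have : 0 <= rint a b (fun x => (b - a) ^+ 2 * cmod (f x) ^+ 2 + (- (2 * (b - a) * N) * cmod (f x) + N ^+ 2)).
  apply: rint_ge0 => x _.
  have := sqr_ge0 ((b - a) * cmod (f x) - N); nra.
rewrite rintD; [|exact: integrZ|by apply: integrD; [exact: integrZ|exact: integr_cst]].
rewrite rintD; [|exact: integrZ|exact: integr_cst].
rewrite (rint_cst _ (ltW ab)) !rintZ// -/N -/Q => h.
have {h} : 0 <= (b - a) * ((b - a) * Q - N ^+ 2) by rewrite !expr2 in h *; nra.
by rewrite pmulr_rge0// subr_ge0.
Qed.

End ComplexIntegral.

(** * The equation y^(n) = m y + g *)

Lemma dvdn_between n m : (n %| m)%N -> (0 < m < 2 * n)%N -> m = n.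
Proof.
case/dvdnP => q -> /andP[]; rewrite muln_gt0 => /andP[q0 n0].
by rewrite ltn_mul2r n0 /= ltnS => q1; rewrite (_ : q = 1%N) ?mul1n//; apply/eqP; rewrite eqn_leq q1.
Qed.

Lemma ae_forall_fin (R : realType) (I : finType) (A : I -> R -> Prop) :
  (forall i, {ae @lebesgue_measure R, forall x, A i x}) ->
  {ae @lebesgue_measure R, forall x, forall i, A i x}.
Proof.
move=> h; suff : {ae @lebesgue_measure R, forall x, forall i, i \in enum I -> A i x}.
  by apply: ae_imply => x H i; apply: H; rewrite mem_enum.
elim: (enum I) => [|i l IH].
  by apply: (@ae_imply _ (fun=> True)) => //; exact: aeW.
apply: ae_imply (ae_and (h i) IH) => x [h1 h2] j; rewrite inE => /orP[/eqP->//|].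
exact: h2.
Qed.

Section BoundaryValueProblem.
Variables (R : realType) (a b : R) (n : nat).
Hypotheses (ab : a < b) (n_gt0 : (0 < n)%N).
Variables (P Q : 'I_n -> {poly R[i]}).
Hypotheses (szP : forall j, (size (P j) <= n)%N) (szQ : forall j, (size (Q j) <= n)%N).
Local Notation cint := (@cintegral_seg R).

(** The equation as a first order system; the top derivative is replaced by the right-hand side, so
    [Y n] does not occur. *)
Definition ode_sol (m : R[i]) (g : R -> R[i]) (Y : nat -> R -> R[i]) : Prop :=
  [/\ forall k, (k < n)%N -> AC_seg a b (Y k),
      forall k, (k.+1 < n)%N -> forall x, a <= x <= b -> dseg a b (Y k) x (Y k.+1 x) &
      {ae @lebesgue_measure R, forall x, a <= x <= b ->
         dseg a b (Y n.-1) x (m * Y 0%N x + g x)}].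

Definition bc (Y : nat -> R -> R[i]) : Prop :=
  forall j, \sum_(k < n) (P j)`_k * Y k a + \sum_(k < n) (Q j)`_k * Y k b = 0.

Lemma bc_lin (Y Z : nat -> R -> R[i]) (c : R[i]) : bc Y -> bc Z ->
  bc (fun k x => Y k x + c * Z k x).
Proof.
move=> hY hZ j; transitivity
  ((\sum_(k < n) (P j)`_k * Y k a + \sum_(k < n) (Q j)`_k * Y k b) +
  c * (\sum_(k < n) (P j)`_k * Z k a + \sum_(k < n) (Q j)`_k * Z k b)); last first.
  by rewrite hY hZ mulr0 addr0.
rewrite mulrDr addrACA !mulr_sumr -!big_split/=.
by apply: eq_bigr => i _; ring.
Qed.

Lemma ode_sol_lin m g h (Y Z : nat -> R -> R[i]) (c : R[i]) :
  ode_sol m g Y -> ode_sol m h Z ->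
  ode_sol m (fun x => g x + c * h x) (fun k x => Y k x + c * Z k x).
Proof.
move=> [Y1 Y2 Y3] [Z1 Z2 Z3]; split.
- by move=> k kn; apply: AC_D; [exact: Y1|exact/AC_Z/Z1].
- by move=> k kn x xab; apply: dsegD; [exact: Y2|exact/dsegZ/Z2].
- apply: ae_imply (ae_and Y3 Z3) => x [h1 h2] xab.
  have -> : m * (Y 0%N x + c * Z 0%N x) + (g x + c * h x) =
    (m * Y 0%N x + g x) + c * (m * Z 0%N x + h x) by ring.
  by apply: dsegD; [exact: h1|exact/dsegZ/h2].
Qed.

Lemma ode_sol_ext m g h Y : eq_seg a b g h -> ode_sol m g Y -> ode_sol m h Y.
Proof.
move=> gh [h1 h2 h3]; split => //; apply: ae_imply h3 => x h3 xab.
by rewrite -gh//; exact: h3.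
Qed.

Variables (r eps : R[i]).
Hypotheses (r_neq0 : r != 0) (eps_prim : n.-primitive_root eps).

(** The characteristic exponents, i.e. the n-th roots of r^n. *)
Definition kap (k : 'I_n) : R[i] := r * eps ^+ k.

Lemma kapX k : kap k ^+ n = r ^+ n.
Proof. by rewrite exprMn -exprM mulnC exprM (prim_expr_order eps_prim) expr1n mulr1. Qed.

Lemma kap_neq0 k : kap k != 0.
Proof.
rewrite mulf_neq0// expf_neq0//; apply/eqP => e0.
have := prim_expr_order eps_prim; rewrite e0 expr0n eqn0Ngt n_gt0 /= => /esym/eqP.
by rewrite oner_eq0.
Qed.

Lemma natn_neq0 : n%:R != 0 :> R[i].
Proof. by rewrite pnatr_eq0 -lt0n. Qed.

Lemma sum_prim_root_exp e : \sum_(k < n) (eps ^+ k) ^+ e =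
  if (n %| e)%N then n%:R else 0 :> R[i].
Proof.
have E k : (eps ^+ k) ^+ e = (eps ^+ e) ^+ k by rewrite -!exprM mulnC.
under eq_bigr do rewrite E.
case: ifPn => ne.
  have -> : eps ^+ e = 1 by apply/eqP; rewrite -(prim_order_dvd eps_prim).
  by under eq_bigr do rewrite expr1n; rewrite sumr_const card_ord.
have e1 : eps ^+ e - 1 != 0 by rewrite subr_eq0 -(prim_order_dvd eps_prim).
apply: (mulfI e1); rewrite mulr0 -subrX1 -exprM mulnC exprM.
by rewrite (prim_expr_order eps_prim) expr1n subrr.
Qed.

Lemma sum_kapX e : \sum_(k < n) kap k ^+ e = if (n %| e)%N then n%:R * r ^+ e else 0.
Proof.
under eq_bigr do rewrite exprMn; rewrite -mulr_sumr sum_prim_root_exp.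
by case: ifP; rewrite ?mulr0// mulrC.
Qed.

Local Notation m := (r ^+ n).

Lemma rn_neq0 : n%:R * m != 0.
Proof. by rewrite mulf_neq0 ?natn_neq0// expf_neq0. Qed.

(** Orthogonality of roots of unity: the exponent n + j - i lies strictly between 0 and 2n, so n
    divides it only for i = j. Hence two Vandermonde matrices are inverse to each other up to the
    factor n r^n. *)
Lemma kap_sum_inv (i j : 'I_n) :
  \sum_(k < n) kap k ^+ j.+1 * kap k ^+ (n.-1 - i) = if i == j then n%:R * m else 0.
Proof.
under eq_bigr do rewrite -exprD.
have i1 : (i <= n.-1)%N by rewrite -ltnS prednK.
have j1 := ltn_ord j; have i2 := ltn_ord i.
have -> : (j.+1 + (n.-1 - i) = n + j - i)%N by lia.
rewrite sum_kapX; case: eqP => [->|/eqP ij].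
  by rewrite addnK dvdnn.
case: ifPn => // /dvdn_between/(_ _)qE.
have {}qE : (n + j - i = n)%N by apply: qE; lia.
by case/eqP : ij; apply/val_inj => /=; lia.
Qed.

(** Variation of constants for z' = kap_k z + g. *)
Definition mode (g : R -> R[i]) (k : 'I_n) (D : R[i]) (x : R) : R[i] :=
  cexp (kap k * x%:C) * (D + cint a x (fun t => cexp (- kap k * t%:C) * g t)).

(** Inverse of the substitution z_k = sum_j kap_k^(n-1-j) y^(j), which decouples the equation of
    order n into n equations of order 1. *)
Definition of_modes (z : 'I_n -> R -> R[i]) (j : nat) (x : R) : R[i] :=
  (n%:R * m)^-1 * \sum_(k < n) kap k ^+ j.+1 * z k x.

Lemma L1_kernel g k : L1_seg a b g -> L1_seg a b (fun t => cexp (k * t%:C) * g t).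
Proof. exact/L1_ACM/AC_cexp. Qed.

Lemma mode_AC g k D : L1_seg a b g -> AC_seg a b (mode g k D).
Proof.
move=> hg; apply: AC_M; first exact: AC_cexp.
by apply: AC_D; [exact: AC_cst|exact/cint_AC/L1_kernel].
Qed.

Lemma mode_derive g k D : L1_seg a b g ->
  {ae @lebesgue_measure R, forall x, a <= x <= b ->
     dseg a b (mode g k D) x (kap k * mode g k D x + g x)}.
Proof.
move=> hg; apply: ae_imply (cint_derive_ae (L1_kernel (- kap k) hg)) => x H xab.
have h := dsegM (@dseg_cexp R a b (kap k) x) (dsegD (@dseg_cst R a b D x) (H xab)).
rewrite add0r mulrA -cexpD mulNr subrr cexp0 mul1r -mulrA in h.
exact: h.
Qed.

Lemma ode_sol_of_modes g D : L1_seg a b g ->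
  ode_sol m g (of_modes (fun k => mode g k (D k))).
Proof.
move=> hg.
have AY k : AC_seg a b (of_modes (fun k => mode g k (D k)) k).
  apply/AC_Z/AC_sum => i _; apply/AC_Z; exact: mode_AC.
have DY j : {ae @lebesgue_measure R, forall x, a <= x <= b ->
    dseg a b (of_modes (fun k => mode g k (D k)) j) x
      ((n%:R * m)^-1 * \sum_(k < n) kap k ^+ j.+1 * (kap k * mode g k (D k) x + g x))}.
  have : {ae @lebesgue_measure R, forall x, forall k, a <= x <= b ->
     dseg a b (mode g k (D k)) x (kap k * mode g k (D k) x + g x)}.
    by apply: ae_forall_fin => k; exact: mode_derive.
  apply: ae_imply => x H xab; apply: dsegZ; apply: dseg_sum => k _.
  by apply: dsegZ; exact: H.
(* The coefficient of [g] is a power sum of the exponents: it vanishes for j.+1 < n and equals 1 for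
   j.+1 = n, so [g] enters the last equation only. *)
have E j x : (n%:R * m)^-1 * \sum_(k < n) kap k ^+ j.+1 * (kap k * mode g k (D k) x + g x)
   = of_modes (fun k => mode g k (D k)) j.+1 x +
     (if (n %| j.+1)%N then r ^+ j.+1 / m else 0) * g x.
  rewrite /of_modes.
  under eq_bigr do rewrite mulrDr mulrA -exprSr.
  rewrite big_split/= mulrDr -mulr_suml sum_kapX; congr (_ + _).
  rewrite mulrA; congr (_ * _); case: ifP; rewrite ?mulr0// => _.
  by field; rewrite natn_neq0 expf_neq0.
split=> //.
- move=> k kn; apply: AC_derive_continuous => //.
  apply: ae_imply (DY k) => x H xab; have := H xab; rewrite E.
  by rewrite gtnNdvd// mul0r addr0.
- apply: ae_imply (DY n.-1) => x H xab; have := H xab; rewrite E prednK//.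
  rewrite dvdnn divff ?expf_neq0// mul1r; congr (dseg _ _ _ _ (_ + _)).
  rewrite /of_modes mulrCA; congr (_ * _); rewrite mulr_sumr; apply: eq_bigr => k _.
  by rewrite [kap k ^+ n.+1]exprS kapX expr1; ring.
Qed.

(** Each combination z_k satisfies z' = kap_k z + g almost everywhere; multiplied by the integrating
    factor and diminished by the integral, it has derivative 0 and is constant by absolute
    continuity. *)
Lemma modes_of_ode_sol g Y : L1_seg a b g -> ode_sol m g Y ->
  exists D : 'I_n -> R[i], forall j : nat, (j < n)%N -> forall x, a <= x <= b ->
    Y j x = of_modes (fun k => mode g k (D k)) j x.
Proof.
move=> hg [AY CY DY].
pose z k x := \sum_(j < n) kap k ^+ (n.-1 - j) * Y j x.
have zY (j : 'I_n) x : Y j x = of_modes z j x.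
  rewrite /of_modes /z.
  transitivity ((n%:R * m)^-1 * \sum_(i < n) (\sum_(k < n) kap k ^+ j.+1 * kap k ^+ (n.-1 - i)) * Y i x).
    rewrite (bigD1 j)//= kap_sum_inv eqxx big1 ?addr0; first by rewrite mulKf// rn_neq0.
    by move=> i ij; rewrite kap_sum_inv (negbTE ij) mul0r.
  congr (_ * _); under eq_bigr do rewrite mulr_suml; rewrite exchange_big/=.
  by apply: eq_bigr => k _; rewrite mulr_sumr; apply: eq_bigr => i _; rewrite mulrA.
have Az k : AC_seg a b (z k) by apply: AC_sum => j _; apply/AC_Z/AY.
have Dz k : {ae @lebesgue_measure R, forall x, a <= x <= b ->
    dseg a b (z k) x (kap k * z k x + g x)}.
  apply: ae_imply DY => x H xab; have {}H := H xab.
  pose d (j : 'I_n) := if (j.+1 < n)%N then Y j.+1 x else m * Y 0%N x + g x.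
  (* Multiplication by kap_k shifts the powers by one; the term with j = 0 becomes kap_k^n Y_0 = m
     Y_0, which together with [g] is the derivative of Y_(n-1). *)
  have -> : kap k * z k x + g x = \sum_(j < n) kap k ^+ (n.-1 - j) * d j.
    have S (F : nat -> R[i]) : \sum_(i < n) F i = \sum_(i < n.-1.+1) F i by rewrite prednK.
    rewrite /z mulr_sumr (S (fun i => kap k * (kap k ^+ (n.-1 - i) * Y i x))).
    rewrite (S (fun j => kap k ^+ (n.-1 - j) * (if (j.+1 < n)%N then Y j.+1 x else m * Y 0%N x + g x))).
    rewrite big_ord_recl big_ord_recr/= (prednK n_gt0) ltnn subnn expr0 mul1r subn0.
    rewrite mulrA -exprS (prednK n_gt0) kapX.
    rewrite addrAC [RHS]addrC; congr (_ + _).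
    apply: eq_bigr => i _; have ii := ltn_ord i.
    have -> : (i.+1 < n)%N by lia.
    rewrite mulrA -exprS /bump /= add1n; congr (_ ^+ _ * _); lia.
  apply: dseg_sum => j _; apply: dsegZ; rewrite /d; case: ifPn => jn.
    exact: CY.
  have -> : (j : nat) = n.-1 by have := ltn_ord j; lia.
  exact: H.
pose w k x := cexp (- kap k * x%:C) * z k x +
   (-1) * cint a x (fun t => cexp (- kap k * t%:C) * g t).
exists (fun k => w k a) => j jn x xab.
rewrite (zY (Ordinal jn)) /of_modes; congr (_ * _); apply: eq_bigr => k _; congr (_ * _).
have Aw : AC_seg a b (w k).
  apply: AC_D; last by apply/AC_Z/cint_AC/L1_kernel.
  by apply: AC_M; [exact: AC_cexp|exact: Az].
have Dw : {ae @lebesgue_measure R, forall x, a <= x <= b -> dseg a b (w k) x 0}.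
  apply: ae_imply (ae_and (Dz k) (cint_derive_ae (L1_kernel (- kap k) hg))) => y [H1 H2] yab.
  have h := dsegD (dsegM (@dseg_cexp R a b (- kap k) y) (H1 yab)) (dsegZ (-1) (H2 yab)).
  rewrite (_ : _ + _ = 0) in h; first exact: h.
  by ring.
rewrite /mode -(AC_derive0_const Aw Dw xab) /w mulN1r subrK mulrA -cexpD mulNr subrr.
by rewrite cexp0 mul1r.
Qed.

End BoundaryValueProblem.

(** * Determinants and inverses of bounded matrices *)

Section DeterminantBounds.
Variable R : realType.

Lemma cmod_sign (bb : bool) : cmod ((-1) ^+ bb : R[i]) = 1.
Proof. by case: bb; rewrite ?expr0 ?expr1 ?cmodN ?cmod1. Qed.

Lemma det_bound (k : nat) (A : 'M[R[i]]_k) (B : R) :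
  (forall i j, cmod (A i j) <= B) -> cmod (\det A) <= (k`!)%:R * B ^+ k.
Proof.
move=> AB; apply: le_trans (cmod_sum _ _ _) _.
apply: le_trans (_ : \sum_(s : 'S_k) B ^+ k <= _); last first.
  by rewrite sumr_const card_Sn mulr_natl.
apply: ler_sum => s _; rewrite cmodM cmod_sign mul1r cmod_prod.
rewrite -[X in _ <= _ ^+ X]card_ord -prodr_const.
by apply: ler_prod => i _; rewrite cmod_ge0 AB.
Qed.

(** Cramer's rule; the cofactors are determinants of order k - 1. *)
Lemma invmx_bound (k : nat) (A : 'M[R[i]]_k) (B d : R) : 0 <= B -> 0 < d ->
  (forall i j, cmod (A i j) <= B) -> d <= cmod (\det A) ->
  forall i j, cmod (invmx A i j) <= d^-1 * ((k.-1)`!%:R * B ^+ k.-1).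
Proof.
move=> B0 d0 AB dA i j.
have uA : A \in unitmx.
  by rewrite unitmxE unitfE -cmod_gt0 (lt_le_trans d0).
rewrite /invmx uA !mxE cmodM cmodV.
apply: ler_pM; rewrite ?invr_ge0 ?cmod_ge0//.
  by rewrite lef_pV2// posrE (lt_le_trans d0).
rewrite /cofactor cmodM cmodX cmodN cmod1 expr1n mul1r.
by apply: det_bound => i' j'; rewrite !mxE.
Qed.

End DeterminantBounds.

Local Opaque cexp.

(** * The boundary conditions as a linear system *)

Section BoundaryMatrix.
Variables (R : realType) (a b : R) (n : nat).
Hypotheses (ab : a < b) (n_gt0 : (0 < n)%N).
Variables (P Q : 'I_n -> {poly R[i]}).
Hypotheses (szP : forall j, (size (P j) <= n)%N) (szQ : forall j, (size (Q j) <= n)%N).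
Variables (r eps : R[i]).
Hypotheses (r_neq0 : r != 0) (eps_prim : n.-primitive_root eps).
Variable s : 'I_n -> bool.
Local Notation cint := (@cintegral_seg R).
Local Notation m := (r ^+ n).
Local Notation kap := (@kap R n r eps).

(* Each exponential is anchored at the end-point where its modulus is 1; [s k] says
   that this is [a]. *)
Definition lead (k : 'I_n) (x : R) : R[i] :=
  cexp (kap k * (x - (if s k then a else b))%:C).

(** The particular solution integrated from the anchor: over [a, x] if [s k], and otherwise minus
    the integral over [x, b]. In both cases the exponential in the kernel decays away from x. *)
Definition part (g : R -> R[i]) (k : 'I_n) (x : R) : R[i] :=
  cexp (kap k * x%:C) * (cint a x (fun t => cexp (- kap k * t%:C) * g t) -
    if s k then 0 else cint a b (fun t => cexp (- kap k * t%:C) * g t)).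

(** Change of coordinates from the coefficient [c] of the anchored exponential to the constant [D]
    of [mode]. *)
Definition lead_coord (g : R -> R[i]) (k : 'I_n) (c : R[i]) : R[i] :=
  c * cexp (- kap k * (if s k then a else b)%:C) -
    if s k then 0 else cint a b (fun t => cexp (- kap k * t%:C) * g t).

Lemma mode_lead g k c x :
  mode a r eps g k (lead_coord g k c) x = c * lead k x + part g k x.
Proof.
rewrite /mode /lead_coord /lead /part rmorphB mulrBr cexpD mulNr; ring.
Qed.

Lemma mode_lead_inv g k D : exists c, D = lead_coord g k c.
Proof.
exists ((D + if s k then 0 else cint a b (fun t => cexp (- kap k * t%:C) * g t)) *
   cexp (kap k * (if s k then a else b)%:C)).
by rewrite /lead_coord -mulrA -cexpD mulNr subrr cexp0 mulr1 addrK.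
Qed.

(** Row j is the j-th boundary form on the anchored exponentials: differentiation multiplies an
    exponential by its exponent, so P_j(D) becomes the value of P_j there. Up to column factors its
    determinant is the characteristic determinant. *)
Definition bmx : 'M[R[i]]_n :=
  \matrix_(j, k) ((P j).[kap k] * lead k a + (Q j).[kap k] * lead k b).

Definition bvec (g : R -> R[i]) : 'cV[R[i]]_n :=
  \col_j \sum_k kap k * ((P j).[kap k] * part g k a + (Q j).[kap k] * part g k b).

Lemma boundary_form (p : {poly R[i]}) (z : 'I_n -> R -> R[i]) x :
  (size p <= n)%N ->
  \sum_(i < n) p`_i * of_modes r eps z i x =
  (n%:R * m)^-1 * \sum_k kap k * (p.[kap k] * z k x).
Proof.
move=> szp; rewrite /of_modes.
under eq_bigr do rewrite mulrCA mulr_sumr.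
rewrite -mulr_sumr exchange_big /=; congr (_ * _); apply: eq_bigr => k _.
rewrite (horner_coef_wide _ szp) mulr_suml mulr_sumr; apply: eq_bigr => i _.
by rewrite exprS; ring.
Qed.

Lemma bc_of_modes (z : 'I_n -> R -> R[i]) :
  bc a b P Q (of_modes r eps z) <->
  forall j, \sum_k kap k * ((P j).[kap k] * z k a + (Q j).[kap k] * z k b) = 0.
Proof.
have E j : \sum_(k < n) (P j)`_k * of_modes r eps z k a +
    \sum_(k < n) (Q j)`_k * of_modes r eps z k b =
  (n%:R * m)^-1 * \sum_k kap k * ((P j).[kap k] * z k a + (Q j).[kap k] * z k b).
  rewrite !boundary_form// -mulrDr -big_split /=; congr (_ * _).
  by apply: eq_bigr => k _; rewrite mulrDr.
split=> h j; last by rewrite E h mulr0.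
by have := h j; rewrite E => /eqP; rewrite mulf_eq0 invr_eq0 (negbTE (rn_neq0 n_gt0 r_neq0)) /= => /eqP.
Qed.

(** The unknowns are [kap k * c k] because [of_modes] weights mode k by kap_k^(j+1) instead of
    kap_k^j. *)
Lemma bc_lead g (c : 'I_n -> R[i]) :
  bc a b P Q (of_modes r eps (fun k => mode a r eps g k (lead_coord g k (c k)))) <->
  bmx *m (\col_k (kap k * c k)) = - bvec g.
Proof.
rewrite bc_of_modes; have E j :
  \sum_k kap k * ((P j).[kap k] * mode a r eps g k (lead_coord g k (c k)) a +
     (Q j).[kap k] * mode a r eps g k (lead_coord g k (c k)) b) =
  (bmx *m (\col_k (kap k * c k)) + bvec g) j 0.
  rewrite !mxE -big_split /=; apply: eq_bigr => k _; rewrite !mxE !mode_lead; ring.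
split=> [h|h j].
  apply/eqP; rewrite -subr_eq0 opprK; apply/eqP/matrixP => j i.
  by rewrite ord1 -E h mxE.
by rewrite E h addNr mxE.
Qed.

Lemma bvp_exists g : \det bmx != 0 -> L1_seg a b g ->
  exists2 Y, ode_sol a b n m g Y & bc a b P Q Y.
Proof.
move=> d0 hg; have uM : bmx \in unitmx by rewrite unitmxE unitfE.
pose d := invmx bmx *m (- bvec g).
exists (of_modes r eps (fun k => mode a r eps g k (lead_coord g k (d k 0 / kap k)))).
  exact: ode_sol_of_modes.
apply/(@bc_lead g (fun k => d k 0 / kap k)).
rewrite (_ : \col_k _ = d); first by rewrite mulKVmx.
apply/matrixP => k i; rewrite ord1 !mxE mulrC divfK//.
exact: kap_neq0.
Qed.

(** Discrete Fourier inversion: weighting the j-th relation by kap_l^(-j-1) isolates n z_l, since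
    the remaining modes meet full sums of powers of a root of unity other than 1. *)
Lemma of_modes_inj (z : 'I_n -> R -> R[i]) x :
  (forall j, (j < n)%N -> of_modes r eps z j x = 0) -> forall k, z k x = 0.
Proof.
move=> h l.
have h1 (j : 'I_n) : \sum_k kap k ^+ j.+1 * z k x = 0.
  have := h j (ltn_ord j); rewrite /of_modes => /eqP.
  by rewrite mulf_eq0 invr_eq0 (negbTE (rn_neq0 n_gt0 r_neq0)) /= => /eqP.
(* The base [r^-1 * eps ^+ (n - l)] is the inverse of [kap l]. *)
have : \sum_(j < n) (r^-1 * eps ^+ (n - l)) ^+ j.+1 * (\sum_k kap k ^+ j.+1 * z k x) = 0.
  by rewrite big1// => j _; rewrite h1 mulr0.
under eq_bigr do rewrite mulr_sumr; rewrite exchange_big /=.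
rewrite (bigD1 l)//= [X in _ + X]big1 ?addr0 => [|k kl].
  under eq_bigr do rewrite mulrA -exprMn.
  have -> : r^-1 * eps ^+ (n - l) * kap l = 1.
    rewrite /kap mulrACA mulVf// mul1r -exprD subnK ?(ltnW (ltn_ord l))//.
    exact: prim_expr_order.
  under eq_bigr do rewrite expr1n mul1r; rewrite sumr_const card_ord -mulr_natl => /eqP.
  by rewrite mulf_eq0 (negbTE (natn_neq0 _ n_gt0)) /= => /eqP.
under eq_bigr do rewrite mulrA -exprMn; rewrite -mulr_suml.
have -> : r^-1 * eps ^+ (n - l) * kap k = eps ^+ (n - l + k).
  by rewrite /kap mulrACA mulVf// mul1r -exprD.
under eq_bigr do rewrite exprS -exprM mulnC exprM.
rewrite -mulr_sumr (sum_prim_root_exp eps_prim).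
case: ifPn => [/dvdn_between E|_]; last by rewrite mulr0 mul0r.
exfalso; case/eqP : kl; apply/val_inj => /=.
have h2 := ltn_ord l; have h3 := ltn_ord k.
have : (n - l + k = n)%N by apply: E; lia.
lia.
Qed.

(** A null vector of the boundary matrix supplies the coefficients. If the resulting function
    vanished on the segment, so would its derivatives, then every mode at a by [of_modes_inj], and
    then the null vector. *)
Lemma bvp_eigenfunction : \det bmx = 0 ->
  exists Y, [/\ ode_sol a b n m (fun=> 0) Y, bc a b P Q Y &
    ~ eq_seg a b (Y 0%N) (fun=> 0)].
Proof.
move=> d0; have : \det bmx^T == 0 by rewrite det_tr d0.
move=> /det0P[v v0 vM].
pose c k := v 0 k / kap k.
pose Y := of_modes r eps (fun k => mode a r eps (fun=> 0) k (lead_coord (fun=> 0) k (c k))).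
have L0 : L1_seg a b (fun=> 0 : R[i]) by exact: L1_cst.
have z0 k x : cint a x (fun t => cexp (- kap k * t%:C) * 0) = 0.
  rewrite (_ : (fun=> _) = fun=> 0); last by apply/funext => t; rewrite mulr0.
  by rewrite /cintegral_seg /Rintegral /= integral0.
have p0 k x : part (fun=> 0) k x = 0.
  by rewrite /part !z0; case: ifP; rewrite subrr mulr0.
have SY : ode_sol a b n m (fun=> 0) Y by exact: ode_sol_of_modes.
exists Y; split => //.
  apply/(@bc_lead (fun=> 0) c).
  have -> : bvec (fun=> 0) = 0.
    by apply/matrixP => j i; rewrite !mxE big1// => k _; rewrite !p0 !mulr0 addr0 mulr0.
  rewrite oppr0; apply: trmx_inj; rewrite trmx_mul trmx0 -vM; congr (_ *m _).
  by apply/matrixP => i k; rewrite ord1 !mxE mulrC divfK ?kap_neq0.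
move=> Y0.
have Yj j : (j < n)%N -> eq_seg a b (Y j) (fun=> 0).
  elim: j => [//|j IH jn x xab].
  have [_ CY _] := SY.
  have := CY j jn x xab.
  move/(dseg_ext xab (IH (ltnW jn))) => h; exact: dseg_unique ab xab h (@dseg_cst R a b 0 x).
have aab : a <= a <= b by rewrite lexx ltW.
have zk := @of_modes_inj _ a (fun j jn => Yj j jn a aab).
case/eqP : v0; apply/matrixP => i k; rewrite ord1 mxE.
have := zk k; rewrite mode_lead p0 addr0 => /eqP; rewrite mulf_eq0 (negbTE (cexp_neq0 _)) orbF.
by rewrite mulf_eq0 invr_eq0 (negbTE (kap_neq0 _ r_neq0 eps_prim _)) ?orbF// => /eqP.
Qed.

Definition decay (sg : R) (g : R -> R[i]) (x : R) : R :=
  rint a b (fun t => expR (- (sg * `|x - t|)) * cmod (g t)).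

Lemma integr_decay sg g x : 0 <= sg -> L1_seg a b g ->
  integr a b (fun t => expR (- (sg * `|x - t|)) * cmod (g t)).
Proof.
move=> s0 hg; have I := L1_cmod hg; apply: integr_dom I _.
  apply: measurable_funM; last exact: meas_cmod (L1_meas hg).
  apply: measurableT_comp; first exact: measurable_expR.
  apply: measurableT_comp; first exact: oppr_measurable.
  apply: measurable_funM; first exact: measurable_cst.
  apply: measurableT_comp; first exact: normr_measurable.
  by apply: measurable_funB; first exact: measurable_cst.
move=> t _; rewrite ger0_norm ?mulr_ge0 ?expR_ge0 ?cmod_ge0// ler_piMl ?cmod_ge0//.
by rewrite expR_le1 oppr_le0 mulr_ge0.
Qed.

Lemma decay_ge0 sg g x : 0 <= decay sg g x.
Proof. by apply: rint_ge0 => t _; rewrite mulr_ge0 ?expR_ge0 ?cmod_ge0. Qed.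

Lemma decay_le sg g x : 0 <= sg -> L1_seg a b g ->
  decay sg g x <= rint a b (fun t => cmod (g t)).
Proof.
move=> s0 hg; apply: rint_le; [exact: integr_decay|exact: L1_cmod|].
move=> t _; rewrite ler_piMl ?cmod_ge0//.
by rewrite expR_le1 oppr_le0 mulr_ge0.
Qed.

Lemma part_bound sg g k x : 0 <= sg -> L1_seg a b g -> a <= x <= b ->
  (s k -> Re (kap k) <= - sg) -> (~~ s k -> sg <= Re (kap k)) ->
  cmod (part g k x) <= 2 * decay sg g x.
Proof.
move=> sg0 hg /andP[ax xb] h1 h2.
pose u t := cexp (- kap k * t%:C) * g t.
have Lu : L1_seg a b u by exact: L1_kernel.
have I := integr_decay x sg0 hg.
have pos t : a <= t <= b -> 0 <= expR (- (sg * `|x - t|)) * cmod (g t).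
  by move=> _; rewrite mulr_ge0 ?expR_ge0 ?cmod_ge0.
have Eu t : cmod (cexp (kap k * x%:C) * u t) = expR (Re (kap k) * (x - t)) * cmod (g t).
  rewrite /u mulrA -cexpD cmodM cmod_cexp mulNr -mulrBr -rmorphB ReM /= mulr0 subr0 //.
rewrite /part -/u; case: ifPn => sk.
  rewrite subr0 -cintZ; last exact: L1_sub Lu.
  apply: le_trans (_ : 2 * rint a x (fun t => expR (- (sg * `|x - t|)) * cmod (g t)) <= _).
    apply: cint_bound.
    - by apply: L1_Z; exact: L1_sub Lu.
    - exact: integr_sub I.
    - move=> t /andP[at_ tx]; rewrite Eu ler_wpM2r ?cmod_ge0// ler_expR.
      rewrite ger0_norm ?subr_ge0//; have := h1 sk; have : 0 <= x - t by rewrite subr_ge0.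
      nra.
  by rewrite ler_wpM2l//; apply: (@rint_sub_le R a b a x).
have -> : cint a x u - cint a b u = - cint x b u.
  by rewrite -(@cint_sub R a x b b)// opprB.
rewrite mulrN cmodN -cintZ; last exact: L1_sub Lu.
apply: le_trans (_ : 2 * rint x b (fun t => expR (- (sg * `|x - t|)) * cmod (g t)) <= _).
  apply: cint_bound.
  - by apply: L1_Z; exact: L1_sub Lu.
  - exact: integr_sub I.
  - move=> t /andP[xt tb]; rewrite Eu ler_wpM2r ?cmod_ge0// ler_expR.
    rewrite ler0_norm ?subr_le0//; have := h2 sk; have : x - t <= 0 by rewrite subr_le0.
    nra.
by rewrite ler_wpM2l//; apply: (@rint_sub_le R a b x b).
Qed.

Lemma lead_bound k x : a <= x <= b -> (s k -> Re (kap k) <= 0) ->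
  (~~ s k -> 0 <= Re (kap k)) -> cmod (lead k x) <= 1.
Proof.
move=> /andP[ax xb] h1 h2; rewrite cmod_cexp expR_le1 ReM /= mulr0 subr0.
case: ifPn => sk; first by rewrite mulr_le0_ge0 ?h1// subr_ge0.
by rewrite mulr_ge0_le0 ?h2// subr_le0.
Qed.

Variable ord : 'I_n -> nat.

Definition sbmx : 'M[R[i]]_n := \matrix_(j, k) (r ^- ord j * bmx j k).

(** Entries of the inverse matrix by Cramer's rule (entries at most 2B, determinant at least d),
    times n for the product, times the bound n 2B of the scaled right-hand side; the last 2 is that
    of [part_bound]. *)
Definition bvp_const (d B : R) : R :=
  n%:R * (d^-1 * ((n.-1)`!%:R * (2 * B) ^+ n.-1)) * (n%:R * (2 * B)) + 2.

Lemma bvp_const_ge0 d B : 0 < d -> 0 <= B -> 0 <= bvp_const d B.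
Proof.
move=> d0 B0; rewrite addr_ge0// !mulr_ge0 ?invr_ge0 ?(ltW d0)//.
by rewrite exprn_ge0// mulr_ge0.
Qed.

(** The scaled system bounds the coefficients by the boundary values of the particular solutions, of
    size |r| times the decay integrals at a and b. The anchored exponentials are at most 1, and
    [of_modes] contributes |r|^j / |r|^n. *)
Lemma bvp_estimate (d B sg : R) g Y : 0 < d -> 0 <= B -> 0 <= sg ->
  d <= cmod (\det sbmx) ->
  (forall j k, cmod (r ^- ord j * (P j).[kap k]) <= B) ->
  (forall j k, cmod (r ^- ord j * (Q j).[kap k]) <= B) ->
  (forall k, s k -> Re (kap k) <= - sg) -> (forall k, ~~ s k -> sg <= Re (kap k)) ->
  L1_seg a b g -> ode_sol a b n m g Y -> bc a b P Q Y ->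
  forall j x, (j < n)%N -> a <= x <= b ->
  cmod (Y j x) <= bvp_const d B * (cmod r ^+ j.+1 / cmod r ^+ n) *
    (decay sg g a + decay sg g b + decay sg g x).
Proof.
move=> d0 B0 sg0 hd PB QB h1 h2 hg SY bY j x jn xab.
have h1' k : s k -> Re (kap k) <= 0 by move=> /h1; lra.
have h2' k : ~~ s k -> 0 <= Re (kap k) by move=> /h2; lra.
have aab : a <= a <= b by rewrite lexx ltW.
have bab : a <= b <= b by rewrite lexx ltW.
have r0 : 0 < cmod r by rewrite cmod_gt0.
have ckap k : cmod (kap k) = cmod r.
  apply/eqP; rewrite -(@eqrXn2 _ n)// ?cmod_ge0//.
  by rewrite -!cmodX (kapX _ eps_prim).
(* An arbitrary solution is expanded, not only the one built in [bvp_exists]; the estimate therefore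
   also yields uniqueness. *)
have [D HD] := modes_of_ode_sol ab n_gt0 r_neq0 eps_prim hg SY.
have [c HcD] := @choice _ _ _ (fun k => mode_lead_inv g k (D k)).
have HY i y : (i < n)%N -> a <= y <= b -> Y i y =
    of_modes r eps (fun k => mode a r eps g k (lead_coord g k (c k))) i y.
  move=> hi hy; rewrite HD//; congr (_ * _); apply: eq_bigr => k _.
  by rewrite -HcD.
have : bc a b P Q (of_modes r eps (fun k => mode a r eps g k (lead_coord g k (c k)))).
  move=> i; rewrite -[RHS](bY i); congr (_ + _); apply: eq_bigr => k _.
    by rewrite HY.
  by rewrite HY.
move=> /bc_lead Mc.
pose v := \col_k (kap k * c k) : 'cV[R[i]]_n.
pose h := \col_i (r ^- ord i * bvec g i 0) : 'cV[R[i]]_n.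
have Mv : sbmx *m v = - h.
  have -> : sbmx = diag_mx (\row_j r ^- ord j) *m bmx.
    by apply/matrixP => i k; rewrite mul_diag_mx !mxE.
  rewrite -mulmxA Mc; apply/matrixP => i k.
  by rewrite ord1 mul_diag_mx !mxE mulrN.
have uS : sbmx \in unitmx by rewrite unitmxE unitfE -cmod_gt0 (lt_le_trans d0).
have SB i k : cmod (sbmx i k) <= 2 * B.
  rewrite !mxE mulrDr !(mulrA (r ^- _)); apply: le_trans (cmodD _ _) _.
  rewrite (cmodM _ (lead k a)) (cmodM _ (lead k b)) mulrDl !mul1r lerD//.
    by rewrite -[leRHS]mulr1 ler_pM ?cmod_ge0 ?PB// (lead_bound aab (@h1' k) (@h2' k)).
  by rewrite -[leRHS]mulr1 ler_pM ?cmod_ge0 ?QB// (lead_bound bab (@h1' k) (@h2' k)).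
set Ea := decay sg g a; set Eb := decay sg g b; set Ex := decay sg g x.
have Ea0 : 0 <= Ea := decay_ge0 _ _ _.
have Eb0 : 0 <= Eb := decay_ge0 _ _ _.
have Ex0 : 0 <= Ex := decay_ge0 _ _ _.
have pb k y : a <= y <= b -> cmod (part g k y) <= 2 * decay sg g y.
  by move=> yab; apply: part_bound => //; [exact: h1|exact: h2].
have hb i : cmod (h i 0) <= n%:R * (2 * B) * (cmod r * (Ea + Eb)).
  rewrite !mxE mulr_sumr; apply: le_trans (cmod_sum _ _ _) _.
  apply: le_trans (_ : \sum_(k < n) (2 * B * (cmod r * (Ea + Eb))) <= _); last first.
    by rewrite sumr_const card_ord -[leLHS]mulr_natl !mulrA.
  apply: ler_sum => k _.
  rewrite [X in cmod X]mulrCA cmodM ckap [leRHS]mulrCA ler_wpM2l ?(ltW r0)// mulrDr !(mulrA (r ^- _)).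
  apply: le_trans (cmodD _ _) _; rewrite (cmodM _ (part g k a)) (cmodM _ (part g k b)).
  have q1 := ler_pM (cmod_ge0 _) (cmod_ge0 _) (PB i k) (pb k a aab).
  have q2 := ler_pM (cmod_ge0 _) (cmod_ge0 _) (QB i k) (pb k b bab).
  by move: q1 q2; rewrite -/Ea -/Eb; lra.
set K1 := n%:R * (d^-1 * ((n.-1)`!%:R * (2 * B) ^+ n.-1)) * (n%:R * (2 * B)).
have vb k : cmod (kap k * c k) <= K1 * (cmod r * (Ea + Eb)).
  have -> : kap k * c k = (invmx sbmx *m (- h)) k 0.
    by rewrite -Mv mulKmx// mxE.
  rewrite mxE; apply: le_trans (cmod_sum _ _ _) _.
  apply: le_trans (_ : \sum_(i < n) ((d^-1 * ((n.-1)`!%:R * (2 * B) ^+ n.-1)) *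
     (n%:R * (2 * B) * (cmod r * (Ea + Eb)))) <= _); last first.
    by rewrite sumr_const card_ord -[leLHS]mulr_natl /K1 !mulrA.
  apply: ler_sum => i _; rewrite cmodM ler_pM ?cmod_ge0//.
    by apply: invmx_bound => //; rewrite mulr_ge0.
  by rewrite mxE cmodN.
rewrite HY// /of_modes cmodM cmodV cmodM cmodX.
have -> : cmod (n%:R : R[i]) = n%:R.
  by rewrite -[n%:R](rmorph_nat (real_complex R)) cmodR ger0_norm.
have n0 : 0 < n%:R :> R by rewrite ltr0n.
have S1 : cmod (\sum_(k < n) kap k ^+ j.+1 * mode a r eps g k (lead_coord g k (c k)) x) <=
   n%:R * (cmod r ^+ j.+1 * (K1 + 2) * (Ea + Eb + Ex)).
  apply: le_trans (cmod_sum _ _ _) _.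
  apply: le_trans (_ : \sum_(k < n) (cmod r ^+ j.+1 * (K1 + 2) * (Ea + Eb + Ex)) <= _); last first.
    by rewrite sumr_const card_ord -[leLHS]mulr_natl.
  apply: ler_sum => k _; rewrite mode_lead exprSr.
  have -> : kap k ^+ j * kap k * (c k * lead k x + part g k x) =
    kap k ^+ j * (kap k * c k * lead k x + kap k * part g k x) by ring.
  rewrite cmodM cmodX ckap [cmod r ^+ j.+1]exprSr -!(mulrA (cmod r ^+ j)) ler_wpM2l ?exprn_ge0 ?(ltW r0)//.
  apply: le_trans (cmodD _ _) _; rewrite (cmodM _ (lead k x)) (cmodM _ (part g k x)) ckap.
  have l1 : cmod (lead k x) <= 1 := lead_bound xab (@h1' k) (@h2' k).
  have q1 := ler_pM (cmod_ge0 _) (cmod_ge0 _) (vb k) l1.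
  have q2 := ler_wpM2l (ltW r0) (pb k x xab).
  have K10 : 0 <= K1 by rewrite /K1 !mulr_ge0 ?invr_ge0 ?(ltW d0)// exprn_ge0// mulr_ge0.
  apply: le_trans (lerD q1 q2) _; rewrite mulr1 -/Ex.
  have -> : K1 * (cmod r * (Ea + Eb)) + cmod r * (2 * Ex) =
    cmod r * (K1 * (Ea + Eb) + 2 * Ex) by ring.
  rewrite -[leRHS]mulrA ler_wpM2l ?(ltW r0)//.
  have := mulr_ge0 K10 Ex0; lra.
apply: le_trans (ler_wpM2l _ S1) _.
  by rewrite invr_ge0 mulr_ge0 ?exprn_ge0 ?(ltW r0) ?(ltW n0).
rewrite /bvp_const -/K1 le_eqVlt; apply/orP; left; apply/eqP.
by field; rewrite !gt_eqF// exprn_gt0.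
Qed.

End BoundaryMatrix.

(** * Minimum modulus principle *)

Section MinimumModulus.
Variable R : realType.
Implicit Types (f g : R[i] -> R[i]) (p : {poly R[i]}).

(** Uniform limits of polynomials on every disc. The class is closed under sums and products, hence
    under determinants, and contains the exponentials, while no complex differentiation is
    involved. *)
Definition poly_approx f := forall B eps : R, 0 <= B -> 0 < eps ->
  exists p, forall h, cmod h <= B -> cmod (f h - p.[h]) <= eps.

Lemma poly_bounded p (B : R) : exists2 K, 0 <= K & forall h, cmod h <= B -> cmod p.[h] <= K.
Proof.
elim/poly_ind: p => [|p c [K K0 HK]]; first by exists 0 => // h _; rewrite horner0 cmod0.
exists (K * `|B| + cmod c); first by rewrite addr_ge0 ?mulr_ge0 ?cmod_ge0.
move=> h hB; rewrite hornerMXaddC; apply: le_trans (cmodD _ _) _.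
rewrite lerD2r cmodM ler_pM ?cmod_ge0 ?HK//.
exact: le_trans hB (ler_norm _).
Qed.

Lemma poly_lipschitz p (B : R) : exists2 K, 0 <= K & forall h k, cmod h <= B ->
  cmod k <= B -> cmod (p.[h] - p.[k]) <= K * cmod (h - k).
Proof.
elim/poly_ind: p => [|p c [K K0 HK]].
  by exists 0 => // h k _ _; rewrite !horner0 subrr cmod0 mul0r.
have [M M0 HM] := poly_bounded p B.
exists (K * `|B| + M); first by rewrite addr_ge0 ?mulr_ge0.
move=> h k hB kB; rewrite !hornerMXaddC.
have -> : p.[h] * h + c - (p.[k] * k + c) = (p.[h] - p.[k]) * h + p.[k] * (h - k) by ring.
apply: le_trans (cmodD _ _) _; rewrite [leRHS]mulrDl !cmodM lerD//.
  rewrite mulrAC ler_pM ?cmod_ge0 ?HK//; exact: le_trans hB (ler_norm _).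
by rewrite ler_wpM2r ?cmod_ge0 ?HM.
Qed.

Lemma poly_approx_bounded f (B : R) : poly_approx f ->
  exists2 K, 0 <= K & forall h, cmod h <= B -> cmod (f h) <= K.
Proof.
move=> /(_ `|B| 1 (normr_ge0 _) ltr01)[p Hp].
have [K K0 HK] := poly_bounded p `|B|.
exists (1 + K); first by rewrite addr_ge0.
move=> h hB; have hB' : cmod h <= `|B| := le_trans hB (ler_norm _).
have := cmodD (f h - p.[h]) p.[h]; rewrite subrK.
have := Hp _ hB'; have := HK _ hB'; lra.
Qed.

Lemma poly_approx_uniform f (B eps : R) : poly_approx f -> 0 < eps ->
  exists2 d, 0 < d & forall h k, cmod h <= B -> cmod k <= B -> cmod (h - k) < d ->
    cmod (f h - f k) <= eps.
Proof.
move=> hf e0; have e30 : 0 < eps / 3 by rewrite divr_gt0.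
have [p Hp] := hf `|B| _ (normr_ge0 _) e30.
have [K K0 HK] := poly_lipschitz p `|B|.
have K1 : 0 < K + 1 by rewrite ltr_wpDl.
exists (eps / 3 / (K + 1)); first by rewrite divr_gt0.
move=> h k /le_trans/(_ (ler_norm _)) hB /le_trans/(_ (ler_norm _)) kB hk.
have -> : f h - f k = (f h - p.[h]) + (p.[h] - p.[k]) - (f k - p.[k]) by ring.
apply: le_trans (cmodB _ _) _; have := cmodD (f h - p.[h]) (p.[h] - p.[k]).
have h1 := Hp _ hB; have h2 := Hp _ kB; have h3 := HK _ _ hB kB.
have : K * cmod (h - k) <= eps / 3.
  have := hk; rewrite ltr_pdivlMr// => q.
  have := cmod_ge0 (h - k); nra.
lra.
Qed.

Lemma poly_approx_horner p : poly_approx (fun h => p.[h]).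
Proof.
by move=> B eps _ e0; exists p => h _; rewrite subrr cmod0 ltW.
Qed.

Lemma poly_approx_ext f g : f =1 g -> poly_approx f -> poly_approx g.
Proof. by move=> /funext ->. Qed.

Lemma poly_approx_cst (c : R[i]) : poly_approx (fun=> c).
Proof. by apply: poly_approx_ext (poly_approx_horner c%:P) => h; rewrite hornerC. Qed.

Lemma poly_approxD f g : poly_approx f -> poly_approx g ->
  poly_approx (fun h => f h + g h).
Proof.
move=> hf hg B eps B0 e0; have e20 : 0 < eps / 2 by rewrite divr_gt0.
have [p Hp] := hf B _ B0 e20; have [q Hq] := hg B _ B0 e20.
exists (p + q) => h hB; rewrite hornerD opprD addrACA.
apply: le_trans (cmodD _ _) _.
by have := Hp h hB; have := Hq h hB; lra.
Qed.

Lemma poly_approxM f g : poly_approx f -> poly_approx g ->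
  poly_approx (fun h => f h * g h).
Proof.
move=> hf hg B eps B0 e0.
have [F F0 HF] := poly_approx_bounded B hf.
have e1 : 0 < eps / (2 * (F + 1)) by rewrite divr_gt0// mulr_gt0// ltr_wpDl.
(* [q] is chosen first because the tolerance for [p] depends on the bound of [q]. *)
have [q Hq] := hg B _ B0 e1.
have [G G0 HG] := poly_bounded q B.
have e2 : 0 < eps / (2 * (G + 1)) by rewrite divr_gt0// mulr_gt0// ltr_wpDl.
have [p Hp] := hf B _ B0 e2.
exists (p * q) => h hB; rewrite hornerM.
have -> : f h * g h - p.[h] * q.[h] = f h * (g h - q.[h]) + q.[h] * (f h - p.[h]) by ring.
apply: le_trans (cmodD _ _) _; rewrite !cmodM.
have h1 : cmod (f h) * cmod (g h - q.[h]) <= eps / 2.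
  apply: le_trans (ler_pM (cmod_ge0 _) (cmod_ge0 _) (HF h hB) (Hq h hB)) _.
  rewrite [leLHS](_ : _ = F / (F + 1) * (eps / 2)); last by field; rewrite gt_eqF// ltr_wpDl.
  by rewrite ratio_mul_le// divr_ge0// ltW.
have h2 : cmod q.[h] * cmod (f h - p.[h]) <= eps / 2.
  apply: le_trans (ler_pM (cmod_ge0 _) (cmod_ge0 _) (HG h hB) (Hp h hB)) _.
  rewrite [leLHS](_ : _ = G / (G + 1) * (eps / 2)); last by field; rewrite gt_eqF// ltr_wpDl.
  by rewrite ratio_mul_le// divr_ge0// ltW.
lra.
Qed.

Lemma poly_approx_sum (I : Type) (l : seq I) (F : I -> R[i] -> R[i]) :
  (forall i, poly_approx (F i)) -> poly_approx (fun h => \sum_(i <- l) F i h).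
Proof.
move=> hF; elim: l => [|i l IH].
  by apply: poly_approx_ext (poly_approx_cst 0) => h; rewrite big_nil.
by apply: poly_approx_ext (poly_approxD (hF i) IH) => h; rewrite big_cons.
Qed.

Lemma poly_approx_prod (I : Type) (l : seq I) (F : I -> R[i] -> R[i]) :
  (forall i, poly_approx (F i)) -> poly_approx (fun h => \prod_(i <- l) F i h).
Proof.
move=> hF; elim: l => [|i l IH].
  by apply: poly_approx_ext (poly_approx_cst 1) => h; rewrite big_nil.
by apply: poly_approx_ext (poly_approxM (hF i) IH) => h; rewrite big_cons.
Qed.

Lemma poly_approx_det k (A : R[i] -> 'M[R[i]]_k) :
  (forall i j, poly_approx (fun h => A h i j)) -> poly_approx (fun h => \det (A h)).
Proof.
move=> hA; apply: poly_approx_sum => s.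
by apply: poly_approxM; [exact: poly_approx_cst|apply: poly_approx_prod => i].
Qed.

Lemma poly_approx_cexp (k : R[i]) : poly_approx (fun h => cexp (k * h)).
Proof.
move=> B eps B0 e0; pose C := cmod k * B.
have C0 : 0 <= C by rewrite mulr_ge0 ?cmod_ge0.
(* The first summand ensures the size condition of [cexp_compound_bound], the second brings its
   error below eps. *)
pose N := Num.bound (2 * C + 6 * C ^+ 2 * expR C / eps).
have X0 : 0 <= 6 * C ^+ 2 * expR C / eps.
  exact: divr_ge0 (mulr_ge0 (mulr_ge0 (ler0n _ 6) (sqr_ge0 C)) (expR_ge0 C)) (ltW e0).
have : 2 * C + 6 * C ^+ 2 * expR C / eps < N.+1%:R.
  apply: lt_le_trans (archi_boundP _) _; first by lra.
  by rewrite ler_nat.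
move=> hN.
exists ((1 + ((k / N.+1%:R)%:P * 'X)) ^+ N.+1) => h hB.
rewrite horner_exp hornerD hornerC hornerM hornerC hornerX.
have -> : k / N.+1%:R * h = k * h / N.+1%:R by rewrite mulrAC.
have kh : cmod (k * h) <= C by rewrite cmodM ler_wpM2l ?cmod_ge0.
apply: le_trans (cexp_compound_bound kh _) _; first by lra.
rewrite ler_pdivrMr ?ltr0n// -ler_pdivrMl//.
rewrite mulrC; have := mulr_ge0 (ler0n R 2) C0; lra.
Qed.

(** For a smaller positive power the angle is 2 theta with 0 < theta < pi, and cos (2 theta) = 1 - 2
    sin^2 theta < 1. *)
Lemma expi_prim_root N : (0 < N)%N -> N.-primitive_root (expi (2%:R * pi / N%:R : R)).
Proof.
move=> N0; rewrite /primitive_root_of_unity N0 /=; apply/forallP => i; apply/eqP.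
have NR : 0 < N%:R :> R by rewrite ltr0n.
rewrite /root_of_unity /root !hornerE ?hornerXn -expiMn subr_eq0.
set x := 2%:R * pi / N%:R *+ i.+1.
have xE : x = pi * (i.+1%:R / N%:R) *+ 2 by rewrite /x; field; rewrite gt_eqF.
apply/idP/idP => [/eqP E|/eqP iN]; last first.
  have -> : x = pi *+ 2 by rewrite xE iN; field; rewrite gt_eqF.
  by apply/eqP/complex_eqP; rewrite /= ?cos2pi ?sin2pi.
apply: contraT => iN; exfalso.
have iltN : (i.+1 < N)%N by rewrite ltn_neqAle iN ltn_ord.
have : cos x = 1 by have := congr1 (@complex.Re R) E.
rewrite xE cos_mulr2n cos2sin2.
have s0 : 0 < sin (pi * (i.+1%:R / N%:R)) :> R.
  apply: sin_gt0_pi; rewrite mulr_gt0 ?pi_gt0 ?divr_gt0 ?ltr0n//=.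
  by rewrite gtr_pMr ?pi_gt0// ltr_pdivrMr// mul1r ltr_nat.
nra.
Qed.

Lemma prod_circle N (rho : R) (x : R[i]) : (0 < N)%N -> 0 < rho ->
  cmod (\prod_(0 <= j < N) (rho%:C * expi (2%:R * pi / N%:R : R) ^+ j - x)) =
  cmod (x ^+ N - rho%:C ^+ N).
Proof.
move=> N0 r0; have rC : rho%:C != 0 :> R[i] by rewrite -cmod_gt0 cmodR gtr0_norm.
pose y := x / rho%:C; have xE : x = rho%:C * y by rewrite mulrC divfK.
have E := factor_Xn_sub_1 (expi_prim_root N0).
have F : cmod (y ^+ N - 1) = \prod_(0 <= j < N) cmod (y - expi (2%:R * pi / N%:R : R) ^+ j).
  have <- : ('X^N - 1 : {poly R[i]}).[y] = y ^+ N - 1 by rewrite !hornerE ?hornerXn.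
  by rewrite -E horner_prod cmod_prod; apply: eq_bigr => j _; rewrite hornerXsubC.
have -> : x ^+ N - rho%:C ^+ N = rho%:C ^+ N * (y ^+ N - 1).
  by rewrite xE exprMn mulrBr mulr1.
rewrite cmodM cmodX F cmod_prod -[X in _ ^+ X]subn0 -prodr_const_nat -big_split /=.
by apply: eq_bigr => j _; rewrite {1}xE -mulrBr cmodM cmodBC.
Qed.

(* Multiply the values of p at N equally spaced points of the circle: a root x
   contributes x^N - rho^N, of modulus at most 2 |x|^N; let N tend to infinity. *)
Lemma poly_min_modulus p (rho M : R) : 0 < rho -> 0 <= M ->
  (forall h, cmod h <= rho -> p.[h] != 0) ->
  (forall h, cmod h = rho -> M <= cmod p.[h]) -> M <= cmod p.[0].
Proof.
move=> r0 M0 nz hM.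
have [rs pE] := closed_field_poly_normal p.
have lc0 : lead_coef p != 0.
  by apply: contraNneq (nz 0 _) => [l0|]; rewrite ?cmod0 ?ltW// pE l0 scale0r horner0.
have ev h : cmod p.[h] = cmod (lead_coef p) * \prod_(x <- rs) cmod (h - x).
  rewrite {1}pE hornerZ horner_prod cmodM cmod_prod; congr (_ * _).
  by apply: eq_bigr => x _; rewrite hornerXsubC.
have big x : x \in rs -> rho < cmod x.
  move=> xrs; rewrite ltNge; apply/negP => /nz /negP; apply.
  rewrite -cmod_eq0 ev mulf_eq0; apply/orP; right.
  by rewrite (big_rem x)//= subrr cmod0 mul0r.
have key N : (0 < N)%N -> M ^+ N <= 2 ^+ size rs * cmod p.[0] ^+ N.
  move=> N0; set e := expi (2%:R * pi / N%:R : R).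
  have on j : cmod (rho%:C * e ^+ j) = rho.
    by rewrite cmodM cmodX cmod_expi expr1n mulr1 cmodR gtr0_norm.
  apply: le_trans (_ : \prod_(0 <= j < N) cmod p.[rho%:C * e ^+ j] <= _).
    rewrite -{1}[N]subn0 -prodr_const_nat; apply: ler_prod => j _; rewrite M0 /=.
    exact: hM.
  under eq_bigr do rewrite ev; rewrite big_split/= prodr_const_nat subn0.
  rewrite ev exprMn mulrCA ler_wpM2l ?exprn_ge0 ?cmod_ge0//.
  have -> : 2 ^+ size rs = \prod_(x <- rs) 2 :> R.
    by rewrite big_const_seq count_predT iter_mulr_1.
  rewrite exchange_big /=.
  rewrite -prodrXl -big_split/=.
  rewrite [leLHS]big_seq [leRHS]big_seq; apply: ler_prod => x xrs.
  rewrite prodr_ge0 /= => [|i _]; last exact: cmod_ge0.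
  rewrite -cmod_prod prod_circle// sub0r cmodN -cmodX.
  apply: le_trans (cmodB _ _) _; rewrite mulr_natl mulr2n lerD2l.
  by rewrite !cmodX cmodR gtr0_norm// lerXn2r ?nnegrE ?cmod_ge0 ?(ltW r0)// ltW// big.
rewrite leNgt; apply/negP => lt.
have p0 : 0 < cmod p.[0] by rewrite cmod_gt0 nz// cmod0 ltW.
pose q := M / cmod p.[0].
have q1 : 1 < q by rewrite ltr_pdivlMr// mul1r.
have q1' : 0 < q - 1 by rewrite subr_gt0.
(* Bernoulli's inequality: the powers of q = M / |p(0)| stay bounded, which is impossible for q >
   1. *)
have qN N : (0 < N)%N -> 1 + N%:R * (q - 1) <= 2 ^+ size rs.
  move=> N0; apply: le_trans (_ : q ^+ N <= _).
    elim: N {N0} => [|N IH]; first by rewrite mul0r addr0 expr0.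
    rewrite exprS; apply: le_trans (ler_wpM2l _ IH); last by lra.
    rewrite -addn1 natrD; have := mulr_ge0 (ler0n R N) (sqr_ge0 (q - 1)); nra.
  by rewrite exprMn exprVn ler_pdivrMr ?exprn_gt0// key.
pose N := (Num.bound (2 ^+ size rs / (q - 1))).+1.
have := qN N isT.
have : 2 ^+ size rs / (q - 1) < N%:R.
  apply: lt_le_trans (archi_boundP _) _; first by rewrite divr_ge0 ?exprn_ge0// ltW.
  by rewrite ler_nat.
rewrite ltr_pdivrMr//; lra.
Qed.

(** Compactness, on a square containing the disc. The added term max(0, |z| - rho) vanishes on the
    disc and keeps the function positive in the corners of the square, where f may have zeros. *)
Lemma disc_lower_bound f (rho : R) : poly_approx f -> 0 < rho ->
  (forall h, cmod h <= rho -> f h != 0) ->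
  exists2 m, 0 < m & forall h, cmod h <= rho -> m <= cmod (f h).
Proof.
move=> hf r0 nz.
pose g (xy : R * R) := cmod (f (Complex xy.1 xy.2)) +
   Num.max 0 (cmod (Complex xy.1 xy.2) - rho).
have gpos xy : 0 < g xy.
  have [h|h] := leP (cmod (Complex xy.1 xy.2)) rho.
    rewrite ltr_wpDr ?le_max ?lexx// cmod_gt0; exact: nz.
  by rewrite ltr_wpDl ?cmod_ge0// lt_max subr_gt0 h orbT.
have cg : continuous g.
  move=> xy; apply/cvgrPdist_le => eps e0.
  have e20 : 0 < eps / 2 by rewrite divr_gt0.
  have [d d0 Hd] := poly_approx_uniform (cmod (Complex xy.1 xy.2) + 2) hf e20.
  have k0 : 0 < Num.min 1 (Num.min (d / 2) (eps / 4)).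
    by rewrite !lt_min ltr01 divr_gt0//= divr_gt0.
  apply: filterS (nbhsx_ballx xy _ k0) => zt [] /=; rewrite /ball /= !lt_min => /andP[x1 /andP[xd xe]] /andP[y1 /andP[yd ye]].
  set z := Complex xy.1 xy.2; set w := Complex zt.1 zt.2.
  have zw : cmod (z - w) <= `|xy.1 - zt.1| + `|xy.2 - zt.2| by apply: le_trans (cmod_ReIm _) _.
  have wz := cmod_distB w z; have zw' := cmod_distB z w.
  rewrite cmodBC in wz.
  have h1 : cmod (f z - f w) <= eps / 2.
    by apply: Hd; rewrite -/z; lra.
  have h2 := cmod_distB (f z) (f w); have h3 := cmod_distB (f w) (f z).
  rewrite cmodBC in h3.
  have h4 : `|Num.max 0 (cmod z - rho) - Num.max 0 (cmod w - rho)| <= cmod (z - w).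
    apply: le_trans (max0_lip _ _) _; rewrite ler_norml; apply/andP; split; lra.
  rewrite /g -/z -/w; move: h4; rewrite !ler_norml => /andP[h4 h5].
  by apply/andP; split; lra.
pose K := (`[- rho, rho] `*` `[- rho, rho])%classic : set (R * R).
have cK : compact K by apply: compact_setX; exact: segment_compact.
have K0 : K !=set0.
  by exists (0, 0); split => /=; rewrite in_itv/= oppr_le0 (ltW r0).
have [c _ Hc] := compact_EVT_min K0 cK (continuous_subspaceT cg).
exists (g c) => // h hr.
have Kh : (Re h, Im h) \in K.
  rewrite inE; split; rewrite /= in_itv/= -ler_norml.
    exact: le_trans (Re_le_cmod _) hr.
  exact: le_trans (Im_le_cmod _) hr.
have E : Complex (Re h, Im h).1 (Re h, Im h).2 = h by case: (h).
by have := Hc _ Kh; rewrite [in X in _ <= X]/g E max_l ?addr0// subr_le0.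
Qed.

Lemma min_modulus f (rho M : R) : poly_approx f -> 0 < rho -> 0 <= M ->
  (forall h, cmod h <= rho -> f h != 0) ->
  (forall h, cmod h = rho -> M <= cmod (f h)) -> M <= cmod (f 0).
Proof.
move=> hf r0 M0 nz hM; have [m m0 Hm] := disc_lower_bound hf r0 nz.
apply/ler_addgt0Pl => eps e0.
(* [m / 2] keeps the approximating polynomial free of zeros in the disc; [eps / 2] is lost twice, on
   the circle and at the centre. *)
pose e := Num.min (m / 2) (eps / 2).
have e_gt0 : 0 < e by rewrite lt_min !divr_gt0.
have em : e <= m / 2 by rewrite ge_min lexx.
have ee : e <= eps / 2 by rewrite ge_min lexx orbT.
have [p Hp] := hf _ _ (ltW r0) e_gt0.
have [Me|Me] := ltP (M - e) 0; first by have := cmod_ge0 (f 0); lra.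
have := @poly_min_modulus p rho (M - e) r0 Me.
have pz h : cmod h <= rho -> p.[h] != 0.
  move=> hr; rewrite -cmod_gt0; have := cmod_distB (f h) (f h - p.[h]).
  rewrite opprB addrCA subrr addr0; have := Hm _ hr; have := Hp _ hr; lra.
move=> /(_ pz) H.
have : M - e <= cmod p.[0].
  apply: H => h hr; have := cmod_distB (f h) (f h - p.[h]).
  rewrite opprB addrCA subrr addr0; have := hM _ hr; have := Hp h; rewrite hr lexx => /(_ isT); lra.
have := cmod_distB p.[0] (p.[0] - f 0).
rewrite opprB addrCA subrr addr0 (cmodBC p.[0]).
have := Hp 0; rewrite cmod0 (ltW r0) => /(_ isT); lra.
Qed.

End MinimumModulus.

(** * Functions close to a quadratic polynomial in an exponential *)

Section ExponentialQuadratic.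
Variable R : realType.

(* Off the region where z is small, three circles are tried: a quadratic with
   leading coefficient bounded below cannot be small at three separated points,
   so f is bounded below on one of the circles, hence at its centre. *)
Lemma exp_quadratic_lower (L c th B : R) : 0 < L -> 0 < c -> 0 < th -> 0 < B ->
  exists2 d, 0 < d & forall (f : R[i] -> R[i]) (kp z0 c0 c1 c2 : R[i]),
    poly_approx f -> (forall h, cmod h <= c -> f h != 0) ->
    cmod kp = L -> cmod z0 <= 1 -> th <= cmod c0 ->
    cmod c1 <= B -> cmod c2 <= B -> th <= cmod c2 \/ (c2 = 0 /\ th <= cmod c1) ->
    (forall h, cmod h <= c -> cmod (f h - (c0 + c1 * (z0 * cexp (kp * h)) +
       c2 * (z0 * cexp (kp * h)) ^+ 2)) <= d) ->
    d <= cmod (f 0).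
Proof.
move=> L0 c_gt0 th0 B0.
(* For |z0| <= tau the linear and the quadratic term are at most th / 4 each, so the constant term
   prevails. *)
pose tau := Num.min 1 (th / (4 * B)).
have tau0 : 0 < tau by rewrite lt_min ltr01 divr_gt0// mulr_gt0.
have tau1 : tau <= 1 by rewrite ge_min lexx.
have tauB : B * tau <= th / 4.
  have : tau <= th / (4 * B) by rewrite ge_min lexx orbT.
  move=> /(ler_wpM2l (ltW B0)) /le_trans; apply.
  by rewrite [leLHS](_ : _ = th / 4)//; field; rewrite gt_eqF.
(* The circles have radii c', 2c', 3c' and lie in the disc of radius c. Points on them differ by at
   most 6c', so the exponents differ by at most 1/12, the range of [cexp_sub1_lower]. *)
pose c' := Num.min (c / 3) (1 / (72 * L)).
have c'0 : 0 < c' by rewrite lt_min !divr_gt0// mulr_gt0.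
have c'c : 3 * c' <= c.
  have : c' <= c / 3 by rewrite ge_min lexx.
  lra.
have c'L : L * c' <= 1 / 72.
  have : c' <= 1 / (72 * L) by rewrite ge_min lexx orbT.
  move=> /(ler_wpM2l (ltW L0)) /le_trans; apply.
  by rewrite [leLHS](_ : _ = 1 / 72)//; field; rewrite gt_eqF.
pose sg := tau * L * c' / 4.
have sg0 : 0 < sg by rewrite divr_gt0// !mulr_gt0.
(* Respectively: the loss for small z0; 24 d < th sg^3, which contradicts smallness at three points
   of the quadratic; 4 d < th sg, which contradicts smallness at two points in the linear case. *)
exists (Num.min (th / 4) (Num.min (th * sg ^+ 3 / 48) (th * sg / 8))).
  by rewrite !lt_min !divr_gt0 ?mulr_gt0 ?exprn_gt0.
set d := Num.min _ _.
have d0 : 0 < d by rewrite !lt_min !divr_gt0 ?mulr_gt0 ?exprn_gt0.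
have d1 : d <= th / 4 by rewrite ge_min lexx.
have d2 : d <= th * sg ^+ 3 / 48 by rewrite !ge_min lexx orbT.
have d3 : d <= th * sg / 8 by rewrite !ge_min lexx !orbT.
move=> f kp z0 c0 c1 c2 af nz kpL z01 c0th c1B c2B cth fF.
pose z h := z0 * cexp (kp * h); pose F h := c0 + c1 * z h + c2 * z h ^+ 2.
have fF' h : cmod h <= c -> cmod (f h - F h) <= d by exact: fF.
have [zs|zl] := leP (cmod z0) tau.
  have cc : cmod (0 : R[i]) <= c by rewrite cmod0 ltW.
  have h1 := fF' 0 cc.
  have z00 : z 0 = z0 by rewrite /z mulr0 cexp0 mulr1.
  have h2 : th / 2 <= cmod (F 0).
    have := cmod_distB c0 (- (c1 * z0 + c2 * z0 ^+ 2)); rewrite opprK cmodN /F z00 addrA.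
    have := cmodD (c1 * z0) (c2 * z0 ^+ 2); rewrite !cmodM.
    have q0 := cmod_ge0 z0.
    have q1 := ler_pM (cmod_ge0 c1) q0 c1B zs.
    have q2 : cmod c2 * (cmod z0 * cmod z0) <= B * tau.
      apply: ler_pM; rewrite ?cmod_ge0 ?mulr_ge0// (le_trans _ zs)//.
      by rewrite ler_piMl.
    lra.
  have := cmod_distB (F 0) (f 0); rewrite cmodBC; lra.
rewrite leNgt; apply/negP => f0d.
have cexp_near (w : R[i]) : cmod w <= 1 / 12 -> 1 / 2 <= cmod (cexp w) /\ cmod (cexp w) <= 2.
  move=> w1; have w2 : cmod w <= 1 / 2 by lra.
  have := cexp_sub1_upper w2; have := cmod_distB 1 (1 - cexp w).
  have -> : 1 - (1 - cexp w) = cexp w by ring.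
  have := cmodD (cexp w - 1) 1; rewrite subrK (cmodBC 1) cmod1; lra.
have pick i : (0 < i <= 3)%N -> exists2 h, cmod h = i%:R * c' & cmod (f h) < d.
  move=> /andP[i0 i3].
  have ic : i%:R * c' <= c.
    by apply: le_trans c'c; rewrite ler_wpM2r ?(ltW c'0)// ler_nat.
  apply: contrapT => H; have : d <= cmod (f 0).
    apply: (@min_modulus R f (i%:R * c') d) => //.
    - by rewrite mulr_gt0// ltr0n.
    - exact: ltW.
    - by move=> h hi; apply: nz; exact: le_trans ic.
    - by move=> h hi; rewrite leNgt; apply/negP => fd; apply: H; exists h.
  by rewrite leNgt f0d.
have [h1 h1c f1] := pick 1%N isT; have [h2 h2c f2] := pick 2%N isT.
have [h3 h3c f3] := pick 3%N isT.
rewrite mul1r in h1c.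
have small h : cmod h <= 3 * c' -> [/\ cmod (F h) <= cmod (f h) + d,
    tau / 2 <= cmod (z h) & cmod (z h) <= 2].
  move=> hc; have hc' := le_trans hc c'c.
  have kh : cmod (kp * h) <= 1 / 12.
    rewrite cmodM kpL; have := ler_wpM2l (ltW L0) hc; lra.
  have [e1 e2] := cexp_near _ kh.
  split.
  - have := cmod_distB (F h) (f h); rewrite cmodBC; have := fF' h hc'; lra.
  - by rewrite cmodM ler_pM ?(ltW tau0) ?(ltW zl)//; lra.
  - rewrite cmodM; have := ler_pM (cmod_ge0 _) (cmod_ge0 _) z01 e2; lra.
have sep h k : cmod h <= 3 * c' -> cmod k <= 3 * c' -> c' <= cmod (h - k) ->
    sg <= cmod (z h - z k).
  move=> hc kc hk; have [_ zk _] := small k kc.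
  have -> : z h - z k = z k * (cexp (kp * (h - k)) - 1).
    have e : cexp (kp * h) = cexp (kp * k) * cexp (kp * (h - k)).
      by rewrite -cexpD -mulrDr addrC subrK.
    by rewrite /z e; ring.
  have khk : cmod (kp * (h - k)) <= 1 / 12.
    rewrite cmodM kpL; have := cmodB h k => hk'.
    have := ler_wpM2l (ltW L0) (le_trans hk' (lerD hc kc)); lra.
  have := cexp_sub1_lower khk; rewrite cmodM kpL => e1.
  rewrite cmodM /sg.
  have -> : tau * L * c' / 4 = (tau / 2) * (L * c' / 2) by field.
  apply: ler_pM; rewrite ?divr_ge0 ?(ltW tau0)//.
    by rewrite mulr_ge0 ?ltW.
  apply: le_trans e1; rewrite ler_wpM2r// ler_wpM2l//; exact: ltW.
have b1 : cmod h1 <= 3 * c' by rewrite h1c; lra.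
have b2 : cmod h2 <= 3 * c' by rewrite h2c; lra.
have b3 : cmod h3 <= 3 * c' by rewrite h3c.
have s21 : sg <= cmod (z h2 - z h1).
  by apply: sep => //; apply: le_trans (cmod_distB _ _); rewrite h1c h2c; lra.
have s31 : sg <= cmod (z h3 - z h1).
  by apply: sep => //; apply: le_trans (cmod_distB _ _); rewrite h1c h3c; lra.
have s32 : sg <= cmod (z h3 - z h2).
  by apply: sep => //; apply: le_trans (cmod_distB _ _); rewrite h2c h3c; lra.
have [F1 _ z1] := small _ b1; have [F2 _ z2] := small _ b2; have [F3 _ z3] := small _ b3.
case: cth => [c2th|[c20 c1th]]; last first.
  have E : c1 * (z h2 - z h1) = F h2 - F h1 by rewrite /F c20; ring.
  have := cmodB (F h2) (F h1); rewrite -E cmodM.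
  have := ler_pM (ltW th0) (ltW sg0) c1th s21; have := mulr_gt0 th0 sg0; lra.
(* Second divided difference: the leading coefficient times the Vandermonde product of the three
   points. *)
have E : c2 * ((z h2 - z h1) * (z h3 - z h1) * (z h3 - z h2)) =
   F h1 * (z h3 - z h2) - F h2 * (z h3 - z h1) + F h3 * (z h2 - z h1) by rewrite /F; ring.
have := cmodD (F h1 * (z h3 - z h2) - F h2 * (z h3 - z h1)) (F h3 * (z h2 - z h1)).
have := cmodB (F h1 * (z h3 - z h2)) (F h2 * (z h3 - z h1)).
rewrite -E !cmodM.
have g (h u v : R[i]) : cmod (F h) <= cmod (f h) + d -> cmod (f h) < d -> cmod u <= 2 ->
    cmod v <= 2 -> cmod (F h) * cmod (u - v) <= 2 * d * 4.
  move=> k1 k2 k3 k4; apply: ler_pM; rewrite ?cmod_ge0//.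
    by rewrite mulr_natl mulr2n (le_trans k1)// lerD2r ltW.
  by apply: le_trans (cmodB _ _) _; rewrite (natrD _ 2 2) lerD.
have g1 := g _ _ _ F1 f1 z3 z2; have g2 := g _ _ _ F2 f2 z3 z1; have g3 := g _ _ _ F3 f3 z2 z1.
have g4 : th * (sg * sg * sg) <= cmod c2 * (cmod (z h2 - z h1) * cmod (z h3 - z h1) * cmod (z h3 - z h2)).
  have sg0' := ltW sg0.
  apply: ler_pM; [exact: ltW|exact: (mulr_ge0 (mulr_ge0 sg0' sg0') sg0')|exact: c2th|].
  by apply: ler_pM; [exact: mulr_ge0| |exact: ler_pM|].
have : sg ^+ 3 = sg * sg * sg by rewrite 2!exprS expr1 mulrA.
move=> sg3; rewrite sg3 in d2.
have := mulr_gt0 th0 (mulr_gt0 (mulr_gt0 sg0 sg0) sg0); lra.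
Qed.

End ExponentialQuadratic.

(** * Uniform bounds over finite families; perturbation of determinants *)

Section FiniteBounds.
Variable R : realType.

(** Nonpositive values are skipped: for the determinants of all column patterns this gives one
    constant below every nonzero modulus. *)
Lemma fin_lower_bound (I : finType) (F : I -> R) :
  exists2 t, 0 < t & forall i, 0 < F i -> t <= F i.
Proof.
suff [t t0 Ht] : exists2 t, 0 < t & forall i, i \in enum I -> 0 < F i -> t <= F i.
  by exists t => // i; apply: Ht; rewrite mem_enum.
elim: (enum I) => [|i l [t t0 Ht]]; first by exists 1.
exists (if 0 < F i then Num.min t (F i) else t).
  by case: ifP => // Fi; rewrite lt_min t0.
move=> j; rewrite inE => /orP[/eqP -> Fi|jl Fj]; first by rewrite Fi ge_min lexx orbT.
by case: ifP => _; rewrite ?ge_min Ht.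
Qed.

Lemma fin_upper_bound (I : finType) (F : I -> R) :
  exists2 M, 0 < M & forall i, F i <= M.
Proof.
exists (1 + \sum_i `|F i|); first by rewrite ltr_pwDl ?sumr_ge0.
move=> i; rewrite (bigD1 i)//= addrCA (le_trans (ler_norm _))// lerDl addr_ge0//.
exact: sumr_ge0.
Qed.

(** Each product in the Leibniz formula is telescoped, one factor at a time. *)
Lemma det_perturbation k (A A' : 'M[R[i]]_k) (B w : R) : 1 <= B ->
  (forall i j, cmod (A i j) <= B) -> (forall i j, cmod (A' i j) <= B) ->
  (forall i j, cmod (A i j - A' i j) <= w) ->
  cmod (\det A - \det A') <= k`!%:R * (k%:R * B ^+ k * w).
Proof.
move=> B1 AB A'B AA'; have B0 : 0 <= B by rewrite (le_trans _ B1).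
have prodB (l : seq 'I_k) (F G : 'I_k -> R[i]) :
    (forall i, cmod (F i) <= B) -> (forall i, cmod (G i) <= B) ->
    (forall i, cmod (F i - G i) <= w) ->
    cmod (\prod_(i <- l) F i - \prod_(i <- l) G i) <= (size l)%:R * B ^+ size l * w.
  move=> FB GB FG; elim: l => [|i l IH]; first by rewrite !big_nil subrr cmod0 !mul0r.
  rewrite !big_cons.
  have -> : F i * \prod_(j <- l) F j - G i * \prod_(j <- l) G j =
    F i * (\prod_(j <- l) F j - \prod_(j <- l) G j) + (F i - G i) * \prod_(j <- l) G j by ring.
  apply: le_trans (cmodD _ _) _; rewrite !cmodM.
  have w0 : 0 <= w := le_trans (cmod_ge0 _) (FG i).
  have q1 := ler_pM (cmod_ge0 _) (cmod_ge0 _) (FB i) IH.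
  have q3 : cmod (\prod_(j <- l) G j) <= B ^+ (size l).+1.
    rewrite cmod_prod; apply: le_trans (_ : B ^+ size l <= _); last first.
      by rewrite exprS ler_peMl// exprn_ge0.
    have -> : B ^+ size l = \prod_(x <- l) B by rewrite big_const_seq count_predT iter_mulr_1.
    by apply: ler_prod => j _; rewrite cmod_ge0 GB.
  have q2 := ler_pM (cmod_ge0 _) (cmod_ge0 _) (FG i) q3.
  apply: le_trans (lerD q1 q2) _; rewrite /= -natr1 le_eqVlt; apply/orP; left; apply/eqP.
  by rewrite exprS; ring.
rewrite /determinant -sumrB; apply: le_trans (cmod_sum _ _ _) _.
apply: le_trans (_ : \sum_(s : 'S_k) (k%:R * B ^+ k * w) <= _); last first.
  by rewrite sumr_const card_Sn -[leLHS]mulr_natl.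
apply: ler_sum => s _; rewrite -mulrBr cmodM cmod_sign mul1r.
have := prodB (index_enum 'I_k) (fun i => A i (s i)) (fun i => A' i (s i)).
have -> : size (index_enum 'I_k) = k by rewrite -sum1_size sum1_card card_ord.
by apply=> i.
Qed.

(** Two variables are kept because the minimum modulus argument moves r' over a disc while the row
    is divided by a power of the fixed centre r. The degree may be smaller than d, in which case the
    limit is 0. *)
Lemma poly_scaled_bound (p : {poly R[i]}) (d : nat) : (size p <= d.+1)%N ->
  exists2 C, 0 <= C & forall r r' e : R[i], cmod e = 1 -> 1 <= cmod r ->
    cmod (r' - r) <= 1 ->
    cmod (r ^- d * p.[r' * e] - e ^+ d * p`_d) <= C / cmod r.
Proof.
move=> szp; pose C := (\sum_(i < d) cmod p`_i * 2 ^+ d) + cmod p`_d * (d%:R * 2 ^+ d).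
exists C.
  by rewrite addr_ge0 ?sumr_ge0 ?mulr_ge0 ?cmod_ge0// ?exprn_ge0// => i _; rewrite mulr_ge0 ?cmod_ge0 ?exprn_ge0.
move=> r r' e e1 r1 rr'.
have r0 : 0 < cmod r by rewrite (lt_le_trans _ r1).
have rn0 : r != 0 by rewrite -cmod_gt0.
have r'2 : cmod r' <= 2 * cmod r.
  have := cmodD (r' - r) r; rewrite subrK; lra.
have rX m : 1 <= cmod r ^+ m by rewrite exprn_ege1.
rewrite (horner_coef_wide _ szp) big_ord_recr /= mulrDr mulr_sumr.
rewrite -addrA; apply: le_trans (cmodD _ _) _; rewrite /C mulrDl lerD//.
  apply: le_trans (cmod_sum _ _ _) _; rewrite mulr_suml; apply: ler_sum => i _.
  rewrite !(cmodM,cmodV,cmodX) e1 mulr1 mulrCA -mulrA ler_wpM2l ?cmod_ge0//.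
  rewrite mulrC ler_pdivrMr ?exprn_gt0// -mulrA.
  have id := ltn_ord i.
  apply: le_trans (_ : (2 * cmod r) ^+ i <= _).
    by rewrite lerXn2r ?nnegrE ?cmod_ge0 ?mulr_ge0 ?cmod_ge0.
  rewrite exprMn ler_pM ?exprn_ge0 ?cmod_ge0//.
    by rewrite ler_weXn2l ?ler1n// ltnW.
  rewrite ler_pdivlMl// -exprS; exact: ler_weXn2l.
have -> : r ^- d * (p`_d * (r' * e) ^+ d) - e ^+ d * p`_d =
   p`_d * (e ^+ d * (r ^- d * (r' ^+ d - r ^+ d))).
  by rewrite exprMn; field; rewrite expf_neq0.
rewrite !(cmodM,cmodV,cmodX) e1 expr1n mul1r -mulrA ler_wpM2l ?cmod_ge0//.
rewrite ler_pdivrMl ?exprn_gt0//.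
case: d {szp} @C => [|d] C; first by rewrite !expr0 subrr cmod0 !mul0r mulr0.
have m1 : cmod r <= 2 * cmod r by lra.
apply: le_trans (cmod_subX d r'2 m1) _.
apply: le_trans (_ : d.+1%:R * (2 * cmod r) ^+ d * 1 <= _).
  by rewrite ler_wpM2l ?mulr_ge0 ?exprn_ge0 ?mulr_ge0 ?cmod_ge0.
rewrite mulr1 exprMn [cmod r ^+ d.+1]exprS [X in _ <= _ * (_ * X / _)]exprS.
have -> : cmod r * cmod r ^+ d * (d.+1%:R * (2 * 2 ^+ d) / cmod r) =
  d.+1%:R * (2 * 2 ^+ d * cmod r ^+ d) by field; rewrite gt_eqF.
rewrite ler_wpM2l// -mulrA ler_peMl ?ler1n// mulr_ge0 ?exprn_ge0 ?cmod_ge0//.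
Qed.

End FiniteBounds.

(** * Lower bound for the characteristic determinant *)

Section PolarForm.
Variable R : realType.

Lemma polar_form (w : R[i]) : w != 0 ->
  exists t : R, [/\ 0 <= t, t < 2 * pi & w = (cmod w)%:C * expi t].
Proof.
move=> w0; have m0 : 0 < cmod w by rewrite cmod_gt0.
pose u := Re w / cmod w; pose v := Im w / cmod w.
have uv : u ^+ 2 + v ^+ 2 = 1.
  have := cmod_sqr w; rewrite /u /v !expr_div_n -mulrDl => <-.
  by rewrite divff// expf_neq0// gt_eqF.
have v2 : 1 - u ^+ 2 = v ^+ 2 by rewrite -uv; ring.
have u1 : -1 <= u <= 1.
  by rewrite -ler_norml -[X in _ <= X]normr1 -ler_sqr ?nnegrE// !real_normK ?num_real// expr1n -uv lerDl sqr_ge0.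
have u1' : u \in `[-1, 1] by rewrite in_itv.
have cu : cos (acos u) = u by rewrite acosK.
have su : sin (acos u) = `|v| by rewrite sin_acos// v2 sqrtr_sqr.
have wE : w = (cmod w)%:C * Complex u v.
  by apply: complex_eqP; rewrite ?ReM ?ImM /= !mul0r ?subr0 ?addr0 mulrCA divff ?mulr1// gt_eqF.
have a0 := acos_ge0 u1; have api := acos_lepi u1; have pi0 := pi_gt0 R.
have [v0|v0] := leP 0 v.
  exists (acos u); split => //; first by lra.
  by rewrite {1}wE; congr (_ * _); rewrite /expi cu su ger0_norm.
exists (2 * pi - acos u); split; first by lra.
  have : acos u != 0.
    by apply/eqP => a00; move: su; rewrite a00 sin0 => /esym/eqP; rewrite normr_eq0 lt_eqF.
  move=> an0; have : 0 < acos u by rewrite lt_def an0.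
  by lra.
rewrite {1}wE; congr (_ * _); rewrite /expi.
have -> : 2 * pi - acos u = - acos u + pi *+ 2 by rewrite -mulr_natl; ring.
rewrite sinD2pi cosD2pi cosN sinN cu su ltr0_norm// opprK.
by [].
Qed.

End PolarForm.

(** * Column patterns and Birkhoff regularity *)

Section Patterns.
Variables (R : realType) (n : nat).
Hypothesis n_gt0 : (0 < n)%N.
Variables (d : 'I_n -> nat) (al be : 'I_n -> R[i]).
Local Notation eps := (expi (2%:R * pi / n%:R : R)).

(** Leading part of the scaled boundary matrix; [p k] is the pair of values of the k-th exponential
    at a and at b. *)
Definition pmx (p : 'I_n -> R[i] * R[i]) : 'M[R[i]]_n :=
  \matrix_(j, k) ((eps ^+ k) ^+ d j * (al j * (p k).1 + be j * (p k).2)).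

(** The limit far from the imaginary axis: an exponential is 1 at its anchor and 0 at the other
    end. *)
Definition pat (t : 'I_n -> bool) (k : 'I_n) : R[i] * R[i] :=
  if t k then (1, 0) else (0, 1).

Lemma pmx_linear p p1 p2 (k : 'I_n) (z : R[i]) :
  (forall i, i != k -> p1 i = p i) -> (forall i, i != k -> p2 i = p i) ->
  (p k).1 = (p1 k).1 + z * (p2 k).1 -> (p k).2 = (p1 k).2 + z * (p2 k).2 ->
  \det (pmx p) = \det (pmx p1) + z * \det (pmx p2).
Proof.
move=> h1 h2 e1 e2; rewrite -(det_tr (pmx p)) -(det_tr (pmx p1)) -(det_tr (pmx p2)).
rewrite -[\det (pmx p1)^T]mul1r.
apply: (@determinant_multilinear _ _ _ _ _ k 1 z).
- by apply/matrixP => i j; rewrite !mxE e1 e2; ring.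
- by apply/matrixP => i j; rewrite !mxE h1// eq_sym neq_lift.
- by apply/matrixP => i j; rewrite !mxE h2// eq_sym neq_lift.
Qed.

Lemma expi_gt0_pi (t : R) : 0 < t < 2 * pi -> sin t != 0 -> (0 < sin t) = (t < pi).
Proof.
move=> /andP[t0 t2] s0; have [tp|tp] := ltP t pi.
  by rewrite sin_gt0_pi// t0.
apply/negbTE; rewrite -leNgt.
have tp' : pi != t by apply: contraNneq s0 => <-; rewrite sinpi.
have : 0 < sin (t - pi) by apply: sin_gt0_pi; rewrite subr_gt0 lt_neqAle tp' tp/=; lra.
by rewrite sinB sinpi cospi mulr0 subr0 mulrN1 oppr_gt0 => /ltW.
Qed.

Lemma Im_scaled (rho t : R) : Im (rho%:C * expi t) = rho * sin t.
Proof. by rewrite ImM /= mul0r addr0. Qed.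

Lemma eps_prim : n.-primitive_root eps.
Proof. exact: expi_prim_root. Qed.

(* Rotate w into the sector 0 < arg w < 2 pi / n: the columns are permuted
   cyclically, the rows are multiplied by units, and the indices k for which
   w eps^k is in the upper half-plane become an initial segment. *)
Lemma half_plane_det_neq0 (w : R[i]) :
  \det (pmx (pat (fun k => (k < n.+1./2)%N))) != 0 ->
  \det (pmx (pat (fun k => (k < n./2)%N))) != 0 ->
  (forall k : 'I_n, Im (w * eps ^+ k) != 0) ->
  \det (pmx (pat (fun k => 0 < Im (w * eps ^+ k)))) != 0.
Proof.
move=> hn1 hn2 hw.
have NR : 0 < n%:R :> R by rewrite ltr0n.
have pi0 := pi_gt0 R.
have w0 : w != 0.
  by apply/eqP => w0; have := hw (Ordinal n_gt0); rewrite w0 mul0r /= eqxx.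
have [t [t0 t2 wE]] := polar_form w0; set rho := cmod w in wE.
have rho0 : 0 < rho by rewrite cmod_gt0.
(* The argument of [w] in units of 2 pi / n: [s] whole steps, absorbed by the shift of indices, and
   a remainder [u]. *)
pose x := t * n%:R / (2 * pi).
have x0 : 0 <= x by rewrite divr_ge0 ?mulr_ge0 ?(ltW NR) ?(ltW pi0).
pose s := Num.truncn x.
have /andP[sx xs] := truncn_itv x0.
pose u := x - s%:R.
have tE : t = 2 * pi / n%:R * (s%:R + u).
  rewrite /u /x; move: pi0; move: (pi : R) => p p0.
  by field; rewrite !gt_eqF.
have epsX k : eps ^+ k = expi (2 * pi / n%:R * k%:R).
  by rewrite -expiMn mulr_natr.
have wk k : Im (w * eps ^+ k) = rho * sin (2 * pi / n%:R * (u + (s + k)%N%:R)).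
  rewrite wE epsX -[X in Im X]mulrA -expiD Im_scaled; congr (_ * sin _).
  rewrite {1}tE natrD; move: (pi : R) => p.
  by field; rewrite gt_eqF.
pose T' (l : nat) := 0 < sin (2 * pi / n%:R * (u + l%:R)).
have per q l : sin (2 * pi / n%:R * (u + (q * n + l)%N%:R)) = sin (2 * pi / n%:R * (u + l%:R)).
  have -> : 2 * pi / n%:R * (u + (q * n + l)%N%:R) = 2 * pi / n%:R * (u + l%:R) + (pi *+ 2) *+ q.
    rewrite natrD natrM -[_ *+ q]mulr_natr -[pi *+ 2]mulr_natl; move: (pi : R) => p.
    by field; rewrite gt_eqF.
  by rewrite (periodicn (@sinD2pi R)).
pose sg (k : 'I_n) : 'I_n := Ordinal (ltn_pmod (s + k) n_gt0).
have sin_sg (k : 'I_n) : sin (2 * pi / n%:R * (u + (s + k)%N%:R)) =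
    sin (2 * pi / n%:R * (u + (sg k : nat)%:R)).
  by rewrite /sg /= {1}(divn_eq (s + k) n) per.
have sg_inj : injective sg.
  move=> k k' /(congr1 val) /= /eqP; rewrite eqn_modDl => /eqP E.
  by apply/val_inj => /=; move: E; rewrite !modn_small.
have onto l : exists k, sg k = l.
  have /codomP[k ->] : l \in codom sg by exact: (injF_onto sg_inj).
  by exists k.
have nz (l : 'I_n) : sin (2 * pi / n%:R * (u + l%:R)) != 0.
  have [k <-] := onto l; have := hw k; rewrite wk sin_sg mulf_eq0 negb_or => /andP[_ //].
have u0 : 0 < u.
  rewrite lt_neqAle subr_ge0 sx andbT; apply/eqP => u0.
  by have := nz (Ordinal n_gt0); rewrite -u0 /= addr0 mulr0 sin0 eqxx.
have u1 : u < 1 by have := xs; rewrite -natr1 /u -/s; lra.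
have T'E (l : 'I_n) : T' l = (2 * (u + l%:R) < n%:R).
  have ln : l%:R + 1 <= n%:R :> R by rewrite natr1 ler_nat.
  have l0 : 0 <= l%:R :> R by [].
  have q0 : 0 < pi / n%:R :> R by rewrite divr_gt0.
  have xE : 2 * pi / n%:R * (u + l%:R) = 2 * (u + l%:R) * (pi / n%:R).
    by move: (pi : R) => p; field; rewrite gt_eqF.
  have nE : n%:R * (pi / n%:R) = pi :> R by rewrite mulrC divfK// gt_eqF.
  rewrite /T' expi_gt0_pi//; last first.
    have h : 2 * (u + l%:R) * (pi / n%:R) < 2 * n%:R * (pi / n%:R) by rewrite ltr_pM2r//; lra.
    have h2 : 0 < 2 * (u + l%:R) by lra.
    by rewrite xE (mulr_gt0 h2 q0) /= (lt_le_trans h)// -mulrA nE.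
  by rewrite xE -[X in _ < X](nE) ltr_pM2r.
(* The number of integers l >= 0 with u + l < n / 2 jumps at u = 1/2, which is the origin of the two
   Birkhoff matrices. For u = 1/2 the order n is even, since otherwise some w eps^k would be real,
   and both counts agree. *)
have [nu nuE T'nu] : exists2 nu, \det (pmx (pat (fun k => (k < nu)%N))) != 0 &
    forall l : 'I_n, T' l = (l < nu)%N.
  have nE : n%:R = (odd n)%:R + 2 * (n./2)%:R :> R.
    by rewrite -{1}(odd_double_half n) natrD -muln2 natrM mulrC.
  have [u2|u2|u2] := ltgtP (2 * u) 1.
  - exists (n.+1./2) => // l; rewrite T'E; apply/idP/idP => h.
      rewrite -uphalfE uphalf_half ltnNge; apply/negP => h2.
      have : (odd n)%:R + (n./2)%:R <= l%:R :> R by rewrite -natrD ler_nat.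
      move: h; rewrite nE; case: (odd n) => /=; lra.
    move: h; rewrite -uphalfE uphalf_half -ltnS -addn1 => h.
    have : l%:R + 1 <= (odd n)%:R + (n./2)%:R :> R.
      by rewrite -natrD natr1 ler_nat -ltnS -addn1.
    rewrite nE; case: (odd n) => /=; lra.
  - exists (n./2) => // l; rewrite T'E; apply/idP/idP => h.
      rewrite ltnNge; apply/negP => h2.
      have : (n./2)%:R <= l%:R :> R by rewrite ler_nat.
      move: h; rewrite nE; case: (odd n) => /=; lra.
    have : l%:R + 1 <= (n./2)%:R :> R by rewrite natr1 ler_nat.
    rewrite nE; case: (odd n) => /=; lra.
  - have en : odd n = false.
      apply/negP => on; have ln : (n./2 < n)%N.
        by rewrite ltn_half_double -addnn -[X in (X < _)%N]addn0 ltn_add2l.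
      have := nz (Ordinal ln); rewrite /= (_ : _ * _ = pi) ?sinpi ?eqxx//.
      have hE : (n./2)%:R = (n%:R - 1) / 2 :> R by rewrite nE on /=; field.
      rewrite hE (_ : u = 1 / 2); last by lra.
      by move: (pi : R) => p; field; rewrite gt_eqF.
    exists (n./2) => // l; rewrite T'E; apply/idP/idP => h.
      rewrite ltnNge; apply/negP => h2.
      have : (n./2)%:R <= l%:R :> R by rewrite ler_nat.
      move: h; rewrite nE en /=; lra.
    have : l%:R + 1 <= (n./2)%:R :> R by rewrite natr1 ler_nat.
    rewrite nE en /=; lra.
have -> : pmx (pat (fun k => 0 < Im (w * eps ^+ k))) =
    diag_mx (\row_j (eps ^+ s) ^- d j) *m col_perm (perm sg_inj) (pmx (pat (fun k => (k < nu)%N))).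
  apply/matrixP => j k; rewrite mul_diag_mx !mxE permE.
  have -> : pat (fun k => (k < nu)%N) (sg k) = pat (fun k => 0 < Im (w * eps ^+ k)) k.
    by rewrite /pat -T'nu /T' -sin_sg wk pmulr_rgt0.
  rewrite mulrA; congr (_ * _).
  have -> : eps ^+ sg k = eps ^+ s * eps ^+ k.
    by rewrite /= (prim_expr_mod eps_prim) exprD.
  rewrite exprMn mulrA mulVf ?mul1r// expf_neq0// expf_neq0// -cmod_gt0 cmod_expi ltr01//.
rewrite det_mulmx det_diag col_permE det_mulmx det_perm !mulf_neq0 ?signr_eq0//.
apply/prodf_neq0 => j _; rewrite mxE invr_eq0 expf_neq0// expf_neq0// -cmod_gt0 cmod_expi ltr01//.
Qed.

End Patterns.

(** * Asymptotics of the scaled boundary matrix *)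

Section DeterminantLowerBound.
Variables (R : realType) (a b : R) (n : nat).
Hypotheses (ab : a < b) (n_gt0 : (0 < n)%N).
Variables (P Q : 'I_n -> {poly R[i]}).
Hypothesis regular : birkhoff_regular P Q.
Local Notation eps := (expi (2%:R * pi / n%:R : R)).
Local Notation ord := (bc_order P Q).
Local Notation al := (fun j => (P j)`_(ord j)).
Local Notation be := (fun j => (Q j)`_(ord j)).
Local Notation pmx_ := (pmx ord al be).
Local Notation lead_ r s := (@lead R a b n r eps s).
Local Notation kap_ r := (@kap R n r eps).
Local Notation bmx_ r s := (@bmx R a b n P Q r eps s).

Lemma pmx_birkhoff nu : pmx_ (pat _ (fun k => (k < nu)%N)) = birkhoff_mx P Q nu.
Proof.
apply/matrixP => j k; rewrite !mxE -exprM /pat; congr (_ * _).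
by case: ifP => _ /=; rewrite mulr1 mulr0 ?addr0 ?add0r.
Qed.

(** Multiplication by -i turns the left half-plane into the upper one. *)
Lemma half_plane_pattern (w : R[i]) :
  (forall k : 'I_n, Re (w * eps ^+ k) != 0) ->
  \det (pmx_ (pat _ (fun k => Re (w * eps ^+ k) < 0))) != 0.
Proof.
move=> hw; pose w' := Complex 0 (-1) * w.
have E (k : 'I_n) : Im (w' * eps ^+ k) = - Re (w * eps ^+ k).
  by rewrite /w' -mulrA ImM /= mul0r add0r mulN1r.
have [r1 r2] := regular.
have := @half_plane_det_neq0 R n n_gt0 ord al be w'.
rewrite !pmx_birkhoff -!unitfE -!unitmxE r1 r2 => /(_ isT isT).
have hw' (k : 'I_n) : Im (w' * eps ^+ k) != 0 by rewrite E oppr_eq0.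
move=> /(_ hw'); rewrite unitmxE unitfE.
rewrite (_ : (fun k : 'I_n => 0 < Im (w' * eps ^+ k)) = (fun k => Re (w * eps ^+ k) < 0))//.
by apply/funext => k; rewrite E oppr_gt0.
Qed.

Lemma size_P j : (size (P j) <= (ord j).+1)%N.
Proof. exact: leq_trans (leq_maxl _ _) (leqSpred _). Qed.

Lemma size_Q j : (size (Q j) <= (ord j).+1)%N.
Proof. exact: leq_trans (leq_maxr _ _) (leqSpred _). Qed.

Lemma cmod_epsX k : cmod (eps ^+ k) = 1.
Proof. by rewrite cmodX cmod_expi expr1n. Qed.

(** The rows are scaled by the centre [r] while the entries are taken at a moving point [r']; for r'
    = r this is [sbmx]. *)
Definition cmat (r r' : R[i]) (s : 'I_n -> bool) : 'M[R[i]]_n :=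
  \matrix_(j, k) (r ^- ord j * bmx_ r' s j k).

(** Columns near the imaginary axis keep their true values, since neither end-point value is
    negligible there; the others are replaced by their limits. *)
Definition near_col (r' : R[i]) (s near : 'I_n -> bool) (k : 'I_n) : R[i] * R[i] :=
  if near k then (lead_ r' s k a, lead_ r' s k b) else pat _ s k.

Lemma cmat_entry : exists2 C, 0 <= C & forall r r' s, 1 <= cmod r -> cmod (r' - r) <= 1 ->
  forall j k, cmod (cmat r r' s j k -
      (eps ^+ k) ^+ ord j * (al j * lead_ r' s k a + be j * lead_ r' s k b)) <=
    C / cmod r * (cmod (lead_ r' s k a) + cmod (lead_ r' s k b)).
Proof.
have hP j : exists C, 0 <= C /\ forall r r' e : R[i], cmod e = 1 -> 1 <= cmod r ->
    cmod (r' - r) <= 1 ->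
    cmod (r ^- ord j * (P j).[r' * e] - e ^+ ord j * al j) <= C / cmod r.
  by have [C C0 HC] := poly_scaled_bound (size_P j); exists C.
have hQ j : exists C, 0 <= C /\ forall r r' e : R[i], cmod e = 1 -> 1 <= cmod r ->
    cmod (r' - r) <= 1 ->
    cmod (r ^- ord j * (Q j).[r' * e] - e ^+ ord j * be j) <= C / cmod r.
  by have [C C0 HC] := poly_scaled_bound (size_Q j); exists C.
have [CP HP] := choice hP; have [CQ HQ] := choice hQ.
have [M1 M10 HM1] := fin_upper_bound CP; have [M2 M20 HM2] := fin_upper_bound CQ.
exists (M1 + M2); first by rewrite addr_ge0 ?ltW.
move=> r r' s r1 rr' j k; rewrite !mxE.
have r0 : 0 < cmod r by rewrite (lt_le_trans _ r1).
set u := lead_ r' s k a; set v := lead_ r' s k b.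
have -> : r ^- ord j * ((P j).[kap_ r' k] * u + (Q j).[kap_ r' k] * v) -
   (eps ^+ k) ^+ ord j * (al j * u + be j * v) =
   (r ^- ord j * (P j).[r' * eps ^+ k] - (eps ^+ k) ^+ ord j * al j) * u +
   (r ^- ord j * (Q j).[r' * eps ^+ k] - (eps ^+ k) ^+ ord j * be j) * v.
  by rewrite /kap; ring.
apply: le_trans (cmodD _ _) _; rewrite (cmodM _ u) (cmodM _ v) [leRHS]mulrDr lerD//.
  rewrite ler_wpM2r ?cmod_ge0//; apply: le_trans ((HP j).2 _ _ _ (cmod_epsX k) r1 rr') _.
  by rewrite ler_pM2r ?invr_gt0// (le_trans (HM1 j))// lerDl ltW.
rewrite ler_wpM2r ?cmod_ge0//; apply: le_trans ((HQ j).2 _ _ _ (cmod_epsX k) r1 rr') _.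
by rewrite ler_pM2r ?invr_gt0// (le_trans (HM2 j))// lerDr ltW.
Qed.

Lemma lead_anchor r s k : lead_ r s k (if s k then a else b) = 1.
Proof. by rewrite /lead subrr mulr0 cexp0. Qed.

Lemma Re_kap_near r r' k : cmod (r' - r) <= 1 -> `|Re (kap_ r' k) - Re (kap_ r k)| <= 1.
Proof.
move=> rr'; rewrite -ReB /kap -mulrBl; apply: le_trans (Re_le_cmod _) _.
by rewrite cmodM cmod_epsX mulr1.
Qed.

Lemma lead_other r s k : lead_ r s k (if s k then b else a) =
  cexp ((if s k then 1 else -1) * (b - a)%:C * kap_ r k).
Proof.
rewrite /lead; case: ifP => _; rewrite ?rmorphB; congr cexp; ring.
Qed.

Lemma Re_lead_exponent r s k (x : R) :
  Re ((if s k then 1 else -1) * x%:C * kap_ r k) =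
  (if s k then 1 else -1) * x * Re (kap_ r k).
Proof.
by case: (s k); rewrite ?mulN1r ?mul1r ?ReM ?ReN ?ImN /= ?oppr0 mul0r subr0.
Qed.

(** Both sources of error are O(1 / |r|): the lower order coefficients of the boundary polynomials,
    and the far end-point values e^(-y) <= 1 / y. Moving r by at most 1 moves each real part by at
    most 1, which explains the bound e^(b - a) for all exponentials. *)
Lemma det_cmat_approx (eta dl : R) : 0 < eta -> 0 < dl ->
  exists2 R0, 1 <= R0 & forall (r : R[i]) (s near : 'I_n -> bool), R0 <= cmod r ->
    (forall k, s k -> Re (kap_ r k) <= 0) -> (forall k, ~~ s k -> 0 <= Re (kap_ r k)) ->
    (forall k, ~~ near k -> eta * cmod r <= `|Re (kap_ r k)|) ->
    forall r', cmod (r' - r) <= 1 ->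
      cmod (\det (cmat r r' s) - \det (pmx_ (near_col r' s near))) <= dl.
Proof.
move=> eta0 dl0; have [C C0 HC] := cmat_entry.
pose L := b - a; have L0 : 0 < L by rewrite subr_gt0.
pose E := expR L; have E1 : 1 <= E by rewrite -expR0 ler_expR ltW.
have [A1 A10 HA1] := fin_upper_bound (fun j => cmod (al j) + cmod (be j)).
pose Bm := 1 + A1 * E + C * (2 * E).
have E0 : 0 < E by rewrite (lt_le_trans _ E1).
have CE0 : 0 <= C * (2 * E) := mulr_ge0 C0 (mulr_ge0 (ler0n _ 2) (ltW E0)).
have AE0 : 0 <= A1 * E := mulr_ge0 (ltW A10) (ltW E0).
have eL0 : 0 < 2 / (eta * L) by rewrite divr_gt0// mulr_gt0.
have Bm1 : 1 <= Bm by rewrite /Bm; lra.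
pose W := C * (2 * E) + A1 * (2 / (eta * L)).
have W0 : 0 <= W.
  by have := mulr_ge0 (ltW A10) (ltW eL0); rewrite /W; lra.
pose K := n`!%:R * (n%:R * Bm ^+ n).
have K0 : 0 <= K by rewrite !mulr_ge0// exprn_ge0// (le_trans _ Bm1).
(* [2 / eta] lets the shift by 1 consume at most half of the gap eta |r|; [K * W / dl] turns the
   determinant error K W / |r| into [dl]. *)
exists (Num.max 1 (Num.max (2 / eta) (K * W / dl))); first by rewrite le_max lexx.
move=> r s near; rewrite !ge_max => /andP[r1 /andP[reta rdl]] sn sp far r' rr'.
have r0 : 0 < cmod r by rewrite (lt_le_trans _ r1).
have eta2 : 2 <= eta * cmod r by move: reta; rewrite ler_pdivrMr// mulrC.
have other k : cmod (lead_ r' s k (if s k then b else a)) <= E /\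
   (~~ near k -> cmod (lead_ r' s k (if s k then b else a)) <= 2 / (eta * L) / cmod r).
  rewrite lead_other cmod_cexp Re_lead_exponent -/L.
  have := Re_kap_near k rr'; rewrite ler_norml => /andP[q1 q2].
  set x := _ * L * _.
  have [xL xF] : x <= L /\ (~~ near k -> x <= - (eta * cmod r / 2 * L)).
    rewrite /x; case: ifPn => sk.
      have sk' := sn _ sk; split; first by nra.
      move=> /far; rewrite ler0_norm// => h; rewrite mul1r.
      have : Re (kap_ r' k) <= - (eta * cmod r / 2) by lra.
      nra.
    have sk' := sp _ sk; split; first by nra.
    move=> /far; rewrite ger0_norm// => h; rewrite mulN1r.
    have : eta * cmod r / 2 <= Re (kap_ r' k) by lra.
    nra.
  split; first by rewrite ler_expR.
  move=> /xF h; apply: le_trans (_ : expR (- (eta * cmod r / 2 * L)) <= _); first by rewrite ler_expR.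
  set y := eta * cmod r / 2 * L.
  have y0 : 0 < y by rewrite !mulr_gt0.
  have -> : 2 / (eta * L) / cmod r = y^-1.
    by rewrite /y; field; rewrite !gt_eqF.
  rewrite expRN lef_pV2 ?posrE ?expR_gt0//.
  by have := expR_ge1Dx y; lra.
have lb k : cmod (lead_ r' s k a) <= E /\ cmod (lead_ r' s k b) <= E.
  have [h _] := other k; have := lead_anchor r' s k; move: h.
  by case: ifP => _ h1 h2; rewrite h2 cmod1.
have nb k : cmod (near_col r' s near k).1 <= E /\ cmod (near_col r' s near k).2 <= E.
  rewrite /near_col /pat; case: ifP => _; first exact: lb.
  by case: ifP => _; split; rewrite [X in cmod X]/= ?cmod0 ?cmod1 ?(ltW E0).
have entry_bound j (k : 'I_n) (u v : R[i]) : cmod u <= E -> cmod v <= E ->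
    cmod ((eps ^+ k) ^+ ord j * (al j * u + be j * v)) <= A1 * E.
  move=> uE vE; rewrite cmodM cmodX cmod_epsX expr1n mul1r.
  apply: le_trans (cmodD _ _) _; rewrite !cmodM.
  apply: le_trans (lerD (ler_wpM2l (cmod_ge0 _) uE) (ler_wpM2l (cmod_ge0 _) vE)) _.
  by rewrite -mulrDl ler_wpM2r ?(ltW E0)// HA1.
have CrC : C / cmod r <= C by rewrite ler_pdivrMr// ler_peMr.
have Cr0 : 0 <= C / cmod r by rewrite divr_ge0 ?cmod_ge0.
have d1 (j k : 'I_n) : cmod (cmat r r' s j k -
      (eps ^+ k) ^+ ord j * (al j * lead_ r' s k a + be j * lead_ r' s k b)) <= C / cmod r * (2 * E).
  apply: le_trans (HC _ _ _ r1 rr' j k) _; rewrite ler_wpM2l//.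
  by have [] := lb k; lra.
have d2 (j k : 'I_n) : cmod ((eps ^+ k) ^+ ord j * (al j * lead_ r' s k a + be j * lead_ r' s k b) -
    pmx_ (near_col r' s near) j k) <= A1 * (2 / (eta * L) / cmod r).
  rewrite mxE -mulrBr cmodM cmodX cmod_epsX expr1n mul1r /near_col /pat.
  have pos : 0 <= A1 * (2 / (eta * L) / cmod r).
    by rewrite mulr_ge0 ?(ltW A10)// divr_ge0 ?cmod_ge0 ?(ltW eL0).
  case: ifPn => [_|nk]; first by rewrite subrr cmod0.
  have [_ /(_ nk) h] := other k; have h2 := lead_anchor r' s k.
  have q0 := cmod_ge0 (lead_ r' s k (if s k then b else a)).
  have q1 := cmod_ge0 (al j); have q2 := cmod_ge0 (be j); have q3 := HA1 j.
  move: h h2 q0; case: ifP => _ h h2 q0 /=; rewrite h2 !mulr1 !mulr0 ?addr0 ?add0r.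
    rewrite addrAC subrr add0r cmodM ler_pM ?cmod_ge0//; lra.
  rewrite addrK cmodM ler_pM ?cmod_ge0//; lra.
have entry (j k : 'I_n) : cmod (cmat r r' s j k - pmx_ (near_col r' s near) j k) <= W / cmod r.
  rewrite -[cmat r r' s j k](subrK ((eps ^+ k) ^+ ord j * (al j * lead_ r' s k a + be j * lead_ r' s k b))).
  rewrite -addrA; apply: le_trans (cmodD _ _) _.
  apply: le_trans (lerD (d1 j k) (d2 j k)) _.
  rewrite /W le_eqVlt; apply/orP; left; apply/eqP.
  by field; rewrite !gt_eqF.
have cb (j k : 'I_n) : cmod (cmat r r' s j k) <= Bm.
  rewrite -[cmat r r' s j k](subrK ((eps ^+ k) ^+ ord j * (al j * lead_ r' s k a + be j * lead_ r' s k b))).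
  apply: le_trans (cmodD _ _) _; have [l1 l2] := lb k.
  have := entry_bound j k _ _ l1 l2; have := d1 j k.
  have : C / cmod r * (2 * E) <= C * (2 * E).
    by rewrite ler_wpM2r// mulr_ge0 ?(ltW E0).
  rewrite /Bm; lra.
have pb (j k : 'I_n) : cmod (pmx_ (near_col r' s near) j k) <= Bm.
  have [l1 l2] := nb k; rewrite mxE; apply: le_trans (entry_bound j k _ _ l1 l2) _.
  rewrite /Bm; lra.
apply: le_trans (det_perturbation Bm1 cb pb entry) _.
have -> : n`!%:R * (n%:R * Bm ^+ n * (W / cmod r)) = K * W / cmod r by rewrite /K; ring.
by rewrite ler_pdivrMr// [dl * _]mulrC -ler_pdivrMr.
Qed.

End DeterminantLowerBound.

(** * Exponents close to the imaginary axis *)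

Section DeterminantLowerBound2.
Variables (R : realType) (a b : R) (n : nat).
Hypotheses (ab : a < b) (n_gt0 : (0 < n)%N).
Variables (P Q : 'I_n -> {poly R[i]}).
Hypothesis regular : birkhoff_regular P Q.
Local Notation eps := (expi (2%:R * pi / n%:R : R)).
Local Notation ord := (bc_order P Q).
Local Notation al := (fun j => (P j)`_(ord j)).
Local Notation be := (fun j => (Q j)`_(ord j)).
Local Notation pmx_ := (pmx ord al be).
Local Notation kap_ r := (@kap R n r eps).

Definition near_axis (k0 k : 'I_n) : bool := (k == k0) || (eps ^+ k == - eps ^+ k0).

(** The pattern after the exponent k0 and its opposite have crossed the imaginary axis. *)
Definition flip (k0 : 'I_n) (s : 'I_n -> bool) (k : 'I_n) : bool :=
  if near_axis k0 k then ~~ s k else s k.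

Lemma eps_inj (k l : 'I_n) : eps ^+ k = eps ^+ l -> k = l.
Proof.
move=> /eqP; rewrite (eq_prim_root_expr (eps_prim R n_gt0)).
by rewrite !modn_small// => /eqP /val_inj.
Qed.

(* Two of the n roots can be close to the imaginary axis only if they are
   opposite; tilting r by a small angle to either side then moves them strictly to
   either side without any other root crossing. *)
Lemma tilt : exists2 eta, 0 < eta & forall r : R[i], r != 0 ->
  (forall k, eta * cmod r <= `|Re (kap_ r k)|) \/
  exists (k0 : 'I_n) (s : 'I_n -> bool),
  [/\ forall k, ~~ near_axis k0 k -> eta * cmod r <= `|Re (kap_ r k)|,
      (forall k, s k -> Re (kap_ r k) <= 0) /\ (forall k, ~~ s k -> 0 <= Re (kap_ r k)),
      forall k, near_axis k0 k -> k != k0 -> s k = ~~ s k0,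
      \det (pmx_ (pat _ s)) != 0 & \det (pmx_ (pat _ (flip k0 s))) != 0].
Proof.
have [m0 m00 Hm0] := fin_lower_bound (fun k : 'I_n => `|Im (eps ^+ k)|).
pose m := Num.min m0 1; have m_gt0 : 0 < m by rewrite lt_min m00 ltr01.
have m1 : m <= 1 by rewrite ge_min lexx orbT.
have Hm (k : 'I_n) : Im (eps ^+ k) != 0 -> m <= `|Im (eps ^+ k)|.
  by move=> h; rewrite ge_min Hm0 ?normr_gt0.
(* A tilt by [tau] must carry the near exponents across the axis, |Re v| < eta |r| <= tau |Im v|,
   and leave the far ones on their side, |Re| >= e2 |r| > tau |r|. *)
pose e2 := m / 8; pose tau := e2 / 2; pose eta := e2 / 4.
have e20 : 0 < e2 by rewrite divr_gt0.
have eta0 : 0 < eta by rewrite divr_gt0.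
have tau0 : 0 < tau by rewrite divr_gt0.
exists eta => // r r0; have cr : 0 < cmod r by rewrite cmod_gt0.
have [|/existsNP[k0 /negP]] := pselect (forall k, eta * cmod r <= `|Re (kap_ r k)|).
  by left.
rewrite -ltNge => small; right; exists k0.
set v := kap_ r k0 in small.
have cv : cmod v = cmod r by rewrite cmodM cmod_epsX mulr1.
have Imv : cmod r / 2 <= `|Im v|.
  have := cmod_sqr v; rewrite cv -(real_normK (num_real (Re v))) -(real_normK (num_real (Im v))).
  have : `|Re v| <= cmod r / 2 by rewrite (le_trans (ltW small))// mulrC ler_wpM2l ?(ltW cr)// /eta /e2; lra.
  move=> xc E; rewrite leNgt; apply/negP => /ltW yc.
  have := ler_pM (normr_ge0 _) (normr_ge0 _) xc xc.
  have := ler_pM (normr_ge0 _) (normr_ge0 _) yc yc.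
  have : 0 < cmod r * cmod r by rewrite mulr_gt0.
  by move: E; rewrite !expr2; lra.
have far (k : 'I_n) : ~~ near_axis k0 k -> e2 * cmod r <= `|Re (kap_ r k)|.
  move=> nk; rewrite leNgt; apply/negP => hk; case/negP : nk.
  (* [z] is the quotient of the two exponents. If it were not real, then |Im z| >= m and the
     exponent k would be far from the axis; so z is 1 or -1. *)
  pose l := (n - k0 + k)%N; pose z : R[i] := eps ^+ l.
  have vz : kap_ r k = v * z.
    rewrite /v /kap /z -[RHS]mulrA -exprD; congr (_ * _).
    have -> : (k0 + l = n + k)%N by rewrite /l addnA subnKC// ltnW.
    by rewrite exprD (prim_expr_order (eps_prim R n_gt0)) mul1r.
  have Im0 : Im z = 0.
    apply/eqP; apply: contraT => zn0.
    have zE : z = eps ^+ (Ordinal (ltn_pmod l n_gt0)).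
      by rewrite /= (prim_expr_mod (eps_prim R n_gt0)).
    have := Hm (Ordinal (ltn_pmod l n_gt0)); rewrite -zE => /(_ zn0) mz.
    have h1 : Re (kap_ r k) = Re v * Re z - Im v * Im z by rewrite vz ReM.
    have z1 : `|Re z| <= 1 by rewrite (le_trans (Re_le_cmod _))// cmod_epsX.
    have h2 : `|Im v| * `|Im z| <= `|Re v| * `|Re z| + `|Re (kap_ r k)|.
      rewrite -!normrM (_ : Im v * Im z = Re v * Re z - Re (kap_ r k)); last by rewrite h1; ring.
      exact: ler_normB.
    have h3 : `|Re v| * `|Re z| <= eta * cmod r.
      by rewrite -[leRHS]mulr1 ler_pM// ltW.
    have h4 : cmod r / 2 * m <= `|Im v| * `|Im z| by rewrite ler_pM ?(ltW m_gt0) ?divr_ge0 ?(ltW cr).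
    have : cmod r * m > 0 by rewrite mulr_gt0.
    move: h2 h3 h4 hk; rewrite /eta /e2; lra.
  have cz : Re z ^+ 2 = 1.
    by have := cmod_sqr z; rewrite cmod_epsX Im0 expr0n addr0 expr1n.
  have kz : eps ^+ k = eps ^+ k0 * z.
    have : r * eps ^+ k = r * (eps ^+ k0 * z) by rewrite -[LHS]/(kap_ r k) vz /v /kap [RHS]mulrA.
    exact: (mulfI r0).
  move/eqP : cz; rewrite sqrf_eq1 => /orP[/eqP Rz|/eqP Rz].
    have z1 : z = 1 by apply: complex_eqP.
    by rewrite /near_axis; apply/orP; left; apply/eqP/eps_inj; rewrite kz z1 mulr1.
  have z1 : z = -1 by apply: complex_eqP => //=; rewrite Im0 oppr0.
  by rewrite /near_axis; apply/orP; right; rewrite kz z1 mulrN1.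
(* The factor 1 + i tau or 1 - i tau replaces a rotation; its modulus is irrelevant to the
   half-plane pattern. *)
pose W (sg : bool) : R[i] := r * Complex 1 (if sg then tau else - tau).
have ReW sg (k : 'I_n) : Re (W sg * eps ^+ k) = Re (kap_ r k) - (if sg then tau else - tau) * Im (kap_ r k).
  have -> : W sg * eps ^+ k = kap_ r k * Complex 1 (if sg then tau else - tau).
    by rewrite /W /kap; ring.
  by rewrite ReM [Re (Complex _ _)]/= [Im (Complex _ _)]/= mulr1 [Im _ * _]mulrC.
have Wfar sg (k : 'I_n) : ~~ near_axis k0 k ->
    (Re (W sg * eps ^+ k) < 0) = (Re (kap_ r k) < 0) /\ Re (W sg * eps ^+ k) != 0.
  move=> /far fk.
  have Ik : `|Im (kap_ r k)| <= cmod r.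
    by rewrite (le_trans (Im_le_cmod _))// cmodM cmod_epsX mulr1.
  have tI : `|(if sg then tau else - tau) * Im (kap_ r k)| <= tau * cmod r.
    have tn : `|if sg then tau else - tau| = tau by case: (sg); rewrite ?normrN gtr0_norm.
    by rewrite normrM tn ler_wpM2l ?(ltW tau0).
  rewrite ReW; move: tI; rewrite ler_norml => /andP[t1 t2].
  have tt : tau * cmod r < e2 * cmod r by rewrite ltr_pM2r// /tau; lra.
  have [neg|pos] := ltP (Re (kap_ r k)) 0.
    rewrite ltr0_norm// in fk.
    have : Re (kap_ r k) - (if sg then tau else - tau) * Im (kap_ r k) < 0 by lra.
    by move=> h; rewrite h lt_eqF.
  rewrite ger0_norm// in fk.
  have : 0 < Re (kap_ r k) - (if sg then tau else - tau) * Im (kap_ r k) by lra.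
  by move=> h; rewrite ltNge (ltW h) gt_eqF.
have tv : eta * cmod r <= tau * `|Im v|.
  apply: le_trans (ler_wpM2l (ltW tau0) Imv); rewrite /eta /tau.
  by rewrite [leRHS](_ : _ = e2 / 4 * cmod r)//; field.
have Wk0 sg : Re (W sg * eps ^+ k0) != 0 /\
    (Re (W sg * eps ^+ k0) < 0) = (sg == (0 < Im v)).
  rewrite ReW -/v; move: small; rewrite ltr_norml => /andP[s1 s2].
  have [Ip|In] := ltP 0 (Im v).
    rewrite gtr0_norm// in tv; case: sg.
      have h : Re v - tau * Im v < 0 by lra.
      by rewrite h lt_eqF.
    have h : 0 < Re v - - tau * Im v by lra.
    by rewrite gt_eqF// ltNge (ltW h).
  rewrite ler0_norm// in tv; case: sg.
    have h : 0 < Re v - tau * Im v by lra.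
    by rewrite gt_eqF// ltNge (ltW h).
  have h : Re v - - tau * Im v < 0 by lra.
  by rewrite h lt_eqF.
have Wopp sg (k : 'I_n) : eps ^+ k = - eps ^+ k0 -> Re (W sg * eps ^+ k) = - Re (W sg * eps ^+ k0).
  by move=> ->; rewrite mulrN ReN.
have kopp (k : 'I_n) : eps ^+ k = - eps ^+ k0 -> Re (kap_ r k) = - Re v.
  by move=> e; rewrite /v /kap e mulrN ReN.
have Wn0 sg (k : 'I_n) : Re (W sg * eps ^+ k) != 0.
  have [|nk] := boolP (near_axis k0 k); last by case: (Wfar sg k nk).
  rewrite /near_axis => /orP[/eqP ->|/eqP e]; first by case: (Wk0 sg).
  by rewrite (Wopp _ _ e) oppr_eq0; case: (Wk0 sg).
have Wnear sg (k : 'I_n) : near_axis k0 k -> (Re (W (~~ sg) * eps ^+ k) < 0) = ~~ (Re (W sg * eps ^+ k) < 0).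
  have E0 : (Re (W (~~ sg) * eps ^+ k0) < 0) = ~~ (Re (W sg * eps ^+ k0) < 0).
    by rewrite (Wk0 (~~ sg)).2 (Wk0 sg).2; case: sg; case: (0 < Im v).
  rewrite /near_axis => /orP[/eqP ->//|/eqP e]; rewrite !(Wopp _ _ e) !oppr_lt0.
  have := Wn0 sg k0; have := Wn0 (~~ sg) k0; move: E0.
  by case: (ltgtP (Re (W (~~ sg) * eps ^+ k0)) 0); case: (ltgtP (Re (W sg * eps ^+ k0)) 0).
(* The side of the tilt whose pattern is compatible with the signs at [r] itself, so that all
   anchored exponentials have modulus at most 1. *)
pose sg := ((Re v <= 0) == (0 < Im v)).
pose s (k : 'I_n) := Re (W sg * eps ^+ k) < 0.
have sk0 : s k0 = (Re v <= 0).
  by rewrite /s (Wk0 sg).2 /sg; case: (Re v <= 0); case: (0 < Im v).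
have sopp (k : 'I_n) : near_axis k0 k -> k != k0 -> eps ^+ k = - eps ^+ k0 /\ s k = ~~ s k0.
  move=> nk kk0; have e : eps ^+ k = - eps ^+ k0.
    by move: nk; rewrite /near_axis (negbTE kk0) => /eqP.
  by split => //; rewrite /s (Wopp _ _ e) oppr_lt0 ltNge le_eqVlt negb_or (Wn0 sg k0).
exists s; split.
- by move=> k /far; apply: le_trans; rewrite ler_wpM2r ?(ltW cr)// /eta; lra.
- split=> k.
    have [|nk] := boolP (near_axis k0 k); last by rewrite /s (Wfar sg k nk).1 => /ltW.
    have [->|kk0 nk] := eqVneq k k0; first by rewrite sk0.
    by have [e ->] := sopp k nk kk0; rewrite sk0 (kopp _ e) oppr_le0 -ltNge => /ltW.
  have [|nk] := boolP (near_axis k0 k); last by rewrite /s (Wfar sg k nk).1 -leNgt.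
  have [->|kk0 nk] := eqVneq k k0; first by rewrite sk0 -ltNge => _ /ltW.
  by have [e ->] := sopp k nk kk0; rewrite sk0 (kopp _ e) oppr_ge0 negbK.
- by move=> k nk kk0; have [] := sopp k nk kk0.
- exact: half_plane_pattern.
- rewrite (_ : flip k0 s = fun k => Re (W (~~ sg) * eps ^+ k) < 0).
    exact: half_plane_pattern.
  apply/funext => k; rewrite /flip; case: ifPn => nk; first by rewrite Wnear.
  by rewrite /s (Wfar sg k nk).1 (Wfar (~~ sg) k nk).1.
Qed.

End DeterminantLowerBound2.

(** * The lower bound from regularity and separation *)

Section DeterminantLowerBound3.
Variables (R : realType) (a b : R) (n : nat).
Hypotheses (ab : a < b) (n_gt0 : (0 < n)%N).
Variables (P Q : 'I_n -> {poly R[i]}).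
Hypothesis regular : birkhoff_regular P Q.
Local Notation eps := (expi (2%:R * pi / n%:R : R)).
Local Notation ord := (bc_order P Q).
Local Notation al := (fun j => (P j)`_(ord j)).
Local Notation be := (fun j => (Q j)`_(ord j)).
Local Notation pmx_ := (pmx ord al be).
Local Notation lead_ r s := (@lead R a b n r eps s).
Local Notation kap_ r := (@kap R n r eps).
Local Notation bmx_ r s := (@bmx R a b n P Q r eps s).
Local Notation cmat_ := (@cmat R a b n P Q).
Local Notation near_col_ := (@near_col R a b n).
Local Notation near_axis_ := (@near_axis R n).
Local Notation flip_ := (@flip R n).

Lemma pmx_ext p q : p =1 q -> pmx_ p = pmx_ q.
Proof. by move=> pq; apply/matrixP => j k; rewrite !mxE pq. Qed.

(** Multilinearity in the near columns, each of which is (1, z) or (z, 1) with one common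
    exponential z. The coefficient with all near columns flipped is the pattern on the other side of
    the axis. *)
Lemma near_expansion (B : R) (r : R[i]) (k0 : 'I_n) (s : 'I_n -> bool) :
  (forall t : 'I_n -> bool, cmod (\det (pmx_ (pat _ t))) <= B) ->
  (forall k, s k -> Re (kap_ r k) <= 0) -> (forall k, ~~ s k -> 0 <= Re (kap_ r k)) ->
  (forall k, near_axis_ k0 k -> k != k0 -> s k = ~~ s k0) ->
  exists kp z0 c1 c2 : R[i], [/\ cmod kp = b - a /\ cmod z0 <= 1, cmod c1 <= 2 * B, cmod c2 <= B,
    c2 = \det (pmx_ (pat _ (flip_ k0 s))) \/
      (c2 = 0 /\ c1 = \det (pmx_ (pat _ (flip_ k0 s)))) &
    forall h, \det (pmx_ (near_col_ (r + h) s (near_axis_ k0))) =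
      \det (pmx_ (pat _ s)) + c1 * (z0 * cexp (kp * h)) + c2 * (z0 * cexp (kp * h)) ^+ 2].
Proof.
move=> HB sn sp sopp.
pose sgn : R[i] := if s k0 then 1 else -1.
pose kp := sgn * (b - a)%:C * eps ^+ k0.
pose z0 := cexp (sgn * (b - a)%:C * kap_ r k0).
pose z h := z0 * cexp (kp * h).
have ckp : cmod kp = b - a.
  rewrite !cmodM cmod_epsX mulr1 cmodR ger0_norm ?subr_ge0 ?(ltW ab)// /sgn.
  by case: ifP; rewrite ?cmodN cmod1 mul1r.
have cz0 : cmod z0 <= 1.
  rewrite cmod_cexp expR_le1 Re_lead_exponent; case: ifPn => sk.
    by rewrite mul1r mulr_ge0_le0 ?sn// subr_ge0 ltW.
  by rewrite mulN1r mulNr oppr_le0 mulr_ge0 ?sp// subr_ge0 ltW.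
have zl h k : near_axis_ k0 k -> near_col_ (r + h) s (near_axis_ k0) k =
    if s k then (1, z h) else (z h, 1).
  move=> nk; rewrite /near_col nk.
  (* An opposite exponent is anchored at the opposite end; the two signs cancel, so both near
     columns contain the same z. *)
  have E : lead_ (r + h) s k (if s k then b else a) = z h.
    rewrite lead_other /z /z0 -cexpD; congr cexp.
    have [->|kk0] := eqVneq k k0; first by rewrite /kp /kap /sgn; ring.
    have e : eps ^+ k = - eps ^+ k0 by move: nk; rewrite /near_axis (negbTE kk0) => /eqP.
    rewrite (sopp k nk kk0) /kp /kap e /sgn; case: (s k0) => /=; ring.
  by move: E (lead_anchor a b (r + h) s k); case: (s k) => -> ->.
have far h k : ~~ near_axis_ k0 k -> near_col_ (r + h) s (near_axis_ k0) k = pat _ s k.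
  by move=> nk; rewrite /near_col (negbTE nk).
have mix (t u : bool) (x : R[i]) : u = t ->
    (if t then (1 : R[i], x) else (x, 1 : R[i])).1 =
      (if u then (1 : R[i], 0 : R[i]) else (0 : R[i], 1 : R[i])).1 +
       x * (if ~~ u then (1 : R[i], 0 : R[i]) else (0 : R[i], 1 : R[i])).1 /\
    (if t then (1 : R[i], x) else (x, 1 : R[i])).2 =
      (if u then (1 : R[i], 0 : R[i]) else (0 : R[i], 1 : R[i])).2 +
       x * (if ~~ u then (1 : R[i], 0 : R[i]) else (0 : R[i], 1 : R[i])).2.
  by move=> ->; case: t => /=; rewrite ?mulr0 ?mulr1 ?addr0 ?add0r.
have n0 : near_axis_ k0 k0 by rewrite /near_axis eqxx.
have B0 : 0 <= B := le_trans (cmod_ge0 _) (HB s).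
have [[k1 nk1 k10]|no] := pselect (exists2 k1, near_axis_ k0 k1 & k1 != k0); last first.
  (* No opposite exponent, as for odd n: a single near column, and the polynomial is linear. *)
  exists kp, z0, (\det (pmx_ (pat _ (flip_ k0 s)))), 0; split => //.
  - by apply: le_trans (HB _) _; rewrite ler_peMl// ler1n.
  - by rewrite cmod0.
  - by right.
  move=> h; rewrite mul0r addr0 -/(z h) [_ * z h]mulrC.
  have nk k : k != k0 -> ~~ near_axis_ k0 k by move=> kk0; apply/negP => nk; apply: no; exists k.
  apply: (@pmx_linear _ _ _ _ _ _ _ _ k0).
  - by move=> k /nk kn; rewrite far.
  - by move=> k /nk kn; rewrite far// /pat /flip (negbTE kn).
  - by rewrite zl// /pat /flip n0; case: (mix (s k0) (s k0) (z h) erefl).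
  - by rewrite zl// /pat /flip n0; case: (mix (s k0) (s k0) (z h) erefl).
(* Only one of the two near columns is flipped. These patterns enter the middle coefficient alone,
   for which an upper bound is enough. *)
pose sA (k : 'I_n) := if k == k0 then ~~ s k else s k.
pose sB (k : 'I_n) := if k == k1 then ~~ s k else s k.
exists kp, z0, (\det (pmx_ (pat _ sA)) + \det (pmx_ (pat _ sB))), (\det (pmx_ (pat _ (flip_ k0 s)))).
split => //; first by apply: le_trans (cmodD _ _) _; have := HB sA; have := HB sB; lra.
  by left.
move=> h; rewrite -/(z h).
have e1 : eps ^+ k1 = - eps ^+ k0 by move: nk1; rewrite /near_axis (negbTE k10) => /eqP.
have nk k : k != k0 -> k != k1 -> ~~ near_axis_ k0 k.
  move=> kk0 kk1; rewrite /near_axis (negbTE kk0) /=; apply: contra kk1 => /eqP e.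
  by apply/eqP; apply: (@eps_inj R n n_gt0); rewrite e e1.
pose p := near_col_ (r + h) s (near_axis_ k0).
pose p1 (k : 'I_n) := if k == k0 then pat _ s k else p k.
pose p2 (k : 'I_n) := if k == k0 then pat _ sA k else p k.
have D0 : \det (pmx_ p) = \det (pmx_ p1) + z h * \det (pmx_ p2).
  apply: (@pmx_linear _ _ _ _ _ _ _ _ k0).
  - by move=> k kk0; rewrite /p1 (negbTE kk0).
  - by move=> k kk0; rewrite /p2 (negbTE kk0).
  - by rewrite /p zl// /p1 /p2 eqxx /pat /sA eqxx; case: (mix (s k0) (s k0) (z h) erefl).
  - by rewrite /p zl// /p1 /p2 eqxx /pat /sA eqxx; case: (mix (s k0) (s k0) (z h) erefl).
have D1 : \det (pmx_ p1) = \det (pmx_ (pat _ s)) + z h * \det (pmx_ (pat _ sB)).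
  apply: (@pmx_linear _ _ _ _ _ _ _ _ k1).
  - move=> k kk1; rewrite /p1; case: eqVneq => [//|kk0].
    by rewrite /p far//; exact: nk.
  - move=> k kk1; rewrite /p1 /pat /sB (negbTE kk1); case: eqVneq => [//|kk0].
    by rewrite /p far//; exact: nk.
  - by rewrite /p1 (negbTE k10) /p zl// /pat /sB eqxx; case: (mix (s k1) (s k1) (z h) erefl).
  - by rewrite /p1 (negbTE k10) /p zl// /pat /sB eqxx; case: (mix (s k1) (s k1) (z h) erefl).
have D2 : \det (pmx_ p2) = \det (pmx_ (pat _ sA)) + z h * \det (pmx_ (pat _ (flip_ k0 s))).
  apply: (@pmx_linear _ _ _ _ _ _ _ _ k1).
  - move=> k kk1; rewrite /p2; case: eqVneq => [//|kk0].
    by rewrite /p far ?nk// /pat /sA (negbTE kk0).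
  - move=> k kk1; rewrite /p2 /pat /flip; case: eqVneq => [->|kk0].
      by rewrite n0 /sA eqxx.
    by rewrite /p far ?nk// (negbTE (nk _ kk0 kk1)).
  - rewrite /p2 (negbTE k10) /p zl// /pat /flip nk1 /sA (negbTE k10).
    by case: (mix (s k1) (s k1) (z h) erefl).
  - rewrite /p2 (negbTE k10) /p zl// /pat /flip nk1 /sA (negbTE k10).
    by case: (mix (s k1) (s k1) (z h) erefl).
by rewrite D0 D1 D2; ring.
Qed.

Lemma poly_approx_bmx r s j k : poly_approx (fun h => bmx_ (r + h) s j k).
Proof.
have aff (p : {poly R[i]}) : poly_approx (fun h => p.[kap_ (r + h) k]).
  apply: (@poly_approx_ext _ (fun h => (p \Po ((eps ^+ k)%:P * ('X + r%:P))).[h])).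
    by move=> h; rewrite horner_comp !hornerE /kap; congr (p.[_]); ring.
  exact: poly_approx_horner.
have ld x : poly_approx (fun h => lead_ (r + h) s k x).
  pose y : R[i] := eps ^+ k * (x - if s k then a else b)%:C.
  apply: (@poly_approx_ext _ (fun h => cexp (y * r) * cexp (y * h))).
    by move=> h; rewrite -cexpD /lead /kap; congr cexp; rewrite /y; ring.
  by apply: poly_approxM; [exact: poly_approx_cst|exact: poly_approx_cexp].
apply: (@poly_approx_ext _ (fun h => (P j).[kap_ (r + h) k] * lead_ (r + h) s k a +
   (Q j).[kap_ (r + h) k] * lead_ (r + h) s k b)).
  by move=> h; rewrite mxE.
by apply: poly_approxD; apply: poly_approxM; [exact: aff|exact: ld|exact: aff|exact: ld].
Qed.

(** Nondegeneracy is required on a disc around r because the value at the centre is controlled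
    through circles, and for all anchorings because [s] is found only in the course of the proof. *)
Lemma det_lower (c0 : R) : 0 < c0 -> exists2 dl, 0 < dl & exists2 R0, 0 < R0 &
  forall r, R0 <= cmod r ->
  (forall r' s, cmod (r' - r) <= c0 -> \det (bmx_ r' s) != 0) ->
  exists s : 'I_n -> bool, [/\ forall k, s k -> Re (kap_ r k) <= 0,
    forall k, ~~ s k -> 0 <= Re (kap_ r k) &
    dl <= cmod (\det (sbmx a b P Q r eps s ord))].
Proof.
move=> c00.
(* Patterns are coded as finite functions, which form a finite type, so that a single [th] serves
   all nonzero determinants. *)
have [th th0 Hth] := fin_lower_bound (fun t : {ffun 'I_n -> bool} => cmod (\det (pmx_ (pat _ t)))).
have [B B0 HB] := fin_upper_bound (fun t : {ffun 'I_n -> bool} => cmod (\det (pmx_ (pat _ t)))).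
have patE (t : 'I_n -> bool) : pmx_ (pat _ t) = pmx_ (pat _ [ffun k => t k]).
  by apply: pmx_ext => k; rewrite /pat ffunE.
have {}Hth (t : 'I_n -> bool) : \det (pmx_ (pat _ t)) != 0 -> th <= cmod (\det (pmx_ (pat _ t))).
  by rewrite patE => h; apply: Hth; rewrite cmod_gt0.
have {}HB (t : 'I_n -> bool) : cmod (\det (pmx_ (pat _ t))) <= B by rewrite patE.
have [eta eta0 Heta] := tilt n_gt0 regular.
pose c := Num.min c0 1; have c_gt0 : 0 < c by rewrite lt_min c00 ltr01.
have cc0 : c <= c0 by rewrite ge_min lexx.
have c1 : c <= 1 by rewrite ge_min lexx orbT.
have L0 : 0 < b - a by rewrite subr_gt0.
have B20 : 0 < 2 * B by rewrite mulr_gt0.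
have [d1 d10 Hd1] := exp_quadratic_lower L0 c_gt0 th0 B20.
pose dl := Num.min (th / 2) d1.
have dl0 : 0 < dl by rewrite lt_min d10 divr_gt0.
have dlth : dl <= th / 2 by rewrite ge_min lexx.
have dld1 : dl <= d1 by rewrite ge_min lexx orbT.
have [R0 R01 HR0] := det_cmat_approx ab P Q eta0 dl0.
exists dl => //; exists R0; first by rewrite (lt_le_trans _ R01).
move=> r rR0 nz.
have r0 : r != 0 by rewrite -cmod_gt0 (lt_le_trans _ rR0)// (lt_le_trans _ R01).
have cmatE s : cmat_ r r s = sbmx a b P Q r eps s ord.
  by apply/matrixP => j k; rewrite !mxE.
have [far|[k0 [s [far [sn sp] sopp n1 n2]]]] := Heta r r0.
  pose s (k : 'I_n) := Re (kap_ r k) < 0.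
  have sn k : s k -> Re (kap_ r k) <= 0 by move=> /ltW.
  have sp k : ~~ s k -> 0 <= Re (kap_ r k) by rewrite /s -leNgt.
  exists s; split => //.
  have := HR0 r s (fun=> false) rR0 sn sp (fun k _ => far k) r.
  rewrite subrr cmod0 => /(_ ler01).
  rewrite (_ : pmx_ (near_col_ r s _) = pmx_ (pat _ s)); last exact: pmx_ext.
  rewrite cmatE => h.
  have : th <= cmod (\det (pmx_ (pat _ s))).
    apply: Hth; apply: half_plane_pattern => // k.
    rewrite -normr_gt0 (lt_le_trans _ (far k))// mulr_gt0// (lt_le_trans _ rR0)// (lt_le_trans _ R01)//.
  have := cmod_distB (\det (pmx_ (pat _ s))) (\det (sbmx a b P Q r eps s ord)).
  by rewrite cmodBC; lra.
exists s; split => //.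
have [kp [z0 [c1' [c2' [[e1 e2] e3 e4 e5 e6]]]]] := near_expansion HB sn sp sopp.
(* With row factors fixed at [r], [f] remains a locally uniform limit of polynomials in h, and its
   zeros are those of the boundary determinant. *)
pose f h := \det (cmat_ r (r + h) s).
have -> : \det (sbmx a b P Q r eps s ord) = f 0 by rewrite /f addr0 cmatE.
apply: (le_trans dld1 _).
apply: (Hd1 f kp z0 (\det (pmx_ (pat _ s))) c1' c2') => //.
- apply: poly_approx_det => j k.
  apply: (@poly_approx_ext _ (fun h => r ^- ord j * bmx_ (r + h) s j k)).
    by move=> h; rewrite [RHS]mxE.
  by apply: poly_approxM; [exact: poly_approx_cst|exact: poly_approx_bmx].
- move=> h hc; rewrite /f.
  have -> : cmat_ r (r + h) s = diag_mx (\row_j r ^- ord j) *m bmx_ (r + h) s.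
    by apply/matrixP => j k; rewrite mul_diag_mx !mxE.
  rewrite det_mulmx det_diag mulf_neq0//.
    by apply/prodf_neq0 => j _; rewrite mxE invr_eq0 expf_neq0.
  by apply: nz; rewrite addrAC subrr add0r (le_trans hc).
- exact: Hth.
- by apply: le_trans e4 _; lra.
- case: e5 => [->|[-> ->]]; [left|right; split => //]; exact: Hth.
- move=> h hc; rewrite -e6; apply: (le_trans _ dld1).
  apply: HR0 => //; rewrite addrAC subrr add0r; exact: le_trans c1.
Qed.

End DeterminantLowerBound3.

(** * Perturbation by the lower order terms *)

Section GeometricLimits.
Variable R : realType.

(** Nested intervals around [u i] of radius 2 K / 2^i; the limit is the supremum of the left
    ends. *)
Lemma real_geometric_limit (u : nat -> R) (K : R) :
  (forall i, `|u i.+1 - u i| <= K * 2^-1 ^+ i) ->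
  exists l, forall i, `|l - u i| <= 2 * K * 2^-1 ^+ i.
Proof.
move=> h; pose lo i := u i - 2 * K * 2^-1 ^+ i; pose up i := u i + 2 * K * 2^-1 ^+ i.
have step i : lo i <= lo i.+1 /\ up i.+1 <= up i.
  have := h i; rewrite /lo /up exprS ler_norml => /andP[h1 h2]; split; lra.
have K0 : 0 <= K by have := h 0%N; rewrite expr0 mulr1; exact: le_trans.
have lu i : lo i <= up i.
  rewrite /lo /up; have : 0 <= 2 * K * 2^-1 ^+ i by rewrite !mulr_ge0// exprn_ge0.
  lra.
have lo_mono i k : lo i <= lo (i + k)%N.
  by elim: k => [|k IH]; rewrite ?addn0// addnS (le_trans IH)//; case: (step (i + k)%N).
have up_mono i k : up (i + k)%N <= up i.
  by elim: k => [|k IH]; rewrite ?addn0// addnS (le_trans _ IH)//; case: (step (i + k)%N).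
have lu2 i j : lo i <= up j.
  by rewrite (le_trans (lo_mono i j))// (le_trans (lu _))// addnC.
pose E := [set lo i | i in [set: nat]].
have hE : has_sup E.
  split; first by exists (lo 0%N); exists 0%N.
  by exists (up 0%N) => _ [i _ <-].
exists (sup E) => i; rewrite ler_norml; apply/andP; split.
  have : lo i <= sup E by apply: ub_le_sup; [case: hE|exists i].
  rewrite /lo; lra.
have : sup E <= up i.
  by apply: ge_sup; [case: hE|move=> _ [j _ <-]; exact: lu2].
rewrite /up; lra.
Qed.

Lemma complex_geometric_limit (u : nat -> R[i]) (K : R) :
  (forall i, cmod (u i.+1 - u i) <= K * 2^-1 ^+ i) ->
  exists l, forall i, `|Re l - Re (u i)| <= 2 * K * 2^-1 ^+ i /\
    `|Im l - Im (u i)| <= 2 * K * 2^-1 ^+ i.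
Proof.
move=> h.
have hR i : `|Re (u i.+1) - Re (u i)| <= K * 2^-1 ^+ i.
  by rewrite -ReB; apply: le_trans (Re_le_cmod _) _.
have hI i : `|Im (u i.+1) - Im (u i)| <= K * 2^-1 ^+ i.
  by rewrite -ImB; apply: le_trans (Im_le_cmod _) _.
have [lR HR] := @real_geometric_limit (fun i => Re (u i)) K hR.
have [lI HI] := @real_geometric_limit (fun i => Im (u i)) K hI.
by exists (Complex lR lI).
Qed.

Lemma half_pow_small (K e : R) : 0 <= K -> 0 < e -> exists i, K * 2^-1 ^+ i <= e.
Proof.
move=> K0 e0; exists (Num.bound (K / e)).
have h : K / e < (Num.bound (K / e))%:R by apply: archi_boundP; rewrite divr_ge0// ltW.
set i := Num.bound _ in h *.
have p2 : i%:R <= 2 ^+ i :> R by rewrite -natrX ler_nat; apply: ltnW; exact: ltn_expl.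
rewrite exprVn ler_pdivrMr ?exprn_gt0//.
move: h; rewrite ltr_pdivrMr// => /ltW h; apply: le_trans h _.
by rewrite mulrC ler_wpM2l// ltW.
Qed.

Lemma geometric_cvg (u : nat -> R) (l K : R) :
  (forall i, `|l - u i| <= K * 2^-1 ^+ i) -> u @ \oo --> l.
Proof.
move=> h; apply/cvgrPdist_le => e e0.
have K0 : 0 <= K by have := h 0%N; rewrite expr0 mulr1; exact: le_trans.
have [N HN] := half_pow_small K0 e0.
exists N => // i /= Ni; apply: le_trans (h i) _; apply: le_trans HN.
rewrite ler_wpM2l// -(subnK Ni) exprD ler_piMl ?exprn_ge0//.
by rewrite exprn_ile1// invf_le1// ler1n.
Qed.

Lemma geometric_zero (x K : R) : 0 <= K -> (forall i, x <= K * 2^-1 ^+ i) -> x <= 0.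
Proof.
move=> K0 h; rewrite leNgt; apply/negP => x0.
have x20 : 0 < x / 2 by rewrite divr_gt0.
have [i Hi] := half_pow_small K0 x20.
have := le_trans (h i) Hi; lra.
Qed.

End GeometricLimits.

(** * Solving the perturbed boundary value problem by iteration *)

Section PerturbedProblem.
Variables (R : realType) (a b : R) (n : nat).
Hypotheses (ab : a < b) (n_gt0 : (0 < n)%N).
Variables (p : 'I_n.-1 -> R -> R[i]) (P Q : 'I_n -> {poly R[i]}).
Hypothesis Lp : forall k, L1_seg a b (p k).
Variables (m cc : R[i]) (kappa : nat -> R).
Hypothesis cc1 : cmod cc = 1.
Hypothesis kappa0 : forall j, 0 <= kappa j.

Definition norm1 (f : R -> R[i]) : R := rint a b (fun t => cmod (f t)).
Definition lower (Y : nat -> R -> R[i]) (x : R) : R[i] := \sum_(k < n.-1) p k x * Y k x.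
(** Pointwise Lipschitz factor of the lower order terms as a function of the L^1 norm of the
    right-hand side; its integral is the contraction constant. *)
Definition weight (t : R) : R := \sum_(k < n.-1) kappa k * cmod (p k t).

Hypothesis solve : forall g, L1_seg a b g -> exists2 Y, ode_sol a b n m g Y & bc a b P Q Y.
Hypothesis estimate : forall g Y, L1_seg a b g -> ode_sol a b n m g Y -> bc a b P Q Y ->
  forall j x, (j < n)%N -> a <= x <= b -> cmod (Y j x) <= kappa j * norm1 g.
Hypothesis contraction : rint a b weight <= 2^-1.

Lemma norm1_ge0 f : 0 <= norm1 f.
Proof. by apply: rint_ge0 => t _; exact: cmod_ge0. Qed.

Lemma integr_weight : integr a b weight.
Proof. by apply: integr_sum => k _; apply/integrZ/L1_cmod/Lp. Qed.

Lemma weight_ge0 t : 0 <= weight t.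
Proof. by apply: sumr_ge0 => k _; rewrite mulr_ge0 ?cmod_ge0. Qed.

Lemma lower_L1 Y : (forall k, (k < n)%N -> AC_seg a b (Y k)) -> L1_seg a b (lower Y).
Proof.
move=> h; apply: L1_sum => k _.
apply: (@L1_ext _ _ _ (fun x => Y k x * p k x)) => [x _|]; first by rewrite mulrC.
by apply: L1_ACM => //; apply: h; exact: leq_trans (ltn_ord k) (leq_pred n).
Qed.

Lemma lower_bound Y (N : R) t : (forall j, (j < n)%N -> cmod (Y j t) <= kappa j * N) ->
  cmod (lower Y t) <= weight t * N.
Proof.
move=> h; apply: le_trans (cmod_sum _ _ _) _; rewrite /weight mulr_suml.
apply: ler_sum => k _; rewrite cmodM mulrAC mulrC ler_wpM2r ?cmod_ge0//.
by apply: h; exact: leq_trans (ltn_ord k) (leq_pred n).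
Qed.

Lemma lowerB Y Z t : lower Y t - lower Z t = lower (fun k x => Y k x + (-1) * Z k x) t.
Proof. by rewrite /lower -sumrB; apply: eq_bigr => k _; ring. Qed.

Lemma norm1_le f h : L1_seg a b f -> integr a b h ->
  (forall x, a <= x <= b -> cmod (f x) <= h x) -> norm1 f <= rint a b h.
Proof. by move=> hf hh H; apply: rint_le => //; exact: L1_cmod. Qed.

Lemma norm1_weight f N : L1_seg a b f -> 0 <= N ->
  (forall x, a <= x <= b -> cmod (f x) <= weight x * N) -> norm1 f <= 2^-1 * N.
Proof.
move=> hf N0 H; apply: le_trans (_ : rint a b (fun x => N * weight x) <= _).
  apply: norm1_le => //; first by apply: integrZ; exact: integr_weight.
  by move=> x /H; rewrite mulrC.
rewrite rintZ; last exact: integr_weight.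
by rewrite mulrC ler_wpM2r.
Qed.

(** The lower order terms are part of the right-hand side g; from |g|_1 <= |f|_1 + |g|_1 / 2 they
    are absorbed, which gives the factor 2. *)
Lemma perturbed_estimate f Y : L1_seg a b f ->
  ode_sol a b n m (fun x => cc * (f x - lower Y x)) Y -> bc a b P Q Y ->
  forall j x, (j < n)%N -> a <= x <= b -> cmod (Y j x) <= kappa j * (2 * norm1 f).
Proof.
move=> hf SY BY j x jn xab.
have [AY _ _] := SY; have hl := lower_L1 AY.
pose g x := cc * (f x - lower Y x).
have hg : L1_seg a b g.
  apply: L1_Z; apply: L1_D => //.
  by apply: L1_ext (L1_Z (-1) hl) => t _; rewrite mulN1r.
have E := estimate hg SY BY.
have N0 := norm1_ge0 g.
have hlow : norm1 (lower Y) <= 2^-1 * norm1 g.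
  by apply: norm1_weight => // t tab; apply: lower_bound => i hi; exact: E.
have : norm1 g <= norm1 f + norm1 (lower Y).
  rewrite /norm1 -rintD; [|exact: L1_cmod|exact: L1_cmod].
  apply: norm1_le => //; first by apply: integrD; exact: L1_cmod.
  by move=> t _; rewrite cmodM cc1 mul1r; exact: cmodB.
move=> h; apply: le_trans (E j x jn xab) _; rewrite ler_wpM2l//.
by have := norm1_ge0 f; lra.
Qed.

(** Iteration on the right-hand side instead of the solution. Successive differences at t are at
    most [weight t] times a geometric term, so the iterates converge at every t, and domination by
    [weight] puts the limit in L^1. *)
Lemma perturbed_exists f : L1_seg a b f ->
  exists2 Y, ode_sol a b n m (fun x => cc * (f x - lower Y x)) Y & bc a b P Q Y.
Proof.
move=> hf.
(* Outside L^1 any value will do; totality is needed for the choice of a solution operator [S]. *)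
have tot g : exists Y, L1_seg a b g -> ode_sol a b n m g Y /\ bc a b P Q Y.
  have [hg|ng] := pselect (L1_seg a b g); last by exists (fun _ _ => 0).
  by have [Y h1 h2] := solve hg; exists Y.
have [S HS] := choice tot.
pose next g x := cc * (f x - lower (S g) x).
have Lnext g : L1_seg a b g -> L1_seg a b (next g).
  move=> hg; have [[AY _ _] _] := HS g hg; apply: L1_Z; apply: L1_D => //.
  by apply: L1_ext (L1_Z (-1) (lower_L1 AY)) => t _; rewrite mulN1r.
have LB g h : L1_seg a b g -> L1_seg a b h -> L1_seg a b (fun x => g x + (-1) * h x).
  by move=> hg hh; apply: L1_D => //; exact: L1_Z.
have SB g h : L1_seg a b g -> L1_seg a b h -> forall j x, (j < n)%N -> a <= x <= b ->
    cmod (S g j x + (-1) * S h j x) <= kappa j * norm1 (fun x => g x + (-1) * h x).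
  move=> hg hh; have [g1 g2] := HS g hg; have [h1 h2] := HS h hh.
  exact: (estimate (LB _ _ hg hh) (ode_sol_lin (-1) g1 h1) (bc_lin (-1) g2 h2)).
have nextB g h t : L1_seg a b g -> L1_seg a b h -> a <= t <= b ->
    cmod (next g t - next h t) <= weight t * norm1 (fun x => g x + (-1) * h x).
  move=> hg hh tab; rewrite /next -mulrBr cmodM cc1 mul1r cmodBC.
  have -> : f t - lower (S h) t - (f t - lower (S g) t) = lower (S g) t - lower (S h) t by ring.
  by rewrite lowerB; apply: lower_bound => j jn; exact: SB.
pose g i := iter i next (fun x => cc * f x).
have Lg i : L1_seg a b (g i) by elim: i => [|i IH]; [exact: (L1_Z cc hf)|exact: (Lnext _ IH)].
pose D := norm1 (fun x => g 1%N x + (-1) * g 0%N x).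
have D0 : 0 <= D := norm1_ge0 _.
have ND i : norm1 (fun x => g i.+1 x + (-1) * g i x) <= D * 2^-1 ^+ i.
  elim: i => [|i IH]; first by rewrite expr0 mulr1.
  apply: le_trans (_ : 2^-1 * norm1 (fun x => g i.+1 x + (-1) * g i x) <= _).
    apply: norm1_weight; [by apply: LB|exact: norm1_ge0|].
    by move=> x xab; rewrite mulN1r; exact: (nextB (g i.+1) (g i) x (Lg i.+1) (Lg i) xab).
  by rewrite exprS mulrCA ler_wpM2l.
(* [nextB] compares images under [next], so the pointwise bound, and with it the limit, starts at
   [g 1]. *)
have step t i : a <= t <= b ->
    cmod (g i.+2 t - g i.+1 t) <= weight t * D * 2^-1 ^+ i.
  move=> tab; apply: le_trans (nextB (g i.+1) (g i) t (Lg i.+1) (Lg i) tab) _.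
  by rewrite -mulrA ler_wpM2l ?weight_ge0.
have lim t : exists l, a <= t <= b -> forall i,
    `|Re l - Re (g i.+1 t)| <= 2 * (weight t * D) * 2^-1 ^+ i /\
    `|Im l - Im (g i.+1 t)| <= 2 * (weight t * D) * 2^-1 ^+ i.
  have [tab|nt] := pselect (is_true (a <= t <= b)); last by exists 0 => /nt.
  have [l Hl] := @complex_geometric_limit R (fun i => g i.+1 t) (weight t * D) (fun i => step t i tab).
  by exists l.
have [gl Hgl] := choice lim.
have glB t i : a <= t <= b ->
    cmod (gl t - g i.+1 t) <= weight t * (4 * D * 2^-1 ^+ i).
  move=> tab; have [h1 h2] := Hgl t tab i; apply: le_trans (cmod_ReIm _) _.
  by rewrite ReB ImB; apply: le_trans (lerD h1 h2) _; rewrite le_eqVlt; apply/orP; left; apply/eqP; ring.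
have mgl : meas_seg a b gl.
  split.
    apply: (@measurable_fun_cvg _ _ _ _ (fun i x => Re (g i.+1 x))).
      by move=> i; have [] := L1_meas (Lg i.+1).
    move=> x /=; rewrite in_itv/= => xab.
    by apply: (@geometric_cvg _ _ _ (2 * (weight x * D))) => i; case: (Hgl x xab i).
  apply: (@measurable_fun_cvg _ _ _ _ (fun i x => Im (g i.+1 x))).
    by move=> i; have [] := L1_meas (Lg i.+1).
  move=> x /=; rewrite in_itv/= => xab.
  by apply: (@geometric_cvg _ _ _ (2 * (weight x * D))) => i; case: (Hgl x xab i).
have Lgl : L1_seg a b gl.
  apply: (@L1_dom _ _ _ _ (fun x => 4 * D * weight x + cmod (g 1%N x))) => //.
    by apply: integrD; [exact/integrZ/integr_weight|exact: L1_cmod].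
  move=> x xab; rewrite -[gl x](subrK (g 1%N x)); apply: le_trans (cmodD _ _) _.
  by rewrite lerD2r; apply: le_trans (glB x 0%N xab) _; rewrite expr0 mulr1 mulrC.
have NB i : norm1 (fun x => g i.+1 x + (-1) * gl x) <= 2^-1 * (4 * D * 2^-1 ^+ i).
  apply: norm1_weight; [by apply: LB|by rewrite !mulr_ge0// exprn_ge0|].
  by move=> x xab; rewrite mulN1r cmodBC; exact: glB.
(* Both sides are within a multiple of 2^-i of [g i.+2]. *)
have fix_pt t : a <= t <= b -> gl t = next gl t.
  move=> tab; apply/eqP; rewrite -subr_eq0; apply/eqP/cmod_le0.
  apply: (@geometric_zero _ _ (weight t * (4 * D))).
    by rewrite mulr_ge0 ?weight_ge0// mulr_ge0.
  move=> i; rewrite -[gl t](subrK (g i.+2 t)) -addrA.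
  apply: le_trans (cmodD _ _) _.
  have h1 := glB t i.+1 tab.
  have h2 : cmod (g i.+2 t - next gl t) <= weight t * norm1 (fun x => g i.+1 x + (-1) * gl x).
    exact: (nextB (g i.+1) gl t (Lg i.+1) Lgl tab).
  have h3 := ler_wpM2l (weight_ge0 t) (NB i).
  rewrite exprS in h1; lra.
have [h1 h2] := HS gl Lgl; exists (S gl) => //.
by apply: ode_sol_ext h1 => t tab; exact: fix_pt.
Qed.

Lemma perturbed_unique f Y Z : L1_seg a b f ->
  ode_sol a b n m (fun x => cc * (f x - lower Y x)) Y -> bc a b P Q Y ->
  ode_sol a b n m (fun x => cc * (f x - lower Z x)) Z -> bc a b P Q Z ->
  forall j x, (j < n)%N -> a <= x <= b -> Y j x = Z j x.
Proof.
move=> hf SY BY SZ BZ j x jn xab.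
have := @perturbed_estimate (fun=> 0) (fun k x => Y k x + (-1) * Z k x) (L1_cst a b 0).
have S0 : ode_sol a b n m (fun x => cc * (0 - lower (fun k x => Y k x + (-1) * Z k x) x))
    (fun k x => Y k x + (-1) * Z k x).
  apply: ode_sol_ext (ode_sol_lin (-1) SY SZ) => t _.
  by rewrite -lowerB; ring.
move=> /(_ S0 (bc_lin (-1) BY BZ) j x jn xab).
have -> : norm1 (fun=> 0) = 0.
  rewrite /norm1 (_ : (fun=> _) = fun=> 0); last by apply/funext => t; rewrite cmod0.
  by rewrite rint_cst ?mul0r// ltW.
rewrite mulr0 mulr0 => /cmod_le0 /eqP; rewrite mulN1r subr_eq0 => /eqP //.
Qed.

End PerturbedProblem.

(** * Resolvents and Green functions *)

Section OperatorSolutions.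
Variables (R : realType) (a b : R) (n : nat).
Hypotheses (ab : a < b) (n_gt0 : (0 < n)%N).
Variables (p : 'I_n.-1 -> R -> R[i]) (P Q : 'I_n -> {poly R[i]}).
Local Notation ci := (Complex 0 1 : R[i]).
Local Notation T := (diff_oper a b p P Q).

Lemma ciX_inv : (- ci) ^+ n * ci ^+ n = 1.
Proof.
rewrite -exprMn (_ : - ci * ci = 1) ?expr1n//.
by apply: complex_eqP; rewrite ?ReM ?ImM /=; ring.
Qed.

Lemma cmod_ci : cmod ci = 1.
Proof. by rewrite cmodE /= expr0n expr1n add0r sqrtr1. Qed.

Lemma shift_to_ode lam y f : shift_oper T lam y f -> exists Y, [/\ eq_seg a b (Y 0%N) y,
  bc a b P Q Y & ode_sol a b n (ci ^+ n * lam) (fun x => ci ^+ n * (f x - lower p Y x)) Y].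
Proof.
move=> [_ [Y [h1 h2 h3 h4 h5]]]; exists Y; split => //; split => //.
  by move=> k kn x xab; apply/is_derive_segP; exact: h3.
apply: ae_imply h5 => x H xab; have [/is_derive_segP d e] := H xab.
suff <- : Y n x = ci ^+ n * lam * Y 0%N x + ci ^+ n * (f x - lower p Y x) by [].
have : ci ^+ n * (f x + lam * y x) = ci ^+ n * ((- ci) ^+ n * Y n x + lower p Y x) by rewrite e.
rewrite mulrDr [in RHS]mulrDr !mulrA [ci ^+ n * (- ci) ^+ n]mulrC ciX_inv mul1r -h1// => E.
have -> : ci ^+ n * lam * Y 0%N x + ci ^+ n * (f x - lower p Y x) =
  (ci ^+ n * f x + ci ^+ n * lam * Y 0%N x) - ci ^+ n * lower p Y x by ring.
by rewrite E addrK.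
Qed.

Lemma ode_to_shift lam y f Y : L2_seg a b f -> eq_seg a b (Y 0%N) y -> bc a b P Q Y ->
  ode_sol a b n (ci ^+ n * lam) (fun x => ci ^+ n * (f x - lower p Y x)) Y ->
  shift_oper T lam y f.
Proof.
move=> hf Yy BY [AY CY DY].
have AY0 : AC_seg a b (fun x => lam * Y 0%N x) by apply: AC_Z; exact: AY.
split.
  have [M _ HM] := AC_bounded AY0.
  apply: (@L2_ext _ _ _ (fun x => f x + lam * Y 0%N x)) => [x xab|]; first by rewrite Yy.
  by apply: L2_D => //; have [] := L2_bounded (meas_AC AY0) HM.
(* The a.e. derivative of Y_(n-1) as dictated by the equation; it serves as [Y n]. *)
pose Yn x := ci ^+ n * lam * Y 0%N x + ci ^+ n * (f x - lower p Y x).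
exists (fun k => if (k < n)%N then Y k else Yn); split.
- by rewrite n_gt0.
- by move=> k kn; rewrite kn; exact: AY.
- by move=> k kn x xab; rewrite kn (ltnW kn); apply/is_derive_segP; exact: CY.
- move=> j; rewrite -[RHS](BY j); congr (_ + _);
    by apply: eq_bigr => k _; rewrite ltn_ord.
- apply: ae_imply DY => x H xab; rewrite ltnn prednK// leqnn; split.
    by apply/is_derive_segP; exact: H.
  have -> : \sum_(k < n.-1) p k x * (if (k < n)%N then Y k else Yn) x = lower p Y x.
    apply: eq_bigr => k _.
    by have -> : (k < n)%N by rewrite (leq_trans (ltn_ord k))// leq_pred.
  rewrite /Yn -Yy// mulrDr !mulrA ciX_inv !mul1r; ring.
Qed.

Hypothesis Lp : forall k, L1_seg a b (p k).
Variables (lam : R[i]) (kappa : nat -> R).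
Hypothesis kappa0 : forall j, 0 <= kappa j.
Hypothesis solve : forall g, L1_seg a b g ->
  exists2 Y, ode_sol a b n (ci ^+ n * lam) g Y & bc a b P Q Y.
Hypothesis estimate : forall g Y, L1_seg a b g -> ode_sol a b n (ci ^+ n * lam) g Y ->
  bc a b P Q Y ->
  forall j x, (j < n)%N -> a <= x <= b -> cmod (Y j x) <= kappa j * norm1 a b g.
Hypothesis contraction : rint a b (weight p kappa) <= 2^-1.

Lemma cmod_ciX : cmod (ci ^+ n) = 1.
Proof. by rewrite cmodX cmod_ci expr1n. Qed.

(** Boundedness in L^2: the uniform bound |y| <= 2 kappa_0 |f|_1 is squared and integrated, and
    Cauchy-Schwarz supplies the second factor b - a. *)
Lemma resolvent_of_estimate : resolvent_set a b T lam.
Proof.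
split=> [f hf|].
  have [Y SY BY] := perturbed_exists Lp cmod_ciX kappa0 solve estimate contraction (L2_L1 hf).
  exists (Y 0%N); first exact: ode_to_shift SY.
  move=> z /shift_to_ode[Z [Zz BZ SZ]] x xab; rewrite -Zz//.
  exact: (perturbed_unique ab Lp cmod_ciX kappa0 estimate contraction (L2_L1 hf) SZ BZ SY BY).
exists (4 * kappa 0%N ^+ 2 * (b - a) ^+ 2) => y f hf /shift_to_ode[Y [Yy BY SY]].
have E := perturbed_estimate Lp cmod_ciX kappa0 estimate contraction (L2_L1 hf) SY BY.
have [AY _ _] := SY.
have Ey x : a <= x <= b -> cmod (y x) <= kappa 0%N * (2 * norm1 a b f).
  by move=> xab; rewrite -Yy//; exact: E.
have [_ h] := L2_bounded (meas_ext Yy (meas_AC (AY 0%N n_gt0))) Ey.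
apply: le_trans h _; have [_ ->] := L2_integr hf; rewrite -EFinM lee_fin.
have := L2_norm1 ab hf; rewrite -/(norm1 a b f) => h.
have ba : 0 < b - a by rewrite subr_gt0.
rewrite (gtr0_norm ba).
have -> : (kappa 0%N * (2 * norm1 a b f)) ^+ 2 * (b - a) =
  4 * kappa 0%N ^+ 2 * (b - a) * norm1 a b f ^+ 2 by ring.
have -> : 4 * kappa 0%N ^+ 2 * (b - a) ^+ 2 * rint a b (fun x => cmod (f x) ^+ 2) =
  4 * kappa 0%N ^+ 2 * (b - a) * ((b - a) * rint a b (fun x => cmod (f x) ^+ 2)) by ring.
by rewrite ler_wpM2l// mulr_ge0 ?(ltW ba)// mulr_ge0// sqr_ge0.
Qed.

End OperatorSolutions.

(** * From bounds on solutions to bounds on kernels *)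

Section KernelBound.
Variables (R : realType) (a b : R).
Hypothesis ab : a < b.
Local Notation cint := (@cintegral_seg R).

Lemma within_continuous_slice (g : R * R -> R) x : a <= x <= b ->
  {within `[a, b] `*` `[a, b], continuous g} ->
  forall t, a <= t <= b -> forall eps : R, 0 < eps -> exists2 r : R, 0 < r &
    forall s, a <= s <= b -> `|s - t| < r -> `|g (x, s) - g (x, t)| <= eps.
Proof.
move=> xab /subspace_continuousP cg t tab e e0.
have := cg (x, t); rewrite /= !in_itv /= xab tab => /(_ (conj isT isT)).
move=> /cvgrPdist_le /(_ e e0); rewrite /within /= => -[[A B] /= [hA hB] AB].
have [r /= r0 Hr] := (nbhs_ballP _ _).1 hB.
exists r => // s sab st; rewrite distrC.
apply: (AB (x, s)); last by rewrite /= !in_itv /= xab sab.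
split; first exact: nbhs_singleton hA.
by apply: Hr; rewrite /ball /= distrC.
Qed.

Definition tent (t0 h t : R) : R := Num.max 0 (h - `|t - t0|).

Lemma tent_ge0 t0 h t : 0 <= tent t0 h t.
Proof. by rewrite le_max lexx. Qed.

Lemma tent_lip t0 h s t : `|tent t0 h t - tent t0 h s| <= `|t - s|.
Proof.
have h1 := ler_distD s t t0; have h2 := ler_distD t s t0; rewrite (distrC s t) in h2.
apply: le_trans (max0_lip _ _) _; rewrite ler_norml; apply/andP; split; lra.
Qed.

Lemma tent_AC t0 h : AC_seg a b (fun t => (tent t0 h t)%:C).
Proof.
apply: (@AC_locally_lipschitz _ _ _ _ 1 1) => // s t _ st _ _.
rewrite -rmorphB cmodR mul1r; apply: le_trans (tent_lip _ _ _ _) _.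
by rewrite ger0_norm ?subr_ge0.
Qed.

Lemma tent_norm1_gt0 t0 h : 0 < h -> a <= t0 <= b -> 0 < norm1 a b (fun t => (tent t0 h t)%:C).
Proof.
move=> h0 /andP[at0 t0b].
have [c [d [ac cd db near]]] : exists c d, [/\ a <= c, c < d, d <= b &
    forall t, c <= t <= d -> h / 2 <= tent t0 h t].
  have key c d : t0 - h / 2 <= c -> d <= t0 + h / 2 -> forall t, c <= t <= d -> h / 2 <= tent t0 h t.
    move=> hc hd t /andP[ct td]; rewrite /tent le_max; apply/orP; right.
    have : `|t - t0| <= h / 2 by rewrite ler_norml; apply/andP; split; lra.
    lra.
  have [tb|bt] := ltP t0 b.
    exists t0, (Num.min b (t0 + h / 2)); split => //.
    - by rewrite lt_min tb ltrDl divr_gt0.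
    - by rewrite ge_min lexx.
    - by apply: key; rewrite ?ge_min ?lexx ?orbT//; lra.
  exists (Num.max a (t0 - h / 2)), t0; split => //.
  - by rewrite le_max lexx.
  - rewrite gt_max (lt_le_trans ab bt)/=; lra.
  - by apply: key; rewrite ?le_max ?lexx ?orbT//; lra.
have Lt := L1_AC (tent_AC t0 h).
apply: lt_le_trans (rint_sub_le ac (ltW cd) db (L1_cmod Lt) (fun x _ => cmod_ge0 _)).
apply: lt_le_trans (_ : rint c d (fun=> h / 2) <= _).
  by rewrite rint_cst ?(ltW cd)// !mulr_gt0 ?subr_gt0// invr_gt0.
apply: rint_le; [exact: integr_cst|exact: integr_sub ac db (L1_cmod Lt)|].
by move=> x /near h1; rewrite cmodR (le_trans h1)// ler_norm.
Qed.

(* A continuous kernel is recovered from its action on tent functions, which act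
   as approximations of the Dirac mass at t0. *)
Lemma kernel_bound (H0 H : R -> R[i]) (t0 B : R) : a <= t0 <= b ->
  meas_seg a b H0 -> meas_seg a b H ->
  (forall eps : R, 0 < eps -> exists2 r, 0 < r & forall s, a <= s <= b -> `|s - t0| < r ->
     cmod (H0 s - H0 t0) <= eps /\ cmod (H s - H t0) <= eps) ->
  (forall f, AC_seg a b f -> cmod (cint a b (fun t => H0 t * f t) -
      cint a b (fun t => H t * f t)) <= B * norm1 a b f) ->
  cmod (H0 t0 - H t0) <= B.
Proof.
move=> t0ab m0 m1 cont bound; apply/ler_addgt0Pl => e e0.
have e40 : 0 < e / 4 by rewrite divr_gt0.
have [r r0 Hr] := cont _ e40.
pose f t : R[i] := (tent t0 r t)%:C.
have Af : AC_seg a b f := tent_AC t0 r; have Lf := L1_AC Af.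
have N0 := tent_norm1_gt0 r0 t0ab; rewrite -/f in N0.
have f_far s : r <= `|s - t0| -> f s = 0.
  by move=> h; rewrite /f /tent max_l// subr_le0.
have L K : meas_seg a b K -> (forall s, a <= s <= b -> `|s - t0| < r -> cmod (K s - K t0) <= e / 4) ->
    L1_seg a b (fun t => K t * f t).
  move=> mK hK; apply: (@L1_dom _ _ _ _ (fun t => (e / 4 + cmod (K t0)) * cmod (f t))).
  - exact: meas_M mK (meas_AC Af).
  - exact/integrZ/L1_cmod.
  - move=> s sab; rewrite cmodM; have [sr|sr] := ltP `|s - t0| r; last by rewrite f_far// cmod0 !mulr0.
    rewrite ler_wpM2r ?cmod_ge0// -[K s](subrK (K t0)).
    by apply: le_trans (cmodD _ _) _; rewrite lerD2r hK.
have L0 := L H0 m0 (fun s h1 h2 => (Hr s h1 h2).1).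
have L1 := L H m1 (fun s h1 h2 => (Hr s h1 h2).2).
have := bound f Af.
set c := H0 t0 - H t0.
pose D s := (H0 s - H s - c) * f s.
have LD : L1_seg a b D.
  apply: (@L1_ext _ _ _ (fun s => H0 s * f s + (-1) * (H s * f s) + (- c) * f s)) => [s _|].
    by rewrite /D; ring.
  by apply: L1_D; [apply: L1_D => //; exact: L1_Z|exact: L1_Z].
have -> : cint a b (fun t => H0 t * f t) - cint a b (fun t => H t * f t) =
    c * cint a b f + cint a b D.
  rewrite -[- cint a b _]mulN1r -cintZ// -cintD//; last exact: L1_Z.
  rewrite -cintZ// -cintD//; last exact: L1_Z.
  by apply: cint_ext => s _; rewrite /D; ring.
(* A tent is real and nonnegative, so its integral is its L^1 norm and can be cancelled at the end
   without loss. *)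
have cf : cmod (cint a b f) = norm1 a b f.
  rewrite /norm1; have -> : cint a b f = (rint a b (tent t0 r))%:C.
    apply: complex_eqP => //=; rewrite -[LHS]/(rint a b (fun=> 0)) rint_cst ?mul0r//; exact: ltW.
  rewrite cmodR ger0_norm; last by apply: rint_ge0 => x _; exact: tent_ge0.
  by apply: rint_ext => x _; rewrite cmodR ger0_norm ?tent_ge0.
have cD : cmod (cint a b D) <= 2 * (e / 2 * norm1 a b f).
  rewrite /norm1 -rintZ; last exact: L1_cmod.
  apply: cint_bound => //; first exact/integrZ/L1_cmod.
  move=> s sab; rewrite cmodM; have [sr|sr] := ltP `|s - t0| r; last by rewrite f_far// cmod0 !mulr0.
  rewrite ler_wpM2r ?cmod_ge0//; have [h1 h2] := Hr s sab sr.
  have -> : H0 s - H s - c = (H0 s - H0 t0) - (H s - H t0) by rewrite /c; ring.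
  by apply: le_trans (cmodB _ _) _; lra.
have := cmod_distB (c * cint a b f) (- cint a b D); rewrite opprK cmodN cmodM cf => h1 h2.
have : cmod c * norm1 a b f <= (e + B) * norm1 a b f by lra.
by rewrite ler_pM2r.
Qed.

End KernelBound.

(** * Smallness of the decay integrals and of the integral over the circle *)

Section Smallness.
Variable R : realType.

(* Split the integral at |x - t| = eta: the near part is small by absolute
   continuity of the integral, the far part by the exponential factor. *)
Lemma decay_small (a b : R) (g : R -> R[i]) (eps : R) : a < b -> L1_seg a b g -> 0 < eps ->
  exists2 s0, 0 < s0 & forall sg x, s0 <= sg -> a <= x <= b -> decay a b sg g x <= eps.
Proof.
move=> ab hg e0; have I := L1_cmod hg.
have e20 : 0 < eps / 2 by rewrite divr_gt0.
have [d d0 Hd] := rint_abs_continuous I e20.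
have N0 : 0 <= norm1 a b g := norm1_ge0 _ _ _.
(* The window around x has length at most d / 2 < d. The threshold below makes the far part at most
   eps / 2 by way of e^(-y) <= 1 / y. *)
pose eta := d / 4; have eta0 : 0 < eta by rewrite divr_gt0.
exists ((norm1 a b g + 1) / (eps / 2) / eta); first by rewrite !divr_gt0// ltr_wpDl.
move=> sg x hs xab.
have sg0 : 0 <= sg by apply: le_trans hs; rewrite !divr_ge0 ?ltW// ltr_wpDl.
pose u := Num.max a (x - eta); pose v := Num.min b (x + eta).
case/andP : (xab) => ax xb.
have au : a <= u by rewrite le_max lexx.
have ux : u <= x by rewrite ge_max ax lerBlDr lerDl ltW.
have xv : x <= v by rewrite le_min xb lerDl ltW.
have vb : v <= b by rewrite ge_min lexx.
have uv : u <= v := le_trans ux xv.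
have ID := integr_decay x sg0 hg.
have small : rint u v (fun t => cmod (g t)) <= eps / 2.
  have := Hd 1%N (fun=> u) (fun=> v); rewrite !big_ord_recl !big_ord0 !addr0 => H.
  have h : rint u v (fun t => `|cmod (g t)|) < eps / 2.
    apply: H => //; first by move=> i j _ _ _; rewrite !ord1.
    have h1 : x - eta <= u by rewrite le_max lexx orbT.
    have h2 : v <= x + eta by rewrite ge_min lexx orbT.
    rewrite /eta in h1 h2; lra.
  apply: ltW; apply: le_lt_trans h; rewrite le_eqVlt; apply/orP; left; apply/eqP.
  by apply: rint_ext => t _; rewrite ger0_norm ?cmod_ge0.
pose q := expR (- (sg * eta)).
(* The alternative [c1 = c2] occurs when the window reaches past an end of the segment and the outer
   interval is a single point. *)
have far c1 c2 : a <= c1 -> c1 <= c2 -> c2 <= b -> (forall t, c1 <= t <= c2 -> eta <= `|x - t| \/ c1 = c2) ->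
    rint c1 c2 (fun t => expR (- (sg * `|x - t|)) * cmod (g t)) <=
    q * rint c1 c2 (fun t => cmod (g t)).
  move=> h1 h2 h3 h4; rewrite -rintZ; last exact: integr_sub h1 h3 I.
  have [e|ne] := eqVneq c1 c2; first by rewrite e /rint set_itv1 !Rintegral_set1.
  apply: rint_le; [exact: integr_sub h1 h3 ID|exact: integr_sub h1 h3 (integrZ q I)|].
  move=> t /h4[et|e]; last by rewrite e eqxx in ne.
  by rewrite ler_wpM2r ?cmod_ge0// ler_expR lerN2 ler_wpM2l.
have D1 : rint a u (fun t => expR (- (sg * `|x - t|)) * cmod (g t)) <=
    q * rint a u (fun t => cmod (g t)).
  apply: far => // [|t /andP[at_ tu]]; first by rewrite (le_trans ux).
  have [h|h] := leP a (x - eta).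
    have uE : u = x - eta by rewrite /u max_r.
    by left; rewrite ger0_norm; rewrite uE in tu; lra.
  by right; rewrite /u max_l// ltW.
have D3 : rint v b (fun t => expR (- (sg * `|x - t|)) * cmod (g t)) <=
    q * rint v b (fun t => cmod (g t)).
  apply: far => // [|t /andP[vt tb]]; first by rewrite (le_trans au).
  have [h|h] := leP (x + eta) b.
    have vE : v = x + eta by rewrite /v min_r.
    by left; rewrite ler0_norm; rewrite vE in vt; lra.
  by right; rewrite /v min_l// ltW.
have D2 : rint u v (fun t => expR (- (sg * `|x - t|)) * cmod (g t)) <= eps / 2.
  apply: le_trans small; apply: rint_le; [exact: integr_sub ID|exact: integr_sub I|].
  move=> t _; rewrite ler_piMl ?cmod_ge0// expR_le1 oppr_le0 mulr_ge0//.
rewrite /decay (rint_split (le_trans au uv) vb ID) (rint_split au uv (integr_sub (lexx _) vb ID)).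
have tot : rint a u (fun t => cmod (g t)) + rint v b (fun t => cmod (g t)) <= norm1 a b g.
  rewrite /norm1 (rint_split (le_trans au uv) vb I) (rint_split au uv (integr_sub (lexx _) vb I)).
  have : 0 <= rint u v (fun t => cmod (g t)) by apply: rint_ge0 => t _; exact: cmod_ge0.
  lra.
have qs : q * (norm1 a b g + 1) <= eps / 2.
  have y0 : 0 < sg * eta.
    by rewrite mulr_gt0// (lt_le_trans _ hs)// !divr_gt0// ltr_wpDl.
  have h1 : (norm1 a b g + 1) / (eps / 2) <= sg * eta by rewrite -ler_pdivrMr.
  have qy : q * (sg * eta) <= 1.
    rewrite /q expRN ler_pdivrMl ?expR_gt0// mulr1.
    by have := expR_ge1Dx (sg * eta); lra.
  have q0 : 0 <= q := expR_ge0 _.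
  have h2 : q * ((norm1 a b g + 1) / (eps / 2)) <= 1 := le_trans (ler_wpM2l q0 h1) qy.
  by rewrite mulrA ler_pdivrMr// mul1r in h2.
have q0 : 0 <= q := expR_ge0 _.
have := ler_wpM2l q0 tot; lra.
Qed.

(* The integral of a nonnegative function is a supremum over the simple functions
   below it; measurability of [F] is not available for the Green functions. *)
Lemma ge0_integral_le (D : set R) (F S : R -> R) : (forall t, D t -> 0 <= F t <= S t) ->
  (\int[@lebesgue_measure R]_(t in D) (F t)%:E <=
   \int[@lebesgue_measure R]_(t in D) (S t)%:E)%E.
Proof.
move=> FS; rewrite !ge0_integralE; first last.
- by move=> t /FS/andP[]; rewrite lee_fin.
- by move=> t /FS/andP[h1 h2]; rewrite lee_fin (le_trans h1).
apply: ereal_sup_le => _ [h /= hF <-]; exists h => //= t.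
apply: le_trans (hF t) _; rewrite /patch; case: ifP => // /set_mem/FS/andP[_].
by rewrite lee_fin.
Qed.

Lemma indic_itv_integr (a b c d : R) : integr a b (\1_`[c, d]%classic : R -> R).
Proof.
by have := @integrable_indic_itv R c d true false => /integrableS; apply.
Qed.

Lemma indic_itv_rint (a b c d : R) : c <= d -> rint a b (\1_`[c, d]%classic : R -> R) <= d - c.
Proof.
move=> cd; have I := indic_itv_integr a b c d.
rewrite -lee_fin /rint /Rintegral fineK; last exact: integrable_fin_num I.
rewrite integral_indic//; apply: le_trans (le_measure _ _ _ (@subIsetl _ _ _)) _.
- by rewrite inE; apply: measurableI.
- by rewrite inE.
have E := @lebesgue_measure_itv R `[c, d]; rewrite [X in (X <= _)%E]E /= lte_fin.
by case: ltP => // _; rewrite lee_fin subr_ge0.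
Qed.

Lemma sin_outside_zeros (eta t : R) : 0 < eta -> eta <= 1 -> eta <= t <= 2 * pi - eta ->
  ~~ (pi - eta <= t <= pi + eta) -> sin eta <= `|sin t|.
Proof.
move=> eta0 eta1 /andP[t1 t2] nt; have pi2 := pi_ge2 R.
have mono (u v : R) : 0 <= u -> u <= v -> v <= pi / 2 -> sin u <= sin v.
  move=> u0 uv vp; have [->//|ne] := eqVneq u v.
  have iu : u \in `[- (pi / 2), pi / 2] by rewrite in_itv /=; apply/andP; split; lra.
  have iv : v \in `[- (pi / 2), pi / 2] by rewrite in_itv /=; apply/andP; split; lra.
  by apply: ltW; rewrite ltr_sin// lt_neqAle ne.
have side u : eta <= u <= pi - eta -> sin eta <= sin u.
  move=> /andP[u1 u2]; have [h|h] := leP u (pi / 2); first by apply: mono => //; lra.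
  have -> : sin u = sin (pi - u) by rewrite sinB sinpi cospi mul0r mulN1r sub0r opprK.
  by apply: mono; lra.
have [tp|tp] := ltP t (pi - eta).
  by apply: le_trans (side t _) (ler_norm _); apply/andP; split; lra.
have tp2 : pi + eta < t by rewrite ltNge; move: nt; rewrite tp.
have h : sin eta <= sin (t - pi) by apply: side; apply/andP; split; lra.
rewrite sinB sinpi cospi mulr0 subr0 mulrN1 in h.
by apply: le_trans h _; rewrite -normrN ler_norm.
Qed.

(** Domination by a step function with excess [c2] on three intervals, at 0, pi and 2 pi, of lengths
    eta, 2 eta and eta. *)
Lemma integral_step_bound (F : R -> R) (c1 c2 eta : R) : 0 <= c1 -> 0 <= c2 ->
  0 < eta -> eta <= 1 ->
  (forall t, 0 <= t <= 2 * pi -> 0 <= F t) ->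
  (forall t, 0 <= t <= 2 * pi -> F t <= c1 + c2) ->
  (forall t, 0 <= t <= 2 * pi -> sin eta <= `|sin t| -> F t <= c1) ->
  (\int[@lebesgue_measure R]_(t in `[0%R, (2 * pi)%R]) (F t)%:E <=
   (c1 * (2 * pi) + c2 * (4 * eta))%:E)%E.
Proof.
move=> c10 c20 eta0 eta1 F0 F1 F2.
have pi2 := pi_ge2 R.
pose i1 : R -> R := \1_`[0, eta]%classic.
pose i2 : R -> R := \1_`[pi - eta, pi + eta]%classic.
pose i3 : R -> R := \1_`[2 * pi - eta, 2 * pi]%classic.
pose S t := c1 + c2 * (i1 t + i2 t + i3 t).
have ind0 (A : set R) t : 0 <= \1_A t :> R by [].
have FS t : 0 <= t <= 2 * pi -> F t <= S t.
  move=> tt; case/andP : (tt) => t0 t2; have le12 := F1 t tt.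
  have p1 : 0 <= i1 t by []. have p2 : 0 <= i2 t by []. have p3 : 0 <= i3 t by [].
  have big : 1 <= i1 t + i2 t + i3 t -> F t <= S t.
    by move=> h; have := ler_wpM2l c20 h; rewrite mulr1 /S; lra.
  have [h|n1] := leP t eta.
    apply: big; suff : i1 t = 1 by lra.
    by rewrite /i1 indicE mem_set//= in_itv /= t0.
  have [h|n3] := leP (2 * pi - eta) t.
    apply: big; suff : i3 t = 1 by lra.
    by rewrite /i3 indicE mem_set//= in_itv /= h.
  case: (boolP (pi - eta <= t <= pi + eta)) => [h|n2].
    apply: big; suff : i2 t = 1 by lra.
    by rewrite /i2 indicE mem_set//= in_itv.
  have h := F2 t tt (sin_outside_zeros eta0 eta1 _ n2).
  apply: le_trans (h _) _; first by rewrite !ltW.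
  by rewrite /S lerDl mulr_ge0// !addr_ge0.
have I1 : integr 0 (2 * pi) i1 := indic_itv_integr _ _ _ _.
have I2 : integr 0 (2 * pi) i2 := indic_itv_integr _ _ _ _.
have I3 : integr 0 (2 * pi) i3 := indic_itv_integr _ _ _ _.
have I12 := integrD I1 I2; have I123 := integrD I12 I3.
have IS : integr 0 (2 * pi) S := integrD (integr_cst _ _ c1) (integrZ c2 I123).
apply: le_trans (ge0_integral_le (S := S) _) _ => [t /=|].
  by rewrite in_itv /= => tt; rewrite F0// FS.
rewrite -[leLHS]fineK; last exact: integrable_fin_num IS.
rewrite lee_fin -[leLHS]/(rint 0 (2 * pi) S).
rewrite (rintD (integr_cst _ _ c1) (integrZ c2 I123)) rint_cst; last by lra.
rewrite subr0 rintZ// lerD2l ler_wpM2l// (rintD I12 I3) (rintD I1 I2).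
have h1 := @indic_itv_rint 0 (2 * pi) 0 eta (ltW eta0).
have h2 : rint 0 (2 * pi) i2 <= (pi + eta) - (pi - eta) by apply: indic_itv_rint; lra.
have h3 : rint 0 (2 * pi) i3 <= 2 * pi - (2 * pi - eta) by apply: indic_itv_rint; lra.
rewrite -/i1 in h1; lra.
Qed.

End Smallness.

(** * Zeros of the determinant and eigenvalues *)

Section Spectrum.
Variables (R : realType) (a b : R) (n : nat).
Local Notation ci := (Complex 0 1 : R[i]).

(** A value missing from the enumeration has multiplicity 0, so its root subspace is trivial and
    contains no eigenfunction. *)
Lemma enum_eigenvalue (T : oper R) lam0 mu y : eigenvalue_enum a b T lam0 ->
  shift_oper T mu y (fun=> 0) -> ~ eq_seg a b y (fun=> 0) -> exists N, lam0 N = mu.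
Proof.
move=> [_ /(_ mu)[m [e [_ he]] hc]] Ty ny.
have [c [Hc _]] : exists! c : 'rV[R[i]]_m,
    eq_seg a b y (fun x => \sum_(i < m) c 0 i * e i x).
  by apply: he; exists 1%N; exists (fun=> 0).
apply: contrapT => nN; have E : [set N | lam0 N = mu] = `I_0.
  by rewrite II0 -subset0 => N /= NE; apply: nN; exists N.
move: hc; rewrite E => /card_eq_II m0; apply: ny => x /Hc ->.
by apply: big1 => i _; have := leq_ltn_trans (leq0n i) (ltn_ord i); rewrite -{1}m0.
Qed.

Hypotheses (ab : a < b) (n_gt0 : (0 < n)%N).
Variables (P Q : 'I_n -> {poly R[i]}).
Hypotheses (szP : forall j, (size (P j) <= n)%N) (szQ : forall j, (size (Q j) <= n)%N).
Local Notation eps := (expi (2%:R * pi / n%:R) : R[i]).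
Local Notation L0 := (diff_oper a b (fun (_ : 'I_n.-1) (_ : R) => (0 : R[i])) P Q).

Lemma lower0 Y x : lower (fun (_ : 'I_n.-1) (_ : R) => (0 : R[i])) Y x = 0.
Proof. by apply: big1 => k _; rewrite mul0r. Qed.

Lemma det_eigenvalue lam0 r s : eigenvalue_enum a b L0 lam0 -> r != 0 ->
  \det (bmx a b P Q r eps s) = 0 ->
  exists N, powR (cmod (lam0 N)) (n%:R^-1) = cmod r.
Proof.
move=> enum r0 d0.
have [Y [SY BY nY]] := bvp_eigenfunction ab n_gt0 szP szQ r0 (eps_prim R n_gt0) d0.
have [|N NE] := @enum_eigenvalue _ _ ((- ci) ^+ n * r ^+ n) (Y 0%N) enum _ nY.
  apply: (@ode_to_shift _ _ _ _ n_gt0 _ _ _ _ _ _ Y) => //.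
    have AY0 : AC_seg a b (fun=> 0 : R[i]) by exact: AC_cst.
    have b0 x : a <= x <= b -> cmod (0 : R[i]) <= 0 by rewrite cmod0.
    by have [] := L2_bounded (meas_AC AY0) b0.
  rewrite mulrA [ci ^+ n * _]mulrC ciX_inv mul1r.
  by apply: ode_sol_ext SY => x _; rewrite lower0 subr0 mulr0.
exists N; rewrite NE cmodM !cmodX cmodN cmod_ci expr1n mul1r.
rewrite -powR_mulrn ?cmod_ge0// -powRrM mulfV ?powRr1 ?cmod_ge0//.
by rewrite pnatr_eq0 -lt0n.
Qed.

Lemma separated_gap (Rad : nat -> R) (lam : nat -> R[i]) : separated_from n Rad lam ->
  exists2 c, 0 < c & forall l N, c <= `|Rad l - powR (cmod (lam N)) (n%:R^-1)|.
Proof.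
rewrite /separated_from; set E := [set _ | _ in _] => h; exists (inf E) => // l N.
apply: ge_inf; last by exists (l, N).
by exists 0 => _ [u _ <-].
Qed.

(** Half of the gap is used: a zero r' in the disc would yield an eigenvalue with |lam|^(1/n) =
    |r'|, closer to [Rad l] than the gap. The condition [c < Rad l] keeps r' away from 0. *)
Lemma separated_nondegenerate (Rad : nat -> R) lam0 : eigenvalue_enum a b L0 lam0 ->
  separated_from n Rad lam0 -> exists2 c, 0 < c & forall l r, c < Rad l ->
    cmod r = Rad l -> forall r' s, cmod (r' - r) <= c -> \det (bmx a b P Q r' eps s) != 0.
Proof.
move=> enum /separated_gap[c c0 gap]; exists (c / 2); first by rewrite divr_gt0.
move=> l r hl hr r' s hr'; apply/eqP => d0.
have d1 := cmod_distB r r'; have d2 := cmod_distB r' r; rewrite cmodBC in d1.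
have r0 : r' != 0 by rewrite -cmod_gt0; lra.
have [N NE] := det_eigenvalue enum r0 d0.
have := gap l N; rewrite NE leNgt => /negP; apply.
rewrite ltr_norml; apply/andP; split; lra.
Qed.

(** The inequality |sin (k theta)| <= k |sin theta|, by the addition formula. *)
Lemma norm_Im_exp (w : R[i]) k : cmod w = 1 -> `|Im (w ^+ k)| <= k%:R * `|Im w|.
Proof.
move=> w1; elim: k => [|k IH]; first by rewrite expr0 /= normr0 mul0r.
rewrite exprS ImM; apply: le_trans (ler_normD _ _) _; rewrite !normrM.
have h1 : `|Re w| <= 1 by rewrite -w1 Re_le_cmod.
have h2 : `|Re (w ^+ k)| <= 1 by rewrite (le_trans (Re_le_cmod _))// cmodX w1 expr1n.
have h3 := ler_pM (normr_ge0 _) (normr_ge0 _) h1 IH.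
have h4 := ler_wpM2l (normr_ge0 (Im w)) h2.
rewrite -natr1; lra.
Qed.

(** The exponents are i rad w with w^n = e^(it), hence have real parts - rad Im w; [norm_Im_exp]
    bounds all of them from below at once and is the origin of the rate rad |sin t| / n. *)
Lemma circle_root (rad t : R) : 0 <= rad -> let r := ci * (rad%:C * expi (t / n%:R)) in
  [/\ r ^+ n = ci ^+ n * ((rad ^+ n)%:C * expi t), cmod r = rad &
      forall k : 'I_n, rad * `|sin t| / n%:R <= `|Re (kap r eps k)|].
Proof.
move=> rad0 r.
have n0 : n%:R != 0 :> R by rewrite pnatr_eq0 -lt0n.
have tn : expi (t / n%:R) ^+ n = expi t :> R[i].
  by rewrite -expiMn -[X in expi X]mulr_natr divfK.
split.
- by rewrite !exprMn tn rmorphXn.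
- by rewrite /r !cmodM cmod_ci cmodR cmod_expi mul1r mulr1 ger0_norm.
move=> k; pose w := expi (t / n%:R) * eps ^+ k.
have w1 : cmod w = 1 by rewrite /w cmodM cmodX !cmod_expi expr1n mulr1.
have wn : w ^+ n = expi t.
  by rewrite /w exprMn tn exprAC (prim_expr_order (eps_prim R n_gt0)) expr1n mulr1.
have -> : kap r eps k = ci * (rad%:C * w) by rewrite /kap /r /w !mulrA.
have -> : Re (ci * (rad%:C * w)) = - (rad * Im w).
  by rewrite ReM ImM /=; ring.
rewrite normrN normrM (ger0_norm rad0) -mulrA ler_wpM2l//.
rewrite ler_pdivrMr ?ltr0n// mulrC.
by have := norm_Im_exp n w1; rewrite wn.
Qed.

Lemma circle_param (rad : R) (lam : R[i]) : 0 < rad -> cmod lam = rad ->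
  exists t, lam = rad%:C * expi t.
Proof.
move=> rad0 lr; have l0 : lam != 0 by rewrite -cmod_gt0 lr.
by have [t [_ _ E]] := polar_form l0; exists t; rewrite {1}E lr.
Qed.

End Spectrum.

Lemma rint_sum (R : realType) (a b : R) (I : Type) (l : seq I) (F : I -> R -> R) :
  (forall i, integr a b (F i)) ->
  rint a b (fun x => \sum_(i <- l) F i x) = \sum_(i <- l) rint a b (F i).
Proof.
move=> h; elim: l => [|i l IH].
  rewrite big_nil -[RHS](mul0r (rint a b (fun=> 0))) -rintZ; last exact: integr_cst.
  by apply: rint_ext => x _; rewrite big_nil mul0r.
rewrite big_cons -IH -rintD//; last exact: integr_sum.
by apply: rint_ext => x _; rewrite big_cons.
Qed.

(** * Estimates uniform in the spectral parameter *)

Section UniformEstimates.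
Variables (R : realType) (a b : R) (n : nat).
Hypotheses (ab : a < b) (n_gt0 : (0 < n)%N).
Variables (P Q : 'I_n -> {poly R[i]}).
Hypotheses (szP : forall j, (size (P j) <= n)%N) (szQ : forall j, (size (Q j) <= n)%N).
Hypothesis regular : birkhoff_regular P Q.
Local Notation eps := (expi (2%:R * pi / n%:R) : R[i]).
Local Notation ci := (Complex 0 1 : R[i]).
Local Notation L0 := (diff_oper a b (fun (_ : 'I_n.-1) (_ : R) => (0 : R[i])) P Q).

Definition spread (sg : R) (g : R -> R[i]) (x : R) : R :=
  decay a b sg g a + decay a b sg g b + decay a b sg g x.

Lemma poly_scaled_le (q : {poly R[i]}) d : (size q <= d.+1)%N ->
  exists M, forall r e, cmod e = 1 -> 1 <= cmod r -> cmod (r ^- d * q.[r * e]) <= M.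
Proof.
move=> hq; have [C C0 HC] := poly_scaled_bound hq.
exists (C + cmod q`_d) => r e e1 r1.
have rr : cmod (r - r) <= 1 by rewrite subrr cmod0.
have h := HC r r e e1 r1 rr; rewrite -[_ * _](subrK (e ^+ d * q`_d)).
apply: le_trans (cmodD _ _) _; apply: lerD.
  apply: le_trans h _; rewrite ler_pdivrMr ?(lt_le_trans ltr01)//.
  by rewrite ler_peMr.
by rewrite cmodM cmodX e1 expr1n mul1r.
Qed.

Lemma cmod_eps (k : 'I_n) : cmod (eps ^+ k) = 1.
Proof. by rewrite cmodX cmod_expi expr1n. Qed.

(** The rate [sg] stays free: 0 is enough for the contraction and the resolvent, while the
    difference of the Green functions needs the true rate. *)
Lemma bvp_uniform c0 : 0 < c0 -> exists2 K, 0 <= K & exists2 R0, 1 <= R0 &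
  forall r, R0 <= cmod r ->
  (forall r' s, cmod (r' - r) <= c0 -> \det (bmx a b P Q r' eps s) != 0) ->
  (forall g, L1_seg a b g -> exists2 Y, ode_sol a b n (r ^+ n) g Y & bc a b P Q Y) /\
  (forall sg g Y, 0 <= sg -> (forall k : 'I_n, sg <= `|Re (kap r eps k)|) ->
     L1_seg a b g -> ode_sol a b n (r ^+ n) g Y -> bc a b P Q Y ->
     forall j x, (j < n)%N -> a <= x <= b ->
       cmod (Y j x) <= K * (cmod r ^+ j.+1 / cmod r ^+ n) * spread sg g x).
Proof.
move=> c00; have [dl dl0 [R0 R00 HR0]] := det_lower ab n_gt0 regular c00.
have [M HM] := choice (fun j => poly_scaled_le (size_P P Q j)).
have [N HN] := choice (fun j => poly_scaled_le (size_Q P Q j)).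
have [B1 B10 HB1] := fin_upper_bound M.
have [B2 B20 HB2] := fin_upper_bound N.
pose B := Num.max B1 B2; have B0 : 0 <= B by rewrite le_max ltW.
exists (bvp_const n dl B); first exact: bvp_const_ge0.
exists (Num.max 1 R0); first by rewrite le_max lexx.
move=> r; rewrite ge_max => /andP[r1 rR0] nd.
have r0 : r != 0 by rewrite -cmod_gt0 (lt_le_trans ltr01).
have [s [s1 s2 hd]] := HR0 r rR0 nd.
split=> [g hg|sg g Y sg0 hs hg SY BY j x jn xab].
  apply: (bvp_exists n_gt0 szP szQ r0 (eps_prim R n_gt0) (s := s)) => //.
  by apply: nd; rewrite subrr cmod0 ltW.
apply: (bvp_estimate ab n_gt0 szP szQ r0 (eps_prim R n_gt0) dl0 B0 sg0 hd) => //.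
- move=> i k; apply: le_trans (HM i r _ (cmod_eps k) r1) _.
  by rewrite le_max HB1.
- move=> i k; apply: le_trans (HN i r _ (cmod_eps k) r1) _.
  by rewrite le_max HB2 orbT.
- by move=> k /s1 h; have := hs k; rewrite ler0_norm//; lra.
- by move=> k /s2 h; have := hs k; rewrite ger0_norm.
Qed.

Variable p : 'I_n.-1 -> R -> R[i].
Hypothesis Lp : forall k, L1_seg a b (p k).
Local Notation L := (diff_oper a b p P Q).

Definition total_norm1 : R := \sum_(k < n.-1) norm1 a b (p k).

Definition total_spread (sg x : R) : R := \sum_(k < n.-1) spread sg (p k) x.

Lemma total_norm1_ge0 : 0 <= total_norm1.
Proof. by apply: sumr_ge0 => k _; exact: norm1_ge0. Qed.

Lemma spread_le sg g x : 0 <= sg -> L1_seg a b g -> spread sg g x <= 3 * norm1 a b g.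
Proof.
move=> sg0 hg; have h y : decay a b sg g y <= norm1 a b g by exact: decay_le.
have -> : 3 * norm1 a b g = norm1 a b g + norm1 a b g + norm1 a b g by ring.
by rewrite !lerD.
Qed.

Lemma total_spread_le sg x : 0 <= sg -> total_spread sg x <= 3 * total_norm1.
Proof.
move=> sg0; rewrite mulr_sumr; apply: ler_sum => k _; exact: spread_le.
Qed.

Lemma total_spread_small (e : R) : 0 < e -> exists2 s0, 0 < s0 & forall sg x, s0 <= sg ->
  a <= x <= b -> total_spread sg x <= e.
Proof.
move=> e0; have d0 : 0 < e / (3 * (n.-1)%:R + 1).
  by rewrite divr_gt0// ltr_wpDl// mulr_ge0.
have H k : exists s0, forall sg x, s0 <= sg -> a <= x <= b ->
    decay a b sg (p k) x <= e / (3 * (n.-1)%:R + 1).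
  by have [s0 _ h] := decay_small ab (Lp k) d0; exists s0.
have [s Hs] := choice H; have [s0 s00 hs] := fin_upper_bound s.
exists s0 => // sg x hsg xab.
have ha : a <= a <= b by rewrite lexx ltW.
have hb : a <= b <= b by rewrite lexx andbT ltW.
apply: le_trans (_ : \sum_(k < n.-1) 3 * (e / (3 * (n.-1)%:R + 1)) <= _).
  apply: ler_sum => k _; have h := le_trans (hs k) hsg.
  have -> (u : R) : 3 * u = u + u + u by ring.
  exact: lerD (lerD (Hs k sg a h ha) (Hs k sg b h hb)) (Hs k sg x h xab).
rewrite sumr_const card_ord -[X in X <= _]mulr_natr.
have -> : 3 * (e / (3 * n.-1%:R + 1)) * n.-1%:R = e * (3 * n.-1%:R) / (3 * n.-1%:R + 1) by ring.
rewrite ler_pdivrMr ?ltr_wpDl ?mulr_ge0//; apply: (ler_wpM2l (ltW e0)); by rewrite lerDl.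
Qed.

Section OnePoint.
Variables (K : R) (r lam : R[i]).
Hypotheses (K0 : 0 <= K) (r1 : 1 <= cmod r) (rl : r ^+ n = ci ^+ n * lam).
Hypothesis solve : forall g, L1_seg a b g ->
  exists2 Y, ode_sol a b n (r ^+ n) g Y & bc a b P Q Y.
Hypothesis estimate : forall sg g Y, 0 <= sg ->
  (forall k : 'I_n, sg <= `|Re (kap r eps k)|) ->
  L1_seg a b g -> ode_sol a b n (r ^+ n) g Y -> bc a b P Q Y ->
  forall j x, (j < n)%N -> a <= x <= b ->
    cmod (Y j x) <= K * (cmod r ^+ j.+1 / cmod r ^+ n) * spread sg g x.
Hypothesis large : 6 * K * total_norm1 <= cmod r.

(** The estimate at rate 0; the factor 3 counts the three decay integrals. *)
Definition growth (j : nat) : R := 3 * K * (cmod r ^+ j.+1 / cmod r ^+ n).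

Let r_gt0 : 0 < cmod r := lt_le_trans ltr01 r1.

Lemma growth_ge0 j : 0 <= growth j.
Proof. by rewrite /growth !mulr_ge0// ?invr_ge0 exprn_ge0// ltW. Qed.

Lemma growth_estimate g Y : L1_seg a b g -> ode_sol a b n (ci ^+ n * lam) g Y ->
  bc a b P Q Y -> forall j x, (j < n)%N -> a <= x <= b ->
  cmod (Y j x) <= growth j * norm1 a b g.
Proof.
rewrite -rl => hg SY BY j x jn xab.
apply: le_trans (estimate (lexx 0) (fun k => normr_ge0 _) hg SY BY jn xab) _.
have -> : growth j * norm1 a b g = K * (cmod r ^+ j.+1 / cmod r ^+ n) * (3 * norm1 a b g).
  by rewrite /growth; ring.
rewrite ler_wpM2l ?spread_le//.
by rewrite !mulr_ge0// ?invr_ge0 exprn_ge0// ltW.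
Qed.

(* The term of order n - 1 is absent from the differential expression; this is
   where the gain of a factor |r| comes from. *)
Lemma growth_le (k : 'I_n.-1) : growth k <= 3 * K / cmod r.
Proof.
rewrite /growth ler_wpM2l ?mulr_ge0// -[X in _ <= X]mul1r ler_pdivlMr// mulrAC ler_pdivrMr ?exprn_gt0//.
rewrite mul1r -exprSr ler_weXn2l//.
by have := ltn_ord k; lia.
Qed.

(** The contraction constant is at most 3 K / |r| times the total norm of the coefficients, and
    [large] makes this at most 1/2. *)
Lemma growth_contraction : rint a b (weight p growth) <= 2^-1.
Proof.
have -> : rint a b (weight p growth) = \sum_(k < n.-1) growth k * norm1 a b (p k).
  rewrite /weight rint_sum; first by apply: eq_bigr => k _; rewrite rintZ//; exact: L1_cmod.
  by move=> k; apply/integrZ/L1_cmod.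
apply: le_trans (_ : \sum_(k < n.-1) 3 * K / cmod r * norm1 a b (p k) <= _).
  by apply: ler_sum => k _; rewrite ler_wpM2r ?norm1_ge0// growth_le.
rewrite -mulr_sumr -/total_norm1 mulrAC ler_pdivrMr// [X in _ <= X]mulrC ler_pdivlMr//.
apply: le_trans large; rewrite le_eqVlt; apply/orP; left; apply/eqP; ring.
Qed.

Lemma perturbed_resolvent : resolvent_set a b L lam.
Proof.
apply: (resolvent_of_estimate ab n_gt0 Lp growth_ge0 _ growth_estimate growth_contraction).
by rewrite -rl.
Qed.

(** The general result with zero coefficients, for which the contraction condition is trivial. *)
Lemma unperturbed_resolvent : resolvent_set a b L0 lam.
Proof.
have L1_0 (k : 'I_n.-1) : L1_seg a b (fun=> 0 : R[i]) by exact: L1_cst.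
apply: (resolvent_of_estimate ab n_gt0 L1_0 growth_ge0 _ growth_estimate).
  by rewrite -rl.
have -> : rint a b (weight (fun (_ : 'I_n.-1) (_ : R) => (0 : R[i])) growth) = rint a b (fun=> 0).
  by apply: rint_ext => x _; apply: big1 => k _; rewrite cmod0 mulr0.
by rewrite (rint_cst _ (ltW ab)) mul0r invr_ge0.
Qed.

(** The difference solves the unperturbed problem with right-hand side i^n times the lower order
    terms of y. Those are at most 6 K |f|_1 / |r| times sum |p_k|, and solving contributes K
    |r|^(1-n); the decay integrals act on p_k only, so the bound does not involve f beyond its L^1
    norm. *)
Lemma solution_difference sg f y y0 : 0 <= sg ->
  (forall k : 'I_n, sg <= `|Re (kap r eps k)|) -> L1_seg a b f ->
  shift_oper L lam y f -> shift_oper L0 lam y0 f -> forall x, a <= x <= b ->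
  cmod (y0 x - y x) <= 6 * K ^+ 2 / cmod r ^+ n * total_spread sg x * norm1 a b f.
Proof.
move=> sg0 hsg hf /shift_to_ode[Y [Yy BY SY]] /shift_to_ode[Z [Zy BZ SZ]] x xab.
have AY k : (k < n)%N -> AC_seg a b (Y k) by case: SY => h _ _; exact: h.
have hl := lower_L1 Lp AY.
pose g t := ci ^+ n * lower p Y t.
have hg : L1_seg a b g := L1_Z _ hl.
have SW := ode_sol_lin (-1) SZ SY; rewrite -rl in SW.
have {}SW : ode_sol a b n (r ^+ n) g (fun k x => Z k x + -1 * Y k x).
  by apply: ode_sol_ext SW => t _; rewrite lower0 /g; ring.
have BW := bc_lin (-1) BZ BY.
have E := estimate sg0 hsg hg SW BW n_gt0 xab.
rewrite Yy// Zy// mulN1r in E; apply: le_trans E _.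
have cg t : a <= t <= b -> cmod (g t) <=
    \sum_(k < n.-1) (3 * K / cmod r * (2 * norm1 a b f)) * cmod (p k t).
  move=> tab; rewrite /g cmodM cmod_ciX mul1r; apply: le_trans (cmod_sum _ _ _) _.
  apply: ler_sum => k _; rewrite cmodM mulrC ler_wpM2r ?cmod_ge0//.
  have kn : (k < n)%N := leq_trans (ltn_ord k) (leq_pred n).
  have h := perturbed_estimate Lp (cmod_ciX _ _) growth_ge0 growth_estimate
    growth_contraction hf SY BY kn tab.
  apply: le_trans h _; rewrite ler_wpM2r ?growth_le//.
  by rewrite mulr_ge0// norm1_ge0.
have dg u : decay a b sg g u <= (3 * K / cmod r * (2 * norm1 a b f)) *
    \sum_(k < n.-1) decay a b sg (p k) u.
  rewrite mulr_sumr.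
  have -> : \sum_(k < n.-1) 3 * K / cmod r * (2 * norm1 a b f) * decay a b sg (p k) u =
    rint a b (fun t => \sum_(k < n.-1) 3 * K / cmod r * (2 * norm1 a b f) *
       (expR (- (sg * `|u - t|)) * cmod (p k t))).
    rewrite rint_sum; last by move=> k; apply/integrZ/integr_decay.
    by apply: eq_bigr => k _; rewrite rintZ//; exact: integr_decay.
  apply: rint_le; first exact: integr_decay.
    by apply: integr_sum => k _; apply/integrZ/integr_decay.
  move=> t tab; apply: le_trans (ler_wpM2l (expR_ge0 _) (cg t tab)) _.
  by rewrite mulr_sumr; apply: ler_sum => k _; rewrite mulrCA.
have -> : 6 * K ^+ 2 / cmod r ^+ n * total_spread sg x * norm1 a b f =
  K * (cmod r ^+ 1 / cmod r ^+ n) * ((3 * K / cmod r * (2 * norm1 a b f)) * total_spread sg x).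
  have rn : cmod r != 0 by rewrite gt_eqF.
  by rewrite expr1; field; rewrite ?expf_neq0 ?rn.
rewrite ler_wpM2l//; first by rewrite !mulr_ge0// ?invr_ge0 exprn_ge0// ltW.
rewrite /total_spread /spread !big_split /= !mulrDr.
by rewrite !lerD.
Qed.

(** For fixed x the bound of [solution_difference] is a constant times |f|_1, the hypothesis of
    [kernel_bound]; hence it holds at every t with a right-hand side independent of t. *)
Lemma green_difference G0 G sg : green_function a b L0 G0 -> green_function a b L G ->
  0 <= sg -> (forall k : 'I_n, sg <= `|Re (kap r eps k)|) ->
  forall x t, a <= x <= b -> a <= t <= b ->
  cmod (G0 x t lam - G x t lam) <= 6 * K ^+ 2 / cmod r ^+ n * total_spread sg x.
Proof.
move=> hG0 hG sg0 hsg x t xab tab.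
have [cR0 cI0 H0] := hG0 lam unperturbed_resolvent.
have [cR cI H] := hG lam perturbed_resolvent.
have cont (u : R * R -> R) : {within `[a, b] `*` `[a, b], continuous u} ->
    forall t, a <= t <= b -> forall e : R, 0 < e -> exists2 d : R, 0 < d &
    forall s, a <= s <= b -> `|s - t| < d -> `|u (x, s) - u (x, t)| <= e.
  exact: within_continuous_slice.
have meas (u : R * R -> R) : {within `[a, b] `*` `[a, b], continuous u} ->
    measurable_fun `[a, b] (fun s => u (x, s)).
  by move=> /cont h; apply: within_meas.
apply: (@kernel_bound _ _ _ ab (fun s => G0 x s lam) (fun s => G x s lam)) => //.
- by split; [exact: meas cR0|exact: meas cI0].
- by split; [exact: meas cR|exact: meas cI].
- move=> e e0; have e2 : 0 < e / 2 by rewrite divr_gt0.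
  have [d1 d10 h1] := cont _ cR0 t tab _ e2; have [d2 d20 h2] := cont _ cI0 t tab _ e2.
  have [d3 d30 h3] := cont _ cR t tab _ e2; have [d4 d40 h4] := cont _ cI t tab _ e2.
  exists (Num.min (Num.min d1 d2) (Num.min d3 d4)); first by rewrite !lt_min d10 d20 d30.
  move=> s sab; rewrite !lt_min => /andP[/andP[l1 l2] /andP[l3 l4]].
  have := h1 s sab l1; have := h2 s sab l2; have := h3 s sab l3; have := h4 s sab l4.
  move=> /= k4 k3 k2 k1.
  by rewrite (splitr e); split; apply: le_trans (cmod_ReIm _) _; rewrite ReB ImB lerD.
move=> f Af; have [M _ HM] := AC_bounded Af.
have [hf _] := L2_bounded (meas_AC Af) HM.
have [[/(_ f hf)[y Ty _] _] _] := (perturbed_resolvent, tt).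
have [[/(_ f hf)[y0 Ty0 _] _] _] := (unperturbed_resolvent, tt).
rewrite -(H0 f y0 hf Ty0 x xab) -(H f y hf Ty x xab).
exact: solution_difference (L2_L1 hf) Ty Ty0 _ xab.
Qed.

End OnePoint.

End UniformEstimates.

(** * The bound on the circles *)

Section CircleBound.
Variables (R : realType) (a b : R) (n : nat).
Hypotheses (ab : a < b) (n_gt0 : (0 < n)%N).
Variables (p : 'I_n.-1 -> R -> R[i]) (P Q : 'I_n -> {poly R[i]}).
Hypothesis Lp : forall k, L1_seg a b (p k).
Hypotheses (szP : forall j, (size (P j) <= n)%N) (szQ : forall j, (size (Q j) <= n)%N).
Hypothesis regular : birkhoff_regular P Q.
Local Notation L0 := (diff_oper a b (fun (_ : 'I_n.-1) (_ : R) => (0 : R[i])) P Q).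
Local Notation L := (diff_oper a b p P Q).
Variables (lam0 : nat -> R[i]) (Rad : nat -> R).
Hypothesis enum : eigenvalue_enum a b L0 lam0.
Hypothesis separated : separated_from n Rad lam0.

Lemma circle_bound : exists2 A, 0 <= A & exists R1, forall l, R1 <= Rad l ->
  forall t : R, let lam := (Rad l ^+ n)%:C * expi t in
  [/\ resolvent_set a b L0 lam, resolvent_set a b L lam &
      forall G0 G, green_function a b L0 G0 -> green_function a b L G ->
      forall x y, a <= x <= b -> a <= y <= b ->
      cmod (G0 x y lam - G x y lam) * Rad l ^+ n <=
        A * total_spread a b p (Rad l * `|sin t| / n%:R) x].
Proof.
have [c c0 nd] := separated_nondegenerate ab n_gt0 szP szQ enum separated.
have [K K0 [R0 R01 HK]] := bvp_uniform ab n_gt0 szP szQ regular c0.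
exists (6 * K ^+ 2); first by rewrite mulr_ge0// exprn_ge0.
(* Three thresholds: nondegeneracy of the determinant on the disc, its asymptotics, and the
   contraction. *)
exists (Num.max (c + 1) (Num.max R0 (6 * K * total_norm1 a b p))) => l.
rewrite !ge_max => /andP[cR /andP[R0R large]] t lam.
have R1 : 1 <= Rad l := le_trans R01 R0R.
have Rpos : 0 <= Rad l := le_trans ler01 R1.
have [rn rR sg] := circle_root n_gt0 t Rpos.
move: rn rR sg; set r := Complex 0 1 * _ => rn rR hsg.
have cl : c < Rad l by lra.
rewrite -rR in R1 R0R large.
have [solve est] := HK r R0R (nd l r cl rR).
split.
- exact (unperturbed_resolvent ab n_gt0 K0 R1 rn solve est).
- exact (perturbed_resolvent ab n_gt0 Lp K0 R1 rn solve est large).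
move=> G0 G hG0 hG x y xab yab.
have sg0 : 0 <= Rad l * `|sin t| / n%:R by rewrite !mulr_ge0.
have := green_difference ab n_gt0 Lp K0 R1 rn solve est large hG0 hG sg0 hsg xab yab.
rewrite rR => h; rewrite -ler_pdivlMr; first by rewrite mulrAC in h.
by rewrite exprn_gt0// -rR (lt_le_trans ltr01).
Qed.

End CircleBound.

(** Kernel values off the resolvent sets are unconstrained, so the first conjunct gives the second
    its meaning: on all large circles both kernels are the true Green functions. *)
Theorem theorem1 (R : realType) (a b : R) (n : nat)
    (p : 'I_n.-1 -> R -> R[i]) (P Q : 'I_n -> {poly R[i]})
    (G0 G : R -> R -> R[i] -> R[i])
    (lam0 : nat -> R[i]) (Rad : nat -> R) :
  a < b -> (2 <= n)%N ->
  (forall k, L1_seg a b (p k)) ->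
  (forall j, (size (P j) <= n)%N /\ (size (Q j) <= n)%N) ->
  lin_indep_bc P Q -> normalized_bc P Q -> birkhoff_regular P Q ->
  let L0 := diff_oper a b (fun (_ : 'I_n.-1) (_ : R) => (0 : R[i])) P Q in
  let L := diff_oper a b p P Q in
  green_function a b L0 G0 -> green_function a b L G ->
  eigenvalue_enum a b L0 lam0 ->
  (forall l, 0 < Rad l) -> Rad @ \oo --> +oo ->
  separated_from n Rad lam0 ->
  (\forall l \near \oo, forall lam : R[i], cmod lam = Rad l ^+ n ->
     resolvent_set a b L0 lam /\ resolvent_set a b L lam) /\
  (forall eps : R, 0 < eps ->
     \forall l \near \oo, forall x y : R, a <= x <= b -> a <= y <= b ->
       (circle_integral (Rad l ^+ n)%R
          (fun lam => cmod (G0 x y lam - G x y lam)%R) < eps%:E)%E).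

Proof.
move=> ab n2 Lp sz _ _ regular L0 L hG0 hG enum Rad0 Radoo sep.
have n_gt0 : (0 < n)%N by apply: leq_trans n2.
have szP j : (size (P j) <= n)%N by case: (sz j).
have szQ j : (size (Q j) <= n)%N by case: (sz j).
have [A A0 [R1 H]] := circle_bound ab n_gt0 Lp szP szQ regular enum sep.
have large (M : R) : \forall l \near \oo, M <= Rad l by move/cvgryPge : Radoo; exact.
split.
  move: (large R1); apply: filterS => l hl lam hlam.
  have R0 : 0 < Rad l ^+ n by rewrite exprn_gt0.
  have [t ->] := circle_param R0 hlam.
  by have [h1 h2 _] := H l hl t.
move=> eps eps0.
pose N := total_norm1 a b p; have N0 : 0 <= N := total_norm1_ge0 _ _ _.
have pi0 := pi_gt0 R.
(* Budget: c1 2 pi = eps / 4 from the whole circle, and c2 4 eta <= eps / 4 from the arcs around the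
   real points, where only boundedness is available. *)
pose c1 := eps / (8 * pi); have c10 : 0 < c1 by rewrite divr_gt0// mulr_gt0.
pose c2 := A * (3 * N); have c20 : 0 <= c2 by rewrite !mulr_ge0.
pose eta := Num.min 1 (eps / (16 * (c2 + 1))).
have c21 : 0 < c2 + 1 by rewrite ltr_wpDl.
have eta0 : 0 < eta by rewrite lt_min ltr01 divr_gt0// mulr_gt0.
have eta1 : eta <= 1 by rewrite ge_min lexx.
have d0 : 0 < c1 / (A + 1) by rewrite divr_gt0// ltr_wpDl.
have [s0 s00 small] := total_spread_small ab Lp d0.
have pi2 := pi_ge2 R.
have sin0 : 0 < sin eta by apply: sin_gt0_pi; rewrite eta0 (le_lt_trans eta1)// (lt_le_trans _ pi2)// ltr1n.
(* Off the arcs |sin t| >= sin eta, and this radius makes the rate at least [s0] there. *)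
move: (large (Num.max R1 (s0 * n%:R / sin eta))); apply: filterS => l.
rewrite ge_max => /andP[l1 l2] x y xab yab.
have bound t := let: And3 _ _ h := H l l1 t in h G0 G hG0 hG x y xab yab.
have sg0 t : 0 <= Rad l * `|sin t| / n%:R by rewrite !mulr_ge0// ltW.
pose F t := cmod (G0 x y (Complex (Rad l ^+ n) 0 * expi t) -
  G x y (Complex (Rad l ^+ n) 0 * expi t)) * Rad l ^+ n.
have FA t : F t <= A * total_spread a b p (Rad l * `|sin t| / n%:R) x by exact: bound.
apply: (@le_lt_trans _ _ (c1 * (2 * pi) + c2 * (4 * eta))%:E).
  apply: (@integral_step_bound R F) => //; first exact: ltW.
  - by move=> t _; rewrite mulr_ge0 ?cmod_ge0// exprn_ge0// ltW.
  - move=> t _; apply: le_trans (FA t) _; apply: le_trans (ler_wpM2l A0 (total_spread_le Lp x (sg0 t))) _.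
    by rewrite lerDr ltW.
  - move=> t _ ht; apply: le_trans (FA t) _.
    have hs : s0 <= Rad l * `|sin t| / n%:R.
      rewrite ler_pdivlMr ?ltr0n//; rewrite ler_pdivrMr// in l2; apply: le_trans l2 _.
      by rewrite ler_wpM2l// ltW.
    apply: le_trans (ler_wpM2l A0 (small _ x hs xab)) _.
    have A1 : 0 < A + 1 by rewrite ltr_wpDl.
    by rewrite mulrA ler_pdivrMr// mulrC ler_wpM2l ?(ltW c10)// lerDl.
rewrite lte_fin.
have c1E : c1 * (8 * pi) = eps by rewrite divfK// gt_eqF// mulr_gt0.
have h : eta * (16 * (c2 + 1)) <= eps by rewrite -ler_pdivlMr ?mulr_gt0// ge_min lexx orbT.
move: c1 c2 eta {small d0 FA F bound sin0 l1 l2} c10 c20 c21 eta0 eta1 c1E h => c1 c2 eta *; lra.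
Qed.
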